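(* The field of tensors on $J^2\pi$ $$\omega^2:\theta_2\longmapsto\omega_{\theta_2}\in g^2\otimes\wedge^2T^*_p,\qquad p=\pi_2(\theta_2),$$ where $\omega_{\theta_2}=\omega_H$ for an arbitrary horizontal subspace $H\subset\mathcal A_{\theta_2}$ satisfying $\rho_{2,1}([j_p^3X,j_p^3Y])=0$ for all $j_p^3X,j_p^3Y\in H$, is a differential invariant of the action of $\Gamma$ on the bundle $\pi$; that is, for every point transformation $f$ and every $\theta_2$ in the domain of $f^{(2)}$, the tensor $\omega_{\theta_2}$ at $p$ is carried by $f$ to the tensor $\omega_{f^{(2)}(\theta_2)}$ at $f(p)$.
   Context: All manifolds and maps are smooth. Let $\pi:\mathbb R^2\times\mathbb R^4\to\mathbb R^2$ be the product bundle with base coordinates $(x^1,x^2)=(x,y)$ and fibre coordinates $u^1,\dots,u^4$; its sections $p\mapsto(p,a^0(p),a^1(p),a^2(p),a^3(p))$ are identified with equations $y''=a^3y'^3+a^2y'^2+a^1y'+a^0$. A point transformation is a diffeomorphism $f$ of an open subset of $\mathbb R^2$ onto an open subset of $\mathbb R^2$; $\Gamma$ is the pseudogroup of all point transformations. The lift $f^{(0)}$ sends $(p,u)$ to $(f(p),\tilde u)$, where, with $g=(g^1,g^2)=f^{-1}$, subscripts denoting partial derivatives at $f(p)$, $A=g^1_1+g^1_2t$, $B=g^2_1+g^2_2t$, $Q^i=g^i_{11}+2g^i_{12}t+g^i_{22}t^2$, $J=g^1_1g^2_2-g^1_2g^2_1$, the $\tilde u^i$ are determined by the identity in $t$: $\sum_{i=0}^3\tilde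 u^{i+1}t^i=J^{-1}\bigl(\sum_{i=0}^3u^{i+1}B^iA^{3-i}-AQ^2+BQ^1\bigr)$ (this is the transformation of the coefficients of the equation under the change of variables $f$). $J^k\pi$ is the bundle of $k$-jets of sections of $\pi$, $\pi_k:J^k\pi\to\mathbb R^2$; $j_kS:p\mapsto j^k_pS$; $\Gamma$ acts on $J^k\pi$ by $f^{(k)}(j^k_pS)=j^k_{f(p)}(f^{(0)}\circ S\circ f^{-1})$. A vector field $X$ on the base with flow $f_t$ lifts to the vector field $X^{(k)}$ on $J^k\pi$ with flow $f_t^{(k)}$. $W_p$ is the Lie algebra of $\infty$-jets at $p$ of vector fields on $\mathbb R^2$, $L^k_p\subset W_p$ the jets with zero $k$-jet; $W_p/L^k_p$ is the space of $k$-jets, $T_p=W_p/L^0_p$ is the tangent space, $\rho_{i,j}:W_p/L_p^i\to W_p/L_p^j$ the projection; the Lie bracket induces $[\cdot,\cdot]:W_p/L^k_p\times W_p/L^k_p\to W_p/L^{k-1}_p$. For $\theta_{k+1}=j^{k+1}_pS$, $\theta_k=j^k_pS$, let $\mathcal K_{\theta_{k+1}}$ be the tangent space at $\theta_k$ to the image of $j_kS$, and $\mathcal A_{\theta_{k+1}}=\{j^{k+2}_pX\in W_p/L_p^{k+2}: X^{(k)}_{\theta_k}\in\mathcal K_{\theta_{k+1}}\}$. A 2-dimensional subspace $H\subset\mathcal A_{\theta_{k+1}}$ is horizontal if $\rho_{k+2,0}|_H:H\to T_p$ is an isomorphism; then $\omega_H(X_p,Y_p)=[(\rho_{k+2,0}|_H)^{-1}(X_p),(\rho_{k+2,0}|_H)^{-1}(Y_p)]\in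 W_p/L_p^{k+1}$ for $X_p,Y_p\in T_p$. $g^2\subset L^1_p/L^2_p\cong T_p\otimes S^2T_p^*$ is the 2-dimensional subspace of 2-jets $(X^i_{jk})$ given by $X^2_{11}=0$, $X^1_{11}-2X^2_{12}=0$, $2X^1_{12}-X^2_{22}=0$, $X^1_{22}=0$. For every $\theta_2\in J^2\pi$ horizontal subspaces $H\subset\mathcal A_{\theta_2}$ satisfying the displayed bracket condition exist, $\omega_H$ takes values in $g^2$, and $\omega_H$ does not depend on the choice of such $H$. *)

(* Defs.v *)
(* Real analysis over Stdlib's R, with Coquelicot. *)
From Stdlib Require Import Reals Arith ClassicalEpsilon.
From Coquelicot Require Import Coquelicot.
Open Scope R_scope.

(** * Smooth maps *)

Definition pt : Type := (R * R)%type.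

(* [Ck n D f]: all iterated directional derivatives of [f] of order at most
   [n] exist and are continuous at the points of [D].  For [D] open in a finite
   dimensional space this is the usual class C^n; it is used on R^2 and on
   R x R^2. *)
Fixpoint Ck {U : NormedModule R_AbsRing} (n : nat) (D : U -> Prop) (f : U -> R)
  : Prop :=
  (forall x, D x -> continuous f x) /\
  match n with
  | O => True
  | S m => forall v : U,
      (forall x, D x -> ex_derive (fun s : R => f (plus x (scal s v))) 0) /\
      Ck m D (fun x => Derive (fun s : R => f (plus x (scal s v))) 0)
  end.

Definition smooth {U : NormedModule R_AbsRing} (D : U -> Prop) (f : U -> R)
  : Prop := forall n, Ck n D f.

Definition smooth_map {U : NormedModule R_AbsRing} (D : U -> Prop) (f : U -> pt)
  : Prop := smooth D (fun x => fst (f x)) /\ smooth D (fun x => snd (f x)).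

(* The derivative of order [a] in x and [b] in y. *)
Definition partial (a b : nat) (f : pt -> R) (p : pt) : R :=
  partial_derive a b (fun x y => f (x, y)) (fst p) (snd p).

Definition differential (h : pt -> pt) (p v : pt) : pt :=
  (partial 1 0 (fun q => fst (h q)) p * fst v
     + partial 0 1 (fun q => fst (h q)) p * snd v,
   partial 1 0 (fun q => snd (h q)) p * fst v
     + partial 0 1 (fun q => snd (h q)) p * snd v).

(* The values of [pt_fun] off [pt_dom], and of [pt_inv] off [pt_cod], are
   irrelevant. *)
Record point_transformation := PointTransformation {
  pt_dom : pt -> Prop;
  pt_cod : pt -> Prop;
  pt_fun :> pt -> pt;
  pt_inv : pt -> pt;
  pt_dom_open : open pt_dom;
  pt_cod_open : open pt_cod;
  pt_fun_cod : forall p, pt_dom p -> pt_cod (pt_fun p);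
  pt_inv_dom : forall q, pt_cod q -> pt_dom (pt_inv q);
  pt_funK : forall p, pt_dom p -> pt_inv (pt_fun p) = p;
  pt_invK : forall q, pt_cod q -> pt_fun (pt_inv q) = q;
  pt_fun_smooth : smooth_map pt_dom pt_fun;
  pt_inv_smooth : smooth_map pt_cod pt_inv
}.

(** * Jets *)

Definition mindex (k : nat) : Type :=
  {ab : nat * nat | (fst ab + snd ab <= k)%nat}.

Definition ix {k} (s : mindex k) : nat := fst (proj1_sig s).
Definition iy {k} (s : mindex k) : nat := snd (proj1_sig s).

(* The k-jet at a given point of a function, as the family of its partial
   derivatives of order at most k. *)
Definition fjet (k : nat) (f : pt -> R) (p : pt) : mindex k -> R :=
  fun s => partial (ix s) (iy s) f p.

Definition coef {k} (c : mindex k -> R) (a b : nat) : R :=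
  match le_dec (a + b) k with
  | left h => c (exist _ (a, b) h)
  | right _ => 0
  end.

(* Operations induced on jets by operations on functions are computed on the
   Taylor polynomial, a representative of the jet. *)
Definition taylor {k} (p : pt) (c : mindex k -> R) : pt -> R := fun q =>
  sum_f_R0 (fun a => sum_f_R0 (fun b =>
    coef c a b / (INR (fact a) * INR (fact b))
      * (fst q - fst p) ^ a * (snd q - snd p) ^ b) k) k.

(** * Sections of the bundle and their jets *)

(* [Uj] labels the fibre coordinate u^j, so that [S U1], ..., [S U4] are
   a^0, ..., a^3. *)
Inductive fib := U1 | U2 | U3 | U4.

Definition section : Type := fib -> pt -> R.

(* J^k pi: the base point, and the derivatives of the fibre coordinates.  The
   same type is used for the tangent vectors to J^k pi. *)
Definition J (k : nat) : Type := (pt * (fib -> mindex k -> R))%type.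

Definition jet (k : nat) (S : section) (p : pt) : J k :=
  (p, fun i => fjet k (S i) p).

Definition jet_repr {k} (theta : J k) : section :=
  fun i => taylor (fst theta) (snd theta i).

(** * The action of point transformations *)

Section Lift.

Variables (g : pt -> pt) (q : pt).

Let g1 (a b : nat) : R := partial a b (fun z => fst (g z)) q.
Let g2 (a b : nat) : R := partial a b (fun z => snd (g z)) q.

Definition lift_A (t : R) : R := g1 1 0 + g1 0 1 * t.
Definition lift_B (t : R) : R := g2 1 0 + g2 0 1 * t.
Definition lift_Q1 (t : R) : R := g1 2 0 + 2 * g1 1 1 * t + g1 0 2 * t ^ 2.
Definition lift_Q2 (t : R) : R := g2 2 0 + 2 * g2 1 1 * t + g2 0 2 * t ^ 2.
Definition lift_J : R := g1 1 0 * g2 0 1 - g1 0 1 * g2 1 0.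

(* The coefficients of t^0, ..., t^3 in
   J^-1 (sum_i u^(i+1) B^i A^(3-i) - A Q^2 + B Q^1); see [lift_fibE]. *)
Definition lift_fib (u : fib -> R) (j : fib) : R :=
  let a := g1 1 0 in let b := g1 0 1 in
  let c := g2 1 0 in let d := g2 0 1 in
  match j with
  | U1 => u U1 * a ^ 3 + u U2 * (a ^ 2 * c) + u U3 * (a * c ^ 2) + u U4 * c ^ 3
          - a * g2 2 0 + c * g1 2 0
  | U2 => u U1 * (3 * a ^ 2 * b) + u U2 * (a ^ 2 * d + 2 * a * b * c)
          + u U3 * (2 * a * c * d + b * c ^ 2) + u U4 * (3 * c ^ 2 * d)
          - (2 * a * g2 1 1 + b * g2 2 0) + (2 * c * g1 1 1 + d * g1 2 0)
  | U3 => u U1 * (3 * a * b ^ 2) + u U2 * (2 * a * b * d + b ^ 2 * c)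
          + u U3 * (a * d ^ 2 + 2 * b * c * d) + u U4 * (3 * c * d ^ 2)
          - (a * g2 0 2 + 2 * b * g2 1 1) + (c * g1 0 2 + 2 * d * g1 1 1)
  | U4 => u U1 * b ^ 3 + u U2 * (b ^ 2 * d) + u U3 * (b * d ^ 2) + u U4 * d ^ 3
          - b * g2 0 2 + d * g1 0 2
  end / lift_J.

Lemma lift_fibE (u : fib -> R) (t : R) :
  lift_fib u U1 + lift_fib u U2 * t + lift_fib u U3 * t ^ 2
    + lift_fib u U4 * t ^ 3
  = / lift_J *
    (u U1 * lift_A t ^ 3 + u U2 * lift_B t * lift_A t ^ 2
     + u U3 * lift_B t ^ 2 * lift_A t + u U4 * lift_B t ^ 3
     - lift_A t * lift_Q2 t + lift_B t * lift_Q1 t).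
Proof.
unfold lift_fib, lift_A, lift_B, lift_Q1, lift_Q2, Rdiv; ring.
Qed.

End Lift.

(* f^(0) o S o f^-1, on [pt_cod f]. *)
Definition transform (f : point_transformation) (S : section) : section :=
  fun j q => lift_fib (pt_inv f) q (fun i => S i (pt_inv f q)) j.

(* f^(k), meaningful over [pt_dom f]. *)
Definition prolong (k : nat) (f : point_transformation) (theta : J k) : J k :=
  jet k (transform f (jet_repr theta)) (f (fst theta)).

(** * Lifts of vector fields *)

(* [phi] is the flow of [X] near [p]: [phi t] is constrained for small |t|, on
   a neighbourhood of [p]. *)
Definition local_flow (X : pt -> pt) (p : pt) (phi : R -> point_transformation)
  : Prop :=
  exists (eps : R) (U D : pt -> Prop),
    0 < eps /\ open U /\ U p /\ open D /\ smooth_map D X /\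
    (forall t q, Rabs t < eps -> U q -> pt_dom (phi t) q /\ D (phi t q)) /\
    smooth_map (fun tq : R * pt => Rabs (fst tq) < eps /\ U (snd tq))
               (fun tq : R * pt => pt_fun (phi (fst tq)) (snd tq)) /\
    (forall q, U q -> phi 0 q = q) /\
    (forall t q, Rabs t < eps -> U q ->
       is_derive (fun s : R => phi s q : pt) t (X (phi t q))).

Definition velocity {k} (gamma : R -> J k) (v : J k) : Prop :=
  is_derive (fun t : R => fst (gamma t) : pt) 0 (fst v) /\
  forall i s, is_derive (fun t : R => snd (gamma t) i s) 0 (snd v i s).

(* [v] is the value at [theta] of X^(k). *)
Definition lifted_vector (k : nat) (X : pt -> pt) (theta v : J k) : Prop :=
  exists phi, local_flow X (fst theta) phi /\
    velocity (fun t => prolong k (phi t) theta) v.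

(* The projection of theta_(k+1) to J^k pi. *)
Definition jet_proj {k} (theta : J (S k)) : J k :=
  jet k (jet_repr theta) (fst theta).

(* The subspace K of the tangent space to J^k pi at [jet_proj theta]. *)
Definition jet_tangent {k} (theta : J (S k)) (v : J k) : Prop :=
  exists w : pt,
    velocity (fun s : R => jet k (jet_repr theta) (plus (fst theta) (scal s w))) v.

(** * Jets of vector fields *)

(* W_p / L^k_p.  An element gives the derivatives of both components. *)
Definition vjets (k : nat) : Type := mindex k -> pt.

Definition vjet (k : nat) (X : pt -> pt) (p : pt) : vjets k :=
  fun s => (fjet k (fun q => fst (X q)) p s, fjet k (fun q => snd (X q)) p s).

Definition vcoef {k} (c : vjets k) (a b : nat) : pt :=
  (coef (fun s => fst (c s)) a b, coef (fun s => snd (c s)) a b).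

Definition vjet_repr {k} (p : pt) (c : vjets k) : pt -> pt :=
  fun q => (taylor p (fun s => fst (c s)) q, taylor p (fun s => snd (c s)) q).

Definition vjet_add {k} (c d : vjets k) : vjets k := fun s => plus (c s) (d s).
Definition vjet_scal {k} (r : R) (c : vjets k) : vjets k := fun s => scal r (c s).
Definition vjet_zero {k} : vjets k := fun _ => zero.

(* rho_(k,j), for j <= k. *)
Definition rho {k} (j : nat) (c : vjets k) : vjets j :=
  fun s => vcoef c (ix s) (iy s).

(* rho_(k,0), with W_p / L^0_p identified with R^2. *)
Definition rho0 {k} (c : vjets k) : pt := vcoef c 0 0.

Definition lie (X Y : pt -> pt) : pt -> pt := fun q =>
  minus (differential Y q (X q)) (differential X q (Y q)).

Definition jet_bracket {k} (p : pt) (c d : vjets (S k)) : vjets k :=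
  vjet k (lie (vjet_repr p c) (vjet_repr p d)) p.

(* The subspace A of W_p / L^(k+2)_p attached to theta_(k+1). *)
Definition jet_symmetries {k} (theta : J (S k)) (c : vjets (S (S k))) : Prop :=
  exists (X : pt -> pt) (v : J k),
    (exists D : pt -> Prop, open D /\ D (fst theta) /\ smooth_map D X) /\
    c = vjet (S (S k)) X (fst theta) /\
    lifted_vector k X (jet_proj theta) v /\
    jet_tangent theta v.

(* The bijectivity of rho_(k+2,0) on [H] forces dim H = 2. *)
Definition horizontal {k} (theta : J (S k)) (H : vjets (S (S k)) -> Prop)
  : Prop :=
  H vjet_zero /\
  (forall c d, H c -> H d -> H (vjet_add c d)) /\
  (forall r c, H c -> H (vjet_scal r c)) /\
  (forall c, H c -> jet_symmetries theta c) /\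
  (forall v : pt, exists! c, H c /\ rho0 c = v).

(** * The tensor field omega^2 *)

(* T_p (x) S^2 T_p^* as maps T_p x T_p -> T_p. *)
Definition quad_tensor : Type := pt -> pt -> pt.

(* The isomorphism from L^1_p / L^2_p to T_p (x) S^2 T_p^*, applied to the
   second order part of a 2-jet. *)
Definition quad_part (z : vjets 2) : quad_tensor := fun xi eta =>
  let comp (pr : pt -> R) :=
    pr (vcoef z 2 0) * (fst xi * fst eta)
    + pr (vcoef z 1 1) * (fst xi * snd eta + snd xi * fst eta)
    + pr (vcoef z 0 2) * (snd xi * snd eta) in
  (comp fst, comp snd).

Definition in_g2 (B : quad_tensor) : Prop :=
  exists z : vjets 2,
    rho 1 z = vjet_zero /\ B = quad_part z /\
    snd (vcoef z 2 0) = 0 /\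
    fst (vcoef z 2 0) - 2 * snd (vcoef z 1 1) = 0 /\
    2 * fst (vcoef z 1 1) - snd (vcoef z 0 2) = 0 /\
    fst (vcoef z 0 2) = 0.

(* Tensors of type T (x) T^* (x) T^* (x) T^* (x) T^*: the first two arguments
   are those of the 2-form. *)
Definition tensor : Type := pt -> pt -> quad_tensor.

Definition tensor_zero : tensor := fun _ _ _ _ => zero.

Definition in_g2_wedge2 (tau : tensor) : Prop :=
  (forall v w, in_g2 (tau v w)) /\
  (forall v xi eta, tau v v xi eta = zero) /\
  (forall v v' w xi eta,
     tau (plus v v') w xi eta = plus (tau v w xi eta) (tau v' w xi eta)) /\
  (forall r v w xi eta, tau (scal r v) w xi eta = scal r (tau v w xi eta)) /\
  (forall v w w' xi eta,
     tau v (plus w w') xi eta = plus (tau v w xi eta) (tau v w' xi eta)) /\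
  (forall r v w xi eta, tau v (scal r w) xi eta = scal r (tau v w xi eta)).

(* [tau] is omega_H for some horizontal [H] on which the brackets have zero
   1-jet; the brackets then lie in L^1_p / L^2_p. *)
Definition is_omega2 (theta : J 2) (tau : tensor) : Prop :=
  exists H : vjets 3 -> Prop,
    horizontal theta H /\
    (forall c d, H c -> H d ->
       rho 1 (jet_bracket (fst theta) c d) = vjet_zero) /\
    (forall c d, H c -> H d ->
       tau (rho0 c) (rho0 d) = quad_part (jet_bracket (fst theta) c d)).

(* Such a tensor always exists and is unique, so that neither the choice nor the
   default value matters. *)
Definition omega2 (theta : J 2) : tensor :=
  match excluded_middle_informative (exists tau, is_omega2 theta tau) with
  | left h => proj1_sig (constructive_indefinite_description _ h)
  | right _ => tensor_zero
  end.

Definition push_tensor (f : point_transformation) (p : pt) (tau : tensor)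
  : tensor := fun v w xi eta =>
  let dg := differential (pt_inv f) (f p) in
  differential f p (tau (dg v) (dg w) (dg xi) (dg eta)).

(* Main.v *)
(** A vector field with flow [phi] whose prolongation is tangent to the graph of
    [j_1 S] satisfies linear equations on its 3-jet, obtained by differentiating
    [(phi t)^-1 (phi t theta_1) = theta_1] at [t = 0].  They imply that for any
    horizontal [H] with brackets of zero 1-jet, the second order part of the
    bracket is given by the two relative invariants of Liouville, whatever [H].
    This gives uniqueness of [omega^2] and its values in g^2.

    Conversely, a point transformation [f] conjugates flows, hence carries
    symmetry jets at [theta_2] to symmetry jets at [f^(2) theta_2], compatibly
    with brackets; so it carries an admissible [H] to an admissible [H].  Applied
    to [f] and to its inverse, this shows that admissible subspaces exist at both
    points or at neither, so no existence theorem for flows is needed. *)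

(* Two facts shape the calculus. [Ck] only supplies continuous directional derivatives, so the chain
   rule and the symmetry of second derivatives are derived from these, on the plane and on R x R^2,
   where a flow lives; joint smoothness in (t, q) is what allows time and space derivatives to be
   exchanged. Operations on jets are computed on Taylor polynomials, so each one must be shown to
   depend on the jet alone.

   The elimination is a matter of counting. The 3-jet of a vector field has 20 coefficients. Once
   its value is fixed, tangency gives 12 equations, one for each coefficient of the ODE and for each
   of its two first derivatives; four first and two second derivatives stay free. For two symmetries
   lifting the coordinate frame, the 1-jet of the bracket gives six equations: two relate first
   derivatives, four fix the four free second derivatives. The second order part of the bracket is
   then the map sending (xi, eta) to lambda(xi) eta + lambda(eta) xi, with lambda = L1 dx + L2 dy
   built from the two Liouville invariants. The elements of g^2 are exactly the maps of this
   shape. *)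
From Stdlib Require Import Reals Arith Lra Lia.
From Stdlib Require Import FunctionalExtensionality ProofIrrelevance Classical ClassicalEpsilon.
From Coquelicot Require Import Coquelicot.
Require Import Defs.
Open Scope R_scope.

(** * Directional derivatives and the chain rule *)

Notation VR2 := (prod_NormedModule R_AbsRing R_NormedModule R_NormedModule).
Notation VR3 := (prod_NormedModule R_AbsRing R_NormedModule VR2).

Definition ddir {U : NormedModule R_AbsRing} (v : U) (f : U -> R) (x : U) : R :=
  Derive (fun s : R => f (plus x (scal s v))) 0.

Lemma ball_RE (x : R) (eps : R) (y : R) : ball x eps y <-> Rabs (y - x) < eps.
Proof. split; intros H; exact H. Qed.

Lemma continuous_line {U : NormedModule R_AbsRing} (x v : U) (s0 : R) :
  continuous (fun s : R => plus x (scal s v)) s0.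
Proof.
apply @continuous_plus; [apply continuous_const|].
apply (continuous_scal (fun s : R => s) (fun _ => v)).
- apply continuous_id.
- apply continuous_const.
Qed.

Lemma line_0 {U : NormedModule R_AbsRing} (x v : U) :
  plus x (scal (0 : R) v) = x.
Proof. rewrite (scal_zero_l (K := R_AbsRing)). apply plus_zero_r. Qed.

Lemma locally_line {U : NormedModule R_AbsRing} (D : U -> Prop) (x v : U) :
  open D -> D x -> locally (0 : R) (fun s : R => D (plus x (scal s v))).
Proof.
intros HD Hx.
apply (continuous_line x v 0). apply HD. now rewrite line_0.
Qed.

(** [Ck] only speaks of parameter 0 on the line through each point. A later point of the line is the
    origin of the same line with its parameter shifted by [s0]. *)
Lemma is_derive_line {U : NormedModule R_AbsRing} (f : U -> R) (x v : U) (s0 : R) :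
  ex_derive (fun s : R => f (plus (plus x (scal s0 v)) (scal s v))) 0 ->
  is_derive (fun s : R => f (plus x (scal s v))) s0
    (ddir v f (plus x (scal s0 v))).
Proof.
intros H. apply Derive_correct in H.
apply (is_derive_ext
  (fun s : R => f (plus (plus x (scal s0 v)) (scal (s - s0) v)))).
- intros s. rewrite <- plus_assoc. do 2 f_equal.
  etransitivity; [symmetry; apply (scal_distr_r (K := R_AbsRing) s0 (s - s0) v)|].
  f_equal. unfold plus; simpl; ring.
- evar_last.
  + apply (is_derive_comp (fun r : R => f (plus (plus x (scal s0 v)) (scal r v)))
      (fun s => s - s0)).
    * replace (s0 - s0) with 0 by ring. exact H.
    * auto_derive; [easy|reflexivity].
  + unfold ddir. rewrite ?line_0. unfold scal; simpl; unfold mult; simpl. ring.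
Qed.

(** The hypothesis reads g(s) = a(s) L + o(a(s)). It is kept free of quotients because [a] may
    vanish arbitrarily close to 0. *)
Lemma is_derive_dominated (a g : R -> R) (a' L : R) :
  is_derive a 0 a' -> a 0 = 0 ->
  (forall eps : posreal, locally 0 (fun s => Rabs (g s - a s * L) <= eps * Rabs (a s))) ->
  is_derive g 0 (a' * L).
Proof.
intros Ha Ha0 Hg.
assert (Hg0 : g 0 = 0).
{ pose proof (locally_singleton _ _ (Hg (mkposreal 1 Rlt_0_1))) as H. simpl in H.
  rewrite Ha0 in H. rewrite Rabs_R0 in H. replace (g 0 - 0 * L) with (g 0) in H by ring.
  pose proof (Rabs_pos (g 0)). destruct (Req_dec (g 0) 0) as [E|E]; [easy|].
  apply Rabs_pos_lt in E. lra. }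
assert (Hr : is_derive (fun s => g s - a s * L) 0 0).
{ apply is_derive_Reals. intros eps Heps.
  (* [M] bounds |a(h) / h| for small h, which turns an error proportional to |a(h)| into one
     proportional to |h|. *)
  set (M := Rabs a' + 1). assert (HM : 0 < M) by (unfold M; pose proof (Rabs_pos a'); lra).
  assert (HeM : 0 < eps / 2 / M) by (apply Rdiv_lt_0_compat; lra).
  destruct (Hg (mkposreal _ HeM)) as [d1 Hd1].
  apply is_derive_Reals in Ha. destruct (Ha 1 Rlt_0_1) as [d2 Hd2].
  assert (Hd : 0 < Rmin d1 d2) by (apply Rmin_pos; [apply d1|apply d2]).
  exists (mkposreal _ Hd). intros h Hh0 Hh. simpl in Hh.
  assert (Hh1 : Rabs h < d1) by (eapply Rlt_le_trans; [exact Hh|apply Rmin_l]).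
  assert (Hh2 : Rabs h < d2) by (eapply Rlt_le_trans; [exact Hh|apply Rmin_r]).
  assert (B1 := Hd1 h). simpl in B1.
  assert (B1' : Rabs (g h - a h * L) <= eps / 2 / M * Rabs (a h)).
  { apply B1. apply (proj2 (ball_RE _ _ _)). now rewrite Rminus_0_r. }
  specialize (Hd2 h Hh0 Hh2). rewrite Rplus_0_l, Ha0 in Hd2.
  assert (Hah : Rabs (a h) <= M * Rabs h).
  { replace (a h) with (((a h - 0) / h - a') * h + a' * h) by (field; easy).
    eapply Rle_trans; [apply Rabs_triang|]. rewrite !Rabs_mult. unfold M.
    pose proof (Rabs_pos h). nra. }
  rewrite Rplus_0_l, Ha0, Hg0.
  replace ((g h - a h * L - (0 - 0 * L)) / h - 0) with ((g h - a h * L) / h)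
    by (field; easy).
  unfold Rdiv at 1. rewrite Rabs_mult, Rabs_inv.
  pose proof (Rabs_pos_lt h Hh0) as Hhp.
  apply Rle_lt_trans with (eps / 2); [|lra].
  apply (Rmult_le_reg_r (Rabs h)); [easy|].
  rewrite Rmult_assoc, Rinv_l, Rmult_1_r by lra.
  eapply Rle_trans; [exact B1'|].
  apply Rle_trans with (eps / 2 / M * (M * Rabs h)).
  - apply Rmult_le_compat_l; lra.
  - right. field. lra. }
apply (is_derive_ext (fun s => a s * L + (g s - a s * L))).
- intros; simpl; ring.
- evar_last.
  + apply @is_derive_plus; [|exact Hr].
    apply (is_derive_ext (fun s => scal L (a s))); [intros; unfold scal; simpl; unfold mult;
      simpl; ring|].
    apply (is_derive_scal a 0 L); exact Ha.
  + unfold plus; simpl. ring.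
Qed.

(** One leg of a polygonal path: the mean value theorem along [e], starting at [z s], followed by
    continuity of the directional derivative at [x]. The starting point moves with s, as the
    telescoping in [chain3] requires. *)
Lemma is_derive_step {U : NormedModule R_AbsRing} (D : U -> Prop) (f : U -> R)
  (e : U) (z : R -> U) (a : R -> R) (x : U) (a' : R) :
  open D -> D x ->
  (forall y, D y -> ex_derive (fun s : R => f (plus y (scal s e))) 0) ->
  continuous (ddir e f) x ->
  filterlim z (locally 0) (locally x) ->
  is_derive a 0 a' -> a 0 = 0 ->
  is_derive (fun s => f (plus (z s) (scal (a s) e)) - f (z s)) 0 (a' * ddir e f x).
Proof.
intros HD Hx Hf Hc Hz Ha Ha0.
(* For small s the whole segment issued from [z s] lies in any given neighbourhood of [x]. *)
assert (A : forall P : U -> Prop, locally x P ->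
  locally (0 : R) (fun s => forall r, Rabs r <= Rabs (a s) -> P (plus (z s) (scal r e)))).
{ intros P HP.
  assert (Hl : filterlim (fun w : U * R => plus (fst w) (scal (snd w) e))
    (filter_prod (locally x) (locally (0 : R))) (locally x)).
  { rewrite <- (line_0 x e) at 2.
    apply (filterlim_comp_2 (F := filter_prod (locally x) (locally (0 : R)))
      (fun w : U * R => fst w) (fun w : U * R => scal (snd w) e) plus
      (G := locally x) (H := locally (scal (0 : R) e))); [| |apply filterlim_plus].
    - intros Q HQ. exists Q (fun _ => True); [exact HQ|apply filter_true|easy].
    - intros Q HQ. apply (filterlim_scal_l (V := U) (0 : R) e) in HQ.
      exists (fun _ => True) (fun r => Q (scal r e)); [apply filter_true|exact HQ|easy]. }
  destruct (Hl P HP) as [Q S HQ HS HQS].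
  destruct HS as [d Hd].
  assert (Hac : continuous a 0) by (apply @ex_derive_continuous; eexists; exact Ha).
  assert (Ha' : locally (0 : R) (fun s => Rabs (a s) < d)).
  { apply (Hac (fun y => Rabs y < d)). exists d. intros y Hy. rewrite Ha0 in Hy.
    apply (proj1 (ball_RE _ _ _)) in Hy.
    now rewrite Rminus_0_r in Hy. }
  generalize (filter_and _ _ Ha' (Hz Q HQ)). apply filter_imp.
  intros s [H1 H2] r Hr. apply (HQS (z s) r H2). apply Hd.
  apply (proj2 (ball_RE _ _ _)). rewrite Rminus_0_r. lra. }
apply (is_derive_dominated a); [exact Ha|exact Ha0|].
intros eps.
assert (HP : locally x (fun y => D y /\ Rabs (ddir e f y - ddir e f x) < eps)).
{ apply filter_and; [now apply HD|].
  apply (Hc (fun w => Rabs (w - ddir e f x) < eps)). exists eps. intros y Hy. exact Hy. }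
generalize (A _ HP). apply filter_imp. intros s Hs.
destruct (MVT_gen (fun r => f (plus (z s) (scal r e))) 0 (a s)
  (fun r => ddir e f (plus (z s) (scal r e)))) as [c [Hc1 Hc2]].
- intros r Hr. apply is_derive_line. apply Hf. apply Hs.
  revert Hr. unfold Rmin, Rmax. destruct (Rle_dec 0 (a s)); intros;
  [rewrite !Rabs_pos_eq; lra|rewrite !Rabs_left1; lra].
- intros r Hr. apply continuity_pt_filterlim.
  apply (@ex_derive_continuous R_AbsRing R_NormedModule). eexists.
  apply is_derive_line. apply Hf. apply Hs.
  revert Hr. unfold Rmin, Rmax. destruct (Rle_dec 0 (a s)); intros;
  [rewrite !Rabs_pos_eq; lra|rewrite !Rabs_left1; lra].
- rewrite line_0 in Hc2. rewrite Hc2.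
  replace (ddir e f (plus (z s) (scal c e)) * (a s - 0) - a s * ddir e f x)
    with ((ddir e f (plus (z s) (scal c e)) - ddir e f x) * a s) by ring.
  rewrite Rabs_mult. apply Rmult_le_compat_r; [apply Rabs_pos|].
  left. apply Hs.
  revert Hc1. unfold Rmin, Rmax. destruct (Rle_dec 0 (a s)); intros;
  [rewrite !Rabs_pos_eq; lra|rewrite !Rabs_left1; lra].
Qed.

(** The increment of [f] is telescoped over three segments parallel to the axes, changing g1, then
    g2, then g3. Continuity of the partial derivatives handles each segment, so total
    differentiability of [f] never has to be established. *)
Lemma chain3 (D : VR3 -> Prop) (f : VR3 -> R) (g1 g2 g3 : R -> R) (l1 l2 l3 : R) :
  open D -> Ck 1 D f -> D (g1 0, (g2 0, g3 0)) ->
  is_derive g1 0 l1 -> is_derive g2 0 l2 -> is_derive g3 0 l3 ->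
  is_derive (fun s => f (g1 s, (g2 s, g3 s))) 0
   (l1 * ddir (U := VR3) (1, (0, 0)) f (g1 0, (g2 0, g3 0)) +
    l2 * ddir (U := VR3) (0, (1, 0)) f (g1 0, (g2 0, g3 0)) +
    l3 * ddir (U := VR3) (0, (0, 1)) f (g1 0, (g2 0, g3 0))).
Proof.
intros HD [Hc Hf] Hx H1 H2 H3.
set (x := (g1 0, (g2 0, g3 0)) : R * pt) in *.
assert (C : forall (g : R -> R) (l : R), is_derive g 0 l -> filterlim g (locally 0) (locally (g
  0))).
{ intros g l H. apply (@ex_derive_continuous R_AbsRing R_NormedModule). eexists; exact H. }
assert (E : forall (g : R -> R) (l : R), is_derive g 0 l -> is_derive (fun s => g s - g 0) 0 l).
{ intros g l H. evar_last.
  - apply @is_derive_minus; [exact H|apply is_derive_const].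
  - unfold minus, plus, opp, zero; simpl. ring. }
assert (P : forall h1 h2 h3 : R -> R,
  filterlim h1 (locally 0) (locally (h1 0)) -> filterlim h2 (locally 0) (locally (h2 0)) ->
  filterlim h3 (locally 0) (locally (h3 0)) ->
  filterlim (fun s => (h1 s, (h2 s, h3 s)) : R * pt) (locally 0) (locally (h1 0, (h2 0, h3 0)))).
{ intros h1 h2 h3 K1 K2 K3.
  apply (filterlim_filter_le_2 (G := filter_prod (locally (h1 0))
     (locally ((h2 0, h3 0) : pt)))).
  - intros S [d Hd]. exists (ball (h1 0) d) (ball ((h2 0, h3 0) : pt) d);
    [now exists d|now exists d|]. intros u v Hu Hv. apply Hd. now split.
  - apply filterlim_pair; [exact K1|].
    apply (filterlim_filter_le_2 (G := filter_prod (locally (h2 0)) (locally (h3 0)))).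
    + intros S [d Hd]. exists (ball (h2 0) d) (ball (h3 0) d);
      [now exists d|now exists d|]. intros u v Hu Hv. apply Hd. now split.
    + now apply filterlim_pair. }
assert (K : forall c : R, filterlim (fun _ : R => c) (locally 0) (locally c))
  by (intros; apply filterlim_const).
assert (D' : forall v : R * pt, continuous (ddir (U := VR3) v f) x) by (intros v; apply (Hf v);
  exact Hx).
pose proof (is_derive_step (U := VR3) D f (1, (0, 0)) (fun s => x) (fun s => g1 s - g1 0) x l1
  HD Hx (proj1 (Hf _)) (D' _) (filterlim_const x) (E _ _ H1) (Rminus_diag_eq _ _ eq_refl)) as S1.
pose proof (is_derive_step (U := VR3) D f (0, (1, 0)) (fun s => (g1 s, (g2 0,
  g3 0))) (fun s => g2 s - g2 0) x l2
  HD Hx (proj1 (Hf _)) (D' _)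
   (P g1 (fun _ => g2 0) (fun _ => g3 0) (C _ _ H1) (K _) (K _)) (E _ _ H2) (Rminus_diag_eq _ _
     eq_refl)) as S2.
pose proof (is_derive_step (U := VR3) D f (0, (0, 1)) (fun s => (g1 s, (g2 s,
  g3 0))) (fun s => g3 s - g3 0) x l3
  HD Hx (proj1 (Hf _)) (D' _)
   (P g1 g2 (fun _ => g3 0) (C _ _ H1) (C _ _ H2) (K _)) (E _ _ H3) (Rminus_diag_eq _ _ eq_refl))
     as S3.
pose proof (is_derive_plus _ _ _ _ _ (is_derive_plus _ _ _ _ _ S1 S2) S3) as S4.
pose proof (is_derive_plus _ _ _ _ _ S4 (is_derive_const (f x) (0 : R))) as S5.
evar_last; [eapply is_derive_ext; [|exact S5]|].
- intros s. unfold plus, scal, mult, x; simpl. unfold prod_plus, prod_scal, plus, scal; simpl;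
  unfold prod_plus, prod_scal, plus, scal, mult; simpl.
  unfold mult; simpl.
  replace (g1 0 + (g1 s - g1 0) * 1) with (g1 s) by ring.
  replace (g2 0 + (g1 s - g1 0) * 0) with (g2 0) by ring.
  replace (g3 0 + (g1 s - g1 0) * 0) with (g3 0) by ring.
  replace (g1 s + (g2 s - g2 0) * 0) with (g1 s) by ring.
  replace (g2 0 + (g2 s - g2 0) * 1) with (g2 s) by ring.
  replace (g3 0 + (g2 s - g2 0) * 0) with (g3 0) by ring.
  replace (g1 s + (g3 s - g3 0) * 0) with (g1 s) by ring.
  replace (g2 s + (g3 s - g3 0) * 0) with (g2 s) by ring.
  replace (g3 0 + (g3 s - g3 0) * 1) with (g3 s) by ring. ring.
- unfold plus, zero; simpl. ring.
Qed.

(** * Calculus of smooth functions *)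

Lemma Ck_S {U : NormedModule R_AbsRing} (n : nat) (D : U -> Prop) (f : U -> R) :
  Ck (S n) D f <-> (forall x, D x -> continuous f x) /\
  forall v : U,
    (forall x, D x -> ex_derive (fun s : R => f (plus x (scal s v))) 0) /\
    Ck n D (ddir v f).
Proof. reflexivity. Qed.

Lemma Ck_continuous {U : NormedModule R_AbsRing} (n : nat) (D : U -> Prop) (f : U -> R) :
  Ck n D f -> forall x, D x -> continuous f x.
Proof. destruct n; intros [H _]; exact H. Qed.

Lemma Ck_ex_derive {U : NormedModule R_AbsRing} (n : nat) (D : U -> Prop) (f : U -> R)
  (x v : U) :
  Ck (S n) D f -> D x -> ex_derive (fun s : R => f (plus x (scal s v))) 0.
Proof. intros [_ H] Hx. now apply (H v). Qed.

Lemma Ck_subset {U : NormedModule R_AbsRing} (n : nat) (D E : U -> Prop) (f : U -> R) :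
  (forall x, E x -> D x) -> Ck n D f -> Ck n E f.
Proof.
intros HS; revert f; induction n; intros f.
- intros [H _]; split; [auto|easy].
- rewrite !Ck_S. intros [H1 H2]. split; [auto|].
  intros v. destruct (H2 v). split; auto.
Qed.

Lemma Ck_pred {U : NormedModule R_AbsRing} (n : nat) (D : U -> Prop) (f : U -> R) :
  Ck (S n) D f -> Ck n D f.
Proof.
revert f; induction n; intros f H.
- split; [|easy]. exact (Ck_continuous _ _ _ H).
- rewrite Ck_S in *. destruct H as [H1 H2]. split; [easy|].
  intros v. destruct (H2 v). split; auto.
Qed.

Lemma ddir_ext_open {U : NormedModule R_AbsRing} (D : U -> Prop) (f h : U -> R) (v x : U) :
  open D -> D x -> (forall y, D y -> f y = h y) -> ddir v f x = ddir v h x.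
Proof.
intros HD Hx H. apply Derive_ext_loc.
generalize (locally_line D x v HD Hx). now apply filter_imp; auto.
Qed.

Lemma Ck_ext {U : NormedModule R_AbsRing} (n : nat) (D : U -> Prop) (f h : U -> R) :
  open D -> (forall x, D x -> f x = h x) -> Ck n D f -> Ck n D h.
Proof.
intros HD; revert f h.
assert (Hc : forall f h : U -> R, (forall x, D x -> f x = h x) ->
  (forall x, D x -> continuous f x) -> forall x, D x -> continuous h x).
{ intros f h He Hf x Hx. apply (continuous_ext_loc _ f); [|auto].
  generalize (HD x Hx). now apply filter_imp; auto. }
induction n; intros f h He.
- intros [H _]; split; [eauto|easy].
- rewrite !Ck_S. intros [H1 H2]. split; [eauto|].
  intros v. destruct (H2 v) as [H3 H4]. split.
  + intros x Hx. eapply ex_derive_ext_loc; [|exact (H3 x Hx)].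
    generalize (locally_line D x v HD Hx). now apply filter_imp; auto.
  + eapply IHn; [|exact H4]. intros x Hx. now apply (ddir_ext_open D).
Qed.

Lemma Ck_const {U : NormedModule R_AbsRing} (n : nat) (D : U -> Prop) (c : R) :
  Ck n D (fun _ => c).
Proof.
revert c; induction n; intros c.
- split; [intros; apply continuous_const|easy].
- apply Ck_S. split; [intros; apply continuous_const|].
  intros v. split; [intros; apply ex_derive_const|].
  replace (ddir v (fun _ => c)) with (fun _ : U => 0); [apply IHn|].
  apply functional_extensionality; intros x. unfold ddir. now rewrite Derive_const.
Qed.

Lemma Ck_linear {U : NormedModule R_AbsRing} (n : nat) (D : U -> Prop) (l : U -> R) :
  (forall x, continuous l x) ->
  (forall x v s, l (plus x (scal s v)) = l x + s * l v) ->
  Ck n D l.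
Proof.
intros Hc Hl. destruct n.
- split; [auto|easy].
- apply Ck_S. split; [auto|]. intros v.
  assert (H : forall x, is_derive (fun s => l (plus x (scal s v))) 0 (l v)).
  { intros x. apply (is_derive_ext (fun s => l x + s * l v)); [intros; now rewrite Hl|].
    auto_derive; [easy|ring]. }
  split; [intros; eexists; apply H|].
  replace (ddir v l) with (fun _ : U => l v); [apply Ck_const|].
  apply functional_extensionality; intros x. symmetry. apply is_derive_unique, H.
Qed.

Lemma ddir_is_derive {U : NormedModule R_AbsRing} (n : nat) (D : U -> Prop) (f : U -> R)
  (x v : U) :
  Ck (S n) D f -> D x ->
  is_derive (fun s : R => f (plus x (scal s v))) 0 (ddir v f x).
Proof. intros H Hx. apply Derive_correct. now apply (Ck_ex_derive n D). Qed.

Lemma ddir_plus {U : NormedModule R_AbsRing} (D : U -> Prop) (f h : U -> R) (x v : U) :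
  Ck 1 D f -> Ck 1 D h -> D x ->
  ddir v (fun y => f y + h y) x = ddir v f x + ddir v h x.
Proof.
intros Hf Hh Hx. apply Derive_plus; now apply (Ck_ex_derive 0 D).
Qed.

Lemma ddir_mult {U : NormedModule R_AbsRing} (D : U -> Prop) (f h : U -> R) (x v : U) :
  Ck 1 D f -> Ck 1 D h -> D x ->
  ddir v (fun y => f y * h y) x = ddir v f x * h x + f x * ddir v h x.
Proof.
intros Hf Hh Hx. unfold ddir.
rewrite Derive_mult; [now rewrite line_0| |]; now apply (Ck_ex_derive 0 D).
Qed.

Lemma ddir_inv {U : NormedModule R_AbsRing} (D : U -> Prop) (f : U -> R) (x v : U) :
  Ck 1 D f -> D x -> f x <> 0 ->
  ddir v (fun y => / f y) x = - ddir v f x * (/ f x * / f x).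
Proof.
intros Hf Hx H0. unfold ddir.
rewrite Derive_inv.
- rewrite line_0. field. exact H0.
- now apply (Ck_ex_derive 0 D).
- now rewrite line_0.
Qed.

Lemma Ck_le {U : NormedModule R_AbsRing} (m n : nat) (D : U -> Prop) (f : U -> R) :
  (m <= n)%nat -> Ck n D f -> Ck m D f.
Proof. induction 1; auto using Ck_pred. Qed.

Lemma Ck_plus {U : NormedModule R_AbsRing} (n : nat) (D : U -> Prop) (f h : U -> R) :
  open D -> Ck n D f -> Ck n D h -> Ck n D (fun x => f x + h x).
Proof.
intros HD; revert f h; induction n; intros f h Hf Hh.
- split; [|easy]. intros x Hx. apply @continuous_plus; now apply (Ck_continuous 0 D).
- apply Ck_S. split.
  + intros x Hx. apply @continuous_plus; now apply (Ck_continuous (S n) D).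
  + intros v. split.
    * intros x Hx. apply @ex_derive_plus; now apply (Ck_ex_derive n D).
    * apply (Ck_ext _ _ (fun x => ddir v f x + ddir v h x) _ HD).
      -- intros x Hx. symmetry.
         apply (ddir_plus D); try easy; apply (Ck_le 1 (S n)); try easy; lia.
      -- apply IHn; [apply Hf|apply Hh].
Qed.

Lemma Ck_mult {U : NormedModule R_AbsRing} (n : nat) (D : U -> Prop) (f h : U -> R) :
  open D -> Ck n D f -> Ck n D h -> Ck n D (fun x => f x * h x).
Proof.
intros HD; revert f h; induction n; intros f h Hf Hh.
- split; [|easy]. intros x Hx. apply (continuous_mult f h); now apply (Ck_continuous 0 D).
- apply Ck_S. split.
  + intros x Hx. apply (continuous_mult f h); now apply (Ck_continuous (S n) D).
  + intros v. split.
    * intros x Hx. apply ex_derive_mult; now apply (Ck_ex_derive n D).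
    * apply (Ck_ext _ _ (fun x => ddir v f x * h x + f x * ddir v h x) _ HD).
      -- intros x Hx. symmetry.
         apply (ddir_mult D); try easy; apply (Ck_le 1 (S n)); try easy; lia.
      -- apply Ck_plus; [easy| |]; apply IHn; try apply Hf; try apply Hh;
         now apply Ck_pred.
Qed.

Lemma Ck_inv {U : NormedModule R_AbsRing} (n : nat) (D : U -> Prop) (f : U -> R) :
  open D -> (forall x, D x -> f x <> 0) -> Ck n D f -> Ck n D (fun x => / f x).
Proof.
intros HD H0; induction n; intros Hf.
- split; [|easy]. intros x Hx.
  apply (continuous_comp f Rinv); [now apply (Ck_continuous 0 D)|].
  apply continuity_pt_filterlim, continuity_pt_inv; [|auto].
  apply derivable_continuous_pt, derivable_pt_id.
- apply Ck_S. split.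
  + apply (Ck_continuous n). apply IHn. now apply Ck_pred.
  + intros v. split.
    * intros x Hx. apply ex_derive_inv; [now apply (Ck_ex_derive n D)|].
      rewrite line_0; auto.
    * apply (Ck_ext _ _ (fun x => (-1 * ddir v f x) * (/ f x * / f x)) _ HD).
      -- intros x Hx. symmetry.
         rewrite (ddir_inv D); [ring| | |]; auto; apply (Ck_le 1 (S n)); try easy; lia.
      -- apply Ck_mult; [easy|apply Ck_mult; [easy|apply Ck_const|apply Hf]|].
         apply Ck_mult; [easy| |]; apply IHn; now apply Ck_pred.
Qed.

Lemma ddir_comp3 {U : NormedModule R_AbsRing} (D : U -> Prop) (E : VR3 -> Prop)
  (f : VR3 -> R) (g1 g2 g3 : U -> R) (x v : U) :
  open E -> Ck 1 E f -> Ck 1 D g1 -> Ck 1 D g2 -> Ck 1 D g3 ->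
  D x -> E (g1 x, (g2 x, g3 x)) ->
  is_derive (fun s : R => let y := plus x (scal s v) in f (g1 y, (g2 y, g3 y))) 0
   (ddir v g1 x * ddir (U := VR3) (1, (0, 0)) f (g1 x, (g2 x, g3 x)) +
    ddir v g2 x * ddir (U := VR3) (0, (1, 0)) f (g1 x, (g2 x, g3 x)) +
    ddir v g3 x * ddir (U := VR3) (0, (0, 1)) f (g1 x, (g2 x, g3 x))).
Proof.
intros HE Hf H1 H2 H3 Hx HEx.
pose proof (chain3 E f (fun s => g1 (plus x (scal s v))) (fun s => g2 (plus x (scal s v)))
  (fun s => g3 (plus x (scal s v))) (ddir v g1 x) (ddir v g2 x) (ddir v g3 x) HE Hf) as H.
cbv beta in H. rewrite !line_0 in H.
apply H; [easy| | |]; now apply (ddir_is_derive 0 D).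
Qed.

Lemma continuous_triple {U : UniformSpace} (g1 g2 g3 : U -> R) (x : U) :
  continuous g1 x -> continuous g2 x -> continuous g3 x ->
  continuous (fun y => (g1 y, (g2 y, g3 y)) : VR3) x.
Proof.
intros H1 H2 H3.
apply filterlim_locally. intros eps.
pose proof (proj1 (filterlim_locally _ _) H1 eps) as K1.
pose proof (proj1 (filterlim_locally _ _) H2 eps) as K2.
pose proof (proj1 (filterlim_locally _ _) H3 eps) as K3.
generalize (filter_and _ _ K1 (filter_and _ _ K2 K3)).
apply filter_imp. intros y [L1 [L2 L3]]. repeat split; assumption.
Qed.

(** Induction with [f] general: a derivative of the composite is a sum of products of a derivative
    of some g_i by a partial derivative of [f] composed with the same maps, which is again of the
    form considered, one order lower. *)
Lemma Ck_comp3 {U : NormedModule R_AbsRing} (n : nat) (D : U -> Prop) (E : VR3 -> Prop)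
  (f : VR3 -> R) (g1 g2 g3 : U -> R) :
  open D -> open E -> (forall x, D x -> E (g1 x, (g2 x, g3 x))) ->
  Ck n E f -> Ck n D g1 -> Ck n D g2 -> Ck n D g3 ->
  Ck n D (fun x => f (g1 x, (g2 x, g3 x))).
Proof.
intros HD HE HDE. revert f. induction n; intros f Hf H1 H2 H3.
all: assert (Hc : forall x, D x -> continuous (fun x => f (g1 x, (g2 x, g3 x))) x) by
 (intros x Hx; apply (continuous_comp (fun y => (g1 y, (g2 y, g3 y)) : VR3) f);
  [apply continuous_triple; eapply Ck_continuous; eauto|
  eapply Ck_continuous; eauto]).
- now split.
- apply Ck_S. split; [exact Hc|].
  intros v.
  assert (Hd : forall x, D x -> is_derive (fun s : R => let y := plus x (scal s v) in f (g1 y,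
    (g2 y, g3 y))) 0
   (ddir v g1 x * ddir (U := VR3) (1, (0, 0)) f (g1 x, (g2 x, g3 x)) +
    ddir v g2 x * ddir (U := VR3) (0, (1, 0)) f (g1 x, (g2 x, g3 x)) +
    ddir v g3 x * ddir (U := VR3) (0, (0, 1)) f (g1 x, (g2 x, g3 x)))).
  { intros x Hx. apply (ddir_comp3 D E); auto; apply (Ck_le 1 (S n)); try easy; lia. }
  split.
  + intros x Hx. eexists. now apply Hd.
  + eapply Ck_ext; [exact HD| |].
    * intros x Hx. symmetry. apply is_derive_unique. now apply Hd.
    * repeat apply Ck_plus; try exact HD; apply Ck_mult; try exact HD;
      try apply H1; try apply H2; try apply H3;
      apply IHn; try apply Hf; now apply Ck_pred.
Qed.

Lemma smooth_ext {U : NormedModule R_AbsRing} (D : U -> Prop) (f h : U -> R) :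
  open D -> (forall x, D x -> f x = h x) -> smooth D f -> smooth D h.
Proof. intros HD He H n. apply (Ck_ext n D f); auto. Qed.

Lemma smooth_subset {U : NormedModule R_AbsRing} (D E : U -> Prop) (f : U -> R) :
  (forall x, E x -> D x) -> smooth D f -> smooth E f.
Proof. intros HS H n. apply (Ck_subset n D); auto. Qed.

Lemma smooth_continuous {U : NormedModule R_AbsRing} (D : U -> Prop) (f : U -> R) (x : U) :
  smooth D f -> D x -> continuous f x.
Proof. intros H. apply (Ck_continuous 0). apply H. Qed.

Lemma smooth_const {U : NormedModule R_AbsRing} (D : U -> Prop) (c : R) :
  smooth D (fun _ => c).
Proof. intros n. apply Ck_const. Qed.

Lemma smooth_linear {U : NormedModule R_AbsRing} (D : U -> Prop) (l : U -> R) :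
  (forall x, continuous l x) ->
  (forall x v s, l (plus x (scal s v)) = l x + s * l v) ->
  smooth D l.
Proof. intros H1 H2 n. now apply Ck_linear. Qed.

Lemma smooth_plus {U : NormedModule R_AbsRing} (D : U -> Prop) (f h : U -> R) :
  open D -> smooth D f -> smooth D h -> smooth D (fun x => f x + h x).
Proof. intros HD Hf Hh n. now apply Ck_plus. Qed.

Lemma smooth_mult {U : NormedModule R_AbsRing} (D : U -> Prop) (f h : U -> R) :
  open D -> smooth D f -> smooth D h -> smooth D (fun x => f x * h x).
Proof. intros HD Hf Hh n. now apply Ck_mult. Qed.

Lemma smooth_opp {U : NormedModule R_AbsRing} (D : U -> Prop) (f : U -> R) :
  open D -> smooth D f -> smooth D (fun x => - f x).
Proof.
intros HD Hf. apply (smooth_ext D (fun x => -1 * f x)); [easy|intros; ring|].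
apply smooth_mult; auto using smooth_const.
Qed.

Lemma smooth_minus {U : NormedModule R_AbsRing} (D : U -> Prop) (f h : U -> R) :
  open D -> smooth D f -> smooth D h -> smooth D (fun x => f x - h x).
Proof. intros HD Hf Hh. apply smooth_plus; auto using smooth_opp. Qed.

Lemma smooth_inv {U : NormedModule R_AbsRing} (D : U -> Prop) (f : U -> R) :
  open D -> (forall x, D x -> f x <> 0) -> smooth D f -> smooth D (fun x => / f x).
Proof. intros HD H0 Hf n. now apply Ck_inv. Qed.

Lemma smooth_div {U : NormedModule R_AbsRing} (D : U -> Prop) (f h : U -> R) :
  open D -> (forall x, D x -> h x <> 0) -> smooth D f -> smooth D h ->
  smooth D (fun x => f x / h x).
Proof. intros HD H0 Hf Hh. apply smooth_mult; auto using smooth_inv. Qed.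

Lemma smooth_pow {U : NormedModule R_AbsRing} (D : U -> Prop) (f : U -> R) (k : nat) :
  open D -> smooth D f -> smooth D (fun x => f x ^ k).
Proof.
intros HD Hf. induction k; simpl; [apply smooth_const|now apply smooth_mult].
Qed.

Lemma smooth_ddir {U : NormedModule R_AbsRing} (D : U -> Prop) (f : U -> R) (v : U) :
  smooth D f -> smooth D (ddir v f).
Proof. intros H n. apply (H (S n)). Qed.

Lemma smooth_comp3 {U : NormedModule R_AbsRing} (D : U -> Prop) (E : VR3 -> Prop)
  (f : VR3 -> R) (g1 g2 g3 : U -> R) :
  open D -> open E -> (forall x, D x -> E (g1 x, (g2 x, g3 x))) ->
  smooth E f -> smooth D g1 -> smooth D g2 -> smooth D g3 ->
  smooth D (fun x => f (g1 x, (g2 x, g3 x))).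
Proof. intros HD HE HDE Hf H1 H2 H3 n. apply (Ck_comp3 n D E); auto. Qed.

Lemma continuous_sndU {A B : UniformSpace} (x : A * B) : continuous (snd : A * B -> B) x.
Proof. destruct x. apply continuous_snd. Qed.

Lemma continuous_fstU {A B : UniformSpace} (x : A * B) : continuous (fst : A * B -> A) x.
Proof. destruct x. apply continuous_fst. Qed.

(* [pt] sits in R x pt, so the two-variable chain rules follow from the
   three-variable ones. *)
Lemma Ck_snd (n : nat) (E : VR2 -> Prop) (f : VR2 -> R) :
  Ck n E f -> Ck n (fun y : VR3 => E (snd y)) (fun y => f (snd y)).
Proof.
revert f; induction n; intros f Hf.
all: assert (Hc : forall x : VR3, E (snd x) -> continuous (fun y : VR3 => f (snd y)) x) by
 (intros x Hx; apply (continuous_comp (snd : VR3 -> VR2) f);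
  [apply continuous_sndU|eapply Ck_continuous; eauto]).
- now split.
- apply Ck_S. split; [exact Hc|]. intros v. split.
  + intros x Hx. exact (Ck_ex_derive n E f (snd x) (snd v) Hf Hx).
  + exact (IHn (ddir (snd v) f) (proj2 (proj2 Hf (snd v)))).
Qed.

Lemma open_snd (E : VR2 -> Prop) : open E -> open (fun y : VR3 => E (snd y)).
Proof.
intros HE x Hx. destruct (HE _ Hx) as [d Hd]. exists d. intros y Hy. apply Hd. apply Hy.
Qed.

Lemma smooth_comp2 {U : NormedModule R_AbsRing} (D : U -> Prop) (E : VR2 -> Prop)
  (f : VR2 -> R) (g1 g2 : U -> R) :
  open D -> open E -> (forall x, D x -> E (g1 x, g2 x)) ->
  smooth E f -> smooth D g1 -> smooth D g2 ->
  smooth D (fun x => f (g1 x, g2 x)).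
Proof.
intros HD HE HDE Hf H1 H2.
apply (smooth_comp3 D (fun y => E (snd y)) (fun y => f (snd y)) (fun _ => 0) g1 g2);
auto using open_snd, smooth_const.
intros n. now apply Ck_snd.
Qed.

Lemma chain2 (D : pt -> Prop) (f : pt -> R) (g1 g2 : R -> R) (l1 l2 : R) :
  open D -> smooth D f -> D (g1 0, g2 0) ->
  is_derive g1 0 l1 -> is_derive g2 0 l2 ->
  is_derive (fun s => f (g1 s, g2 s)) 0
   (l1 * ddir (U := VR2) (1, 0) f (g1 0, g2 0) +
    l2 * ddir (U := VR2) (0, 1) f (g1 0, g2 0)).
Proof.
intros HD Hf Hx H1 H2.
evar_last; [apply (chain3 (fun y => D (snd y)) (fun y => f (snd y)) (fun _ => 0) g1 g2
  0 l1 l2); auto using open_snd; [apply Ck_snd, Hf|apply @is_derive_const]|].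
change (ddir (U := VR3) (0, (1, 0)) (fun y => f (snd y)) (0, (g1 0, g2 0)))
  with (ddir (U := VR2) (1, 0) f (g1 0, g2 0)).
change (ddir (U := VR3) (0, (0, 1)) (fun y => f (snd y)) (0, (g1 0, g2 0)))
  with (ddir (U := VR2) (0, 1) f (g1 0, g2 0)).
ring.
Qed.

(** Schwarz's theorem in two real variables, applied at (0, 0) to the slice [F] of [f] through [x]
    spanned by [u] and [v]. *)
Lemma ddir_comm {U : NormedModule R_AbsRing} (D : U -> Prop) (f : U -> R) (u v x : U) :
  open D -> D x -> smooth D f -> ddir u (ddir v f) x = ddir v (ddir u f) x.
Proof.
intros HD Hx Hf.
set (F := fun s t : R => f (plus x (plus (scal s u) (scal t v)))).
assert (Hl : forall s : R, continuous (fun w : R * R => plus x (plus (scal (fst w) u) (scal (snd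
  w) v))) (s, s)) by
 (intros s; apply @continuous_plus; [apply continuous_const|];
  apply @continuous_plus;
  [apply (continuous_scal (fun w : R * R => fst w) (fun _ => u)) |
   apply (continuous_scal (fun w : R * R => snd w) (fun _ => v))];
  try apply continuous_fst; try apply continuous_snd; apply continuous_const).
assert (E0 : plus x (plus (scal (0 : R) u) (scal (0 : R) v)) = x).
{ now rewrite !(scal_zero_l (K := R_AbsRing)), !plus_zero_r. }
assert (HDl : locally_2d (fun s t => D (plus x (plus (scal s u) (scal t v)))) 0 0).
{ apply locally_2d_locally. apply (Hl 0). simpl. rewrite E0. now apply HD. }
assert (Hu : forall h : U -> R, smooth D h -> forall s t : R,
  D (plus x (plus (scal s u) (scal t v))) ->
  is_derive (fun r : R => h (plus x (plus (scal r u) (scal t v)))) s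
    (ddir u h (plus x (plus (scal s u) (scal t v))))).
{ intros h Hh s t Hst.
  apply (is_derive_ext (fun r : R => h (plus (plus x (scal t v)) (scal r u)))).
  - intros r. f_equal. rewrite <- plus_assoc. f_equal. apply plus_comm.
  - replace (plus x (plus (scal s u) (scal t v))) with (plus (plus x (scal t v)) (scal s u)) in *
     by (rewrite <- plus_assoc; f_equal; apply plus_comm).
    apply is_derive_line. apply (Ck_ex_derive 0 D); [apply Hh|exact Hst]. }
assert (Hv : forall h : U -> R, smooth D h -> forall s t : R,
  D (plus x (plus (scal s u) (scal t v))) ->
  is_derive (fun r : R => h (plus x (plus (scal s u) (scal r v)))) t
    (ddir v h (plus x (plus (scal s u) (scal t v))))).
{ intros h Hh s t Hst.
  apply (is_derive_ext (fun r : R => h (plus (plus x (scal s u)) (scal r v)))).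
  - intros r. f_equal. now rewrite <- plus_assoc.
  - rewrite plus_assoc in *.
    apply is_derive_line. apply (Ck_ex_derive 0 D); [apply Hh|exact Hst]. }
(* The nested neighbourhood is needed because the inner derivative must be identified with [ddir] on
   a whole neighbourhood before the outer one is taken. *)
assert (HD1 : locally_2d (fun s t => locally_2d (fun s t => D (plus x (plus (scal s u) (scal t
  v)))) s t) 0 0).
{ apply locally_2d_locally. apply locally_2d_locally in HDl.
  apply locally_locally in HDl. revert HDl. apply filter_imp.
  intros [s t] Hst. now apply locally_2d_locally. }
assert (Huv : locally_2d (fun s t => is_derive (fun z => Derive (fun t => F z t) t) s
   (ddir u (ddir v f) (plus x (plus (scal s u) (scal t v))))) 0 0).
{ revert HD1. apply locally_2d_impl, locally_2d_forall. intros s t Hst.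
  apply is_derive_ext_loc with (fun z => ddir v f (plus x (plus (scal z u) (scal t v)))).
  - generalize (locally_2d_1d_const_y _ _ _ Hst). apply filter_imp. intros z Hz.
    symmetry. apply is_derive_unique. now apply Hv.
  - apply Hu; [now apply smooth_ddir|]. exact (locally_2d_singleton _ _ _ Hst). }
assert (Hvu : locally_2d (fun s t => is_derive (fun z => Derive (fun s => F s z) s) t
   (ddir v (ddir u f) (plus x (plus (scal s u) (scal t v))))) 0 0).
{ revert HD1. apply locally_2d_impl, locally_2d_forall. intros s t Hst.
  apply is_derive_ext_loc with (fun z => ddir u f (plus x (plus (scal s u) (scal z v)))).
  - generalize (locally_2d_1d_const_x _ _ _ Hst). apply filter_imp. intros z Hz.
    symmetry. apply is_derive_unique. now apply Hu.
  - apply Hv; [now apply smooth_ddir|]. exact (locally_2d_singleton _ _ _ Hst). }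
assert (HC : forall h : U -> R, smooth D h ->
  continuity_2d_pt (fun s t => h (plus x (plus (scal s u) (scal t v)))) 0 0).
{ intros h Hh. apply continuity_2d_pt_filterlim.
  assert (C : continuous h (plus x (plus (scal (0 : R) u) (scal (0 : R) v))))
    by (rewrite E0; now apply (smooth_continuous D)).
  exact (continuous_comp (fun w : R * R => plus x (plus (scal (fst w) u) (scal (snd w) v)))
    h (0, 0) (Hl 0) C). }
pose proof (is_derive_unique _ _ _ (locally_2d_singleton _ _ _ Huv)) as K1.
pose proof (is_derive_unique _ _ _ (locally_2d_singleton _ _ _ Hvu)) as K2.
simpl in K1, K2. rewrite E0 in K1, K2. rewrite <- K1, <- K2.
apply Schwarz.
- generalize (locally_2d_and _ _ _ _ HDl (locally_2d_and _ _ _ _ Huv Hvu)).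
  apply locally_2d_impl, locally_2d_forall. intros s t [H0 [H1 H2]].
  repeat split.
  + eexists. now apply Hu.
  + eexists. now apply Hv.
  + eexists. exact H1.
  + eexists. exact H2.
- eapply continuity_2d_pt_ext_loc; [|apply (HC (ddir u (ddir v f)))].
  + revert Huv. apply locally_2d_impl, locally_2d_forall. intros s t H.
    symmetry. now apply is_derive_unique.
  + now do 2 apply smooth_ddir.
- eapply continuity_2d_pt_ext_loc; [|apply (HC (ddir v (ddir u f)))].
  + revert Hvu. apply locally_2d_impl, locally_2d_forall. intros s t H.
    symmetry. now apply is_derive_unique.
  + now do 2 apply smooth_ddir.
Qed.

(** * Jets of functions on the plane *)

(* Monomorphic in the type of its arguments, so that binders over the plane
   always elaborate to [pt]. *)
Definition ddp (v : pt) (f : pt -> R) : pt -> R := ddir (U := VR2) v f.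

Lemma ddp_ext_open (D : pt -> Prop) (f h : pt -> R) (v x : pt) :
  open D -> D x -> (forall y, D y -> f y = h y) -> ddp v f x = ddp v h x.
Proof. exact (ddir_ext_open (U := VR2) D f h v x). Qed.

Lemma ddp_is_derive (n : nat) (D : pt -> Prop) (f : pt -> R) (x v : pt) :
  Ck (U := VR2) (S n) D f -> D x ->
  is_derive (fun s : R => f (plus x (scal s v))) 0 (ddp v f x).
Proof. exact (ddir_is_derive (U := VR2) n D f x v). Qed.

Lemma ddp_plus (D : pt -> Prop) (f h : pt -> R) (x v : pt) :
  Ck (U := VR2) 1 D f -> Ck (U := VR2) 1 D h -> D x ->
  ddp v (fun y => f y + h y) x = ddp v f x + ddp v h x.
Proof. exact (ddir_plus (U := VR2) D f h x v). Qed.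

Lemma ddp_mult (D : pt -> Prop) (f h : pt -> R) (x v : pt) :
  Ck (U := VR2) 1 D f -> Ck (U := VR2) 1 D h -> D x ->
  ddp v (fun y => f y * h y) x = ddp v f x * h x + f x * ddp v h x.
Proof. exact (ddir_mult (U := VR2) D f h x v). Qed.

Lemma ddp_comm (D : pt -> Prop) (f : pt -> R) (u v x : pt) :
  open D -> D x -> smooth (U := VR2) D f -> ddp u (ddp v f) x = ddp v (ddp u f) x.
Proof. exact (ddir_comm (U := VR2) D f u v x). Qed.

Lemma smooth_ddp (D : pt -> Prop) (f : pt -> R) (v : pt) :
  smooth (U := VR2) D f -> smooth (U := VR2) D (ddp v f).
Proof. exact (smooth_ddir (U := VR2) D f v). Qed.

Notation ddx := (ddp (1, 0)).
Notation ddy := (ddp (0, 1)).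

Lemma Derive_shift (f : R -> R) (x : R) : Derive (fun s => f (x + s)) 0 = Derive f x.
Proof.
pose proof (Derive_n_comp_trans f 1 0 x) as H. simpl in H.
rewrite Rplus_0_l in H. transitivity (Derive (fun t => f t) x); [|reflexivity].
rewrite <- H. apply Derive_ext. intros; f_equal; ring.
Qed.

Lemma DxE (f : pt -> R) (p : pt) : ddx f p = Derive (fun t => f (t, snd p)) (fst p).
Proof.
rewrite <- Derive_shift. apply Derive_ext. intros s. f_equal.
unfold plus, scal; simpl. unfold prod_plus, prod_scal, plus, scal, mult; simpl.
unfold mult; simpl. f_equal; ring.
Qed.

Lemma DyE (f : pt -> R) (p : pt) : ddy f p = Derive (fun t => f (fst p, t)) (snd p).
Proof.
rewrite <- Derive_shift. apply Derive_ext. intros s. f_equal.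
unfold plus, scal; simpl. unfold prod_plus, prod_scal, plus, scal, mult; simpl.
unfold mult; simpl. f_equal; ring.
Qed.

Lemma partial00 (f : pt -> R) : partial 0 0 f = f.
Proof. apply functional_extensionality; intros [x y]; reflexivity. Qed.

Lemma partial_Sl (a b : nat) (f : pt -> R) : partial (S a) b f = ddx (partial a b f).
Proof. apply functional_extensionality; intros p. rewrite DxE. reflexivity. Qed.

Lemma partial0S (b : nat) (f : pt -> R) : partial 0 (S b) f = ddy (partial 0 b f).
Proof. apply functional_extensionality; intros p. rewrite DyE. reflexivity. Qed.

Lemma partial10 (f : pt -> R) : partial 1 0 f = ddx f.
Proof. now rewrite partial_Sl, partial00. Qed.

Lemma partial01 (f : pt -> R) : partial 0 1 f = ddy f.
Proof. now rewrite partial0S, partial00. Qed.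

(** In [partial] the y-derivatives are innermost, so this is a matter of unfolding. The counterpart
    [partial_Dx] rests on the symmetry of second derivatives. *)
Lemma partial_Dy (a b : nat) (f : pt -> R) : partial a b (ddy f) = partial a (S b) f.
Proof.
induction a as [|a IH]; [|now rewrite !partial_Sl, IH].
induction b as [|b IH]; [now rewrite partial00, partial01|].
now rewrite partial0S, IH, <- partial0S.
Qed.

Lemma smooth_partial (D : pt -> Prop) (a b : nat) (f : pt -> R) :
  smooth D f -> smooth D (partial a b f).
Proof.
intros H. induction a as [|a IH].
- induction b as [|b IH]; [now rewrite partial00|]. rewrite partial0S. now apply smooth_ddp.
- rewrite partial_Sl. now apply smooth_ddp.
Qed.

Lemma partial_ext_open (D : pt -> Prop) (a b : nat) (f h : pt -> R) (p : pt) :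
  open D -> D p -> (forall q, D q -> f q = h q) -> partial a b f p = partial a b h p.
Proof.
intros HD Hp He. revert p Hp. induction a as [|a IH].
- induction b as [|b IH]; intros p Hp; [rewrite !partial00; auto|].
  rewrite !partial0S. now apply (ddp_ext_open D).
- intros p Hp. rewrite !partial_Sl. now apply (ddp_ext_open D).
Qed.

Lemma partial_Dx (D : pt -> Prop) (a b : nat) (f : pt -> R) (p : pt) :
  open D -> D p -> smooth D f -> partial a b (ddx f) p = partial (S a) b f p.
Proof.
intros HD Hp Hf.
assert (H0 : forall q, D q -> partial 0 b (ddx f) q = partial 1 b f q).
{ induction b as [|b IH]; intros q Hq; [now rewrite partial00, partial10|].
  rewrite partial_Sl, !partial0S.
  rewrite (ddp_ext_open D _ (partial 1 b f) _ _ HD Hq IH).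
  rewrite partial_Sl.
  apply (ddp_comm D); [easy|easy|now apply smooth_partial]. }
revert p Hp. induction a as [|a IH]; intros p Hp; [auto|].
rewrite (partial_Sl (S a)), partial_Sl. now apply (ddp_ext_open D).
Qed.

(** * Germs of functions and equality of jets *)

Definition smooth_at (p : pt) (f : pt -> R) : Prop :=
  exists D : pt -> Prop, open D /\ D p /\ smooth (U := VR2) D f.

Definition near_eq (p : pt) (f h : pt -> R) : Prop :=
  exists D : pt -> Prop, open D /\ D p /\ forall q, D q -> f q = h q.

Definition jeq (k : nat) (p : pt) (f h : pt -> R) : Prop :=
  forall a b, (a + b <= k)%nat -> partial a b f p = partial a b h p.

Lemma smooth_at_const (p : pt) (c : R) : smooth_at p (fun _ => c).
Proof. exists (fun _ => True). repeat split; [apply open_true|apply (smooth_const (U := VR2))].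
Qed.

Lemma smooth_at_2 (p : pt) (f g h : pt -> R) :
  (forall D : pt -> Prop, open D -> smooth (U := VR2) D f -> smooth (U := VR2) D g ->
     smooth (U := VR2) D h) ->
  smooth_at p f -> smooth_at p g -> smooth_at p h.
Proof.
intros H [D [HD [Dp Df]]] [E [HE [Ep Ef]]]. exists (fun x => D x /\ E x).
repeat split; auto; [now apply open_and|].
apply H; [now apply open_and| |];
[apply (smooth_subset (U := VR2) D)|apply (smooth_subset (U := VR2) E)]; tauto.
Qed.

Lemma smooth_at_plus (p : pt) (f h : pt -> R) :
  smooth_at p f -> smooth_at p h -> smooth_at p (fun x => f x + h x).
Proof. apply smooth_at_2. intros D; apply (smooth_plus (U := VR2)). Qed.

Lemma smooth_at_minus (p : pt) (f h : pt -> R) :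
  smooth_at p f -> smooth_at p h -> smooth_at p (fun x => f x - h x).
Proof. apply smooth_at_2. intros D; apply (smooth_minus (U := VR2)). Qed.

Lemma smooth_at_mult (p : pt) (f h : pt -> R) :
  smooth_at p f -> smooth_at p h -> smooth_at p (fun x => f x * h x).
Proof. apply smooth_at_2. intros D; apply (smooth_mult (U := VR2)). Qed.

Lemma smooth_at_ddp (p v : pt) (f : pt -> R) : smooth_at p f -> smooth_at p (ddp v f).
Proof. intros [D [HD [Dp Df]]]. exists D. repeat split; auto. now apply smooth_ddp. Qed.

Lemma smooth_at_Dx (p : pt) (f : pt -> R) : smooth_at p f -> smooth_at p (ddx f).
Proof. apply smooth_at_ddp. Qed.

Lemma smooth_at_Dy (p : pt) (f : pt -> R) : smooth_at p f -> smooth_at p (ddy f).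
Proof. apply smooth_at_ddp. Qed.

Lemma smooth_at_partial (p : pt) (a b : nat) (f : pt -> R) :
  smooth_at p f -> smooth_at p (partial a b f).
Proof.
intros [D [HD [Dp Df]]]. exists D. repeat split; try easy. now apply smooth_partial.
Qed.

Lemma open_preimage (D E : pt -> Prop) (g : pt -> pt) :
  open D -> open E -> (forall x, D x -> continuous g x) ->
  open (fun x => D x /\ E (g x)).
Proof.
intros HD HE Hg x [ddx Ex]. apply filter_and; [now apply HD|].
apply (Hg x ddx). now apply HE.
Qed.

Lemma continuous_pair {U : UniformSpace} (g1 g2 : U -> R) (x : U) :
  continuous g1 x -> continuous g2 x -> continuous (fun y => (g1 y, g2 y) : pt) x.
Proof.
intros H1 H2.
apply filterlim_locally. intros eps.
pose proof (proj1 (filterlim_locally _ _) H1 eps) as K1.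
pose proof (proj1 (filterlim_locally _ _) H2 eps) as K2.
generalize (filter_and _ _ K1 K2).
apply filter_imp. intros y [L1 L2]. split; assumption.
Qed.

Lemma smooth_map_continuous {U : NormedModule R_AbsRing} (D : U -> Prop) (g : U -> pt) (x : U) :
  smooth_map D g -> D x -> continuous g x.
Proof.
intros [H1 H2] Hx.
apply (continuous_ext (fun y => (fst (g y), snd (g y)) : pt)).
- intros y. now destruct (g y).
- apply continuous_pair; [now apply (smooth_continuous D)|now apply (smooth_continuous D)].
Qed.

Lemma smooth_comp {U : NormedModule R_AbsRing} (D : U -> Prop) (E : pt -> Prop)
  (f : pt -> R) (g : U -> pt) :
  open D -> open E -> (forall x, D x -> E (g x)) ->
  smooth (U := VR2) E f -> smooth_map D g -> smooth D (fun x => f (g x)).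
Proof.
intros HD HE HDE Hf [H1 H2].
apply (smooth_ext D (fun x => f (fst (g x), snd (g x)))); [easy| |].
- intros x _. now destruct (g x).
- apply (smooth_comp2 D E); auto. intros x Hx. destruct (g x) eqn:Eg. simpl.
  rewrite <- Eg. auto.
Qed.

Definition smooth_map_at (p : pt) (g : pt -> pt) : Prop :=
  smooth_at p (fun x => fst (g x)) /\ smooth_at p (fun x => snd (g x)).

Lemma smooth_map_at_common (p : pt) (g : pt -> pt) :
  smooth_map_at p g -> exists D : pt -> Prop, open D /\ D p /\ smooth_map (U := VR2) D g.
Proof.
intros [[D [HD [Dp H1]]] [E [HE [Ep H2]]]]. exists (fun x => D x /\ E x).
repeat split; auto; try now apply open_and.
- apply (smooth_subset (U := VR2) D); tauto.
- apply (smooth_subset (U := VR2) E); tauto.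
Qed.

Lemma smooth_at_comp (p : pt) (f : pt -> R) (g : pt -> pt) :
  smooth_at (g p) f -> smooth_map_at p g -> smooth_at p (fun x => f (g x)).
Proof.
intros [E [HE [Ep Hf]]] Hg. destruct (smooth_map_at_common _ _ Hg) as [D [HD [Dp H]]].
assert (HO : open (fun x : pt => D x /\ E (g x))).
{ apply open_preimage; try easy. intros x Hx. now apply (smooth_map_continuous (U := VR2) D). }
exists (fun x => D x /\ E (g x)). repeat split; try easy.
apply (smooth_comp (U := VR2) _ E); try easy.
  destruct H as [K1 K2]. split; [apply (smooth_subset (U := VR2) D)|apply (smooth_subset (U :=
    VR2) D)]; tauto.
Qed.

Lemma near_eq_ext (p : pt) (f h : pt -> R) : (forall q, f q = h q) -> near_eq p f h.
Proof. intros H. exists (fun _ => True). repeat split; auto. apply open_true. Qed.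

Lemma near_eq_sym (p : pt) (f h : pt -> R) : near_eq p f h -> near_eq p h f.
Proof. intros [D [H1 [H2 H3]]]. exists D. repeat split; auto. intros q Hq. symmetry; auto. Qed.

Lemma near_eq_partial (p : pt) (a b : nat) (f h : pt -> R) :
  near_eq p f h -> partial a b f p = partial a b h p.
Proof. intros [D [H1 [H2 H3]]]. now apply (partial_ext_open D). Qed.

Lemma near_jeq (k : nat) (p : pt) (f h : pt -> R) : near_eq p f h -> jeq k p f h.
Proof. intros H a b _. now apply near_eq_partial. Qed.

Lemma jeq_refl (k : nat) (p : pt) (f : pt -> R) : jeq k p f f.
Proof. now intros a b _. Qed.

Lemma jeq_trans (k : nat) (p : pt) (f g h : pt -> R) :
  jeq k p f g -> jeq k p g h -> jeq k p f h.
Proof. intros H K a b Hab. rewrite H; auto. Qed.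

Lemma jeq_le (k l : nat) (p : pt) (f h : pt -> R) :
  (l <= k)%nat -> jeq k p f h -> jeq l p f h.
Proof. intros Hl H a b Hab. apply H. lia. Qed.

Lemma jeq_val (k : nat) (p : pt) (f h : pt -> R) : jeq k p f h -> f p = h p.
Proof. intros H. specialize (H 0%nat 0%nat ltac:(lia)). now rewrite !partial00 in H. Qed.

(** A recursive form of jet equality. With it, compatibility with products and composites follows by
    induction from the first order Leibniz and chain rules, without the higher order formulas. *)
Lemma jeq_S (k : nat) (p : pt) (f h : pt -> R) :
  smooth_at p f -> smooth_at p h ->
  jeq (S k) p f h <-> f p = h p /\ jeq k p (ddx f) (ddx h) /\ jeq k p (ddy f) (ddy h).
Proof.
intros [D [HD [Dp Hf]]] [E [HE [Ep Hh]]]. split.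
- intros H. split; [now apply (jeq_val (S k))|split].
  + intros a b Hab. rewrite (partial_Dx D), (partial_Dx E); auto. apply H; lia.
  + intros a b Hab. rewrite !partial_Dy. apply H; lia.
- intros [H0 [H1 H2]] a b Hab. destruct b as [|b].
  + destruct a as [|a]; [now rewrite !partial00|].
    rewrite <- (partial_Dx D), <- (partial_Dx E); auto. apply H1; lia.
  + rewrite <- !partial_Dy. apply H2; lia.
Qed.

Lemma jeq_near (k : nat) (p : pt) (f f' h h' : pt -> R) :
  near_eq p f f' -> near_eq p h h' -> jeq k p f' h' -> jeq k p f h.
Proof.
intros H1 H2 H. apply (jeq_trans _ _ _ f'); [now apply near_jeq|].
apply (jeq_trans _ _ _ h'); [easy|]. apply near_jeq. now apply near_eq_sym.
Qed.

Lemma near_Dplus (p : pt) (f h : pt -> R) (v : pt) :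
  smooth_at p f -> smooth_at p h ->
  near_eq p (ddp v (fun x => f x + h x))
    (fun x => ddp v f x + ddp v h x).
Proof.
intros [D [HD [Dp Hf]]] [E [HE [Ep Hh]]]. exists (fun q => D q /\ E q).
repeat split; auto; [now apply open_and|]. intros q [Hq1 Hq2].
apply (ddp_plus (fun q => D q /\ E q)); try easy.
- apply (Ck_subset (U := VR2) 1 D); [tauto|apply Hf].
- apply (Ck_subset (U := VR2) 1 E); [tauto|apply Hh].
Qed.

Lemma near_Dmult (p : pt) (f h : pt -> R) (v : pt) :
  smooth_at p f -> smooth_at p h ->
  near_eq p (ddp v (fun x => f x * h x))
    (fun x => ddp v f x * h x + f x * ddp v h x).
Proof.
intros [D [HD [Dp Hf]]] [E [HE [Ep Hh]]]. exists (fun q => D q /\ E q).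
repeat split; auto; [now apply open_and|]. intros q [Hq1 Hq2].
apply (ddp_mult (fun q => D q /\ E q)); try easy.
- apply (Ck_subset (U := VR2) 1 D); [tauto|apply Hf].
- apply (Ck_subset (U := VR2) 1 E); [tauto|apply Hh].
Qed.

Lemma near_Dcomp (p : pt) (f : pt -> R) (g : pt -> pt) (v : pt) :
  smooth_at (g p) f -> smooth_map_at p g ->
  near_eq p (ddp v (fun x => f (g x)))
    (fun x => ddp v (fun y => fst (g y)) x * ddx f (g x)
            + ddp v (fun y => snd (g y)) x * ddy f (g x)).
Proof.
intros [E [HE [Ep Hf]]] Hg. destruct (smooth_map_at_common _ _ Hg) as [D [HD [Dp H]]].
exists (fun x => D x /\ E (g x)). repeat split; auto.
{ apply open_preimage; try easy. intros x Hx. now apply (smooth_map_continuous (U := VR2) D). }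
intros q [Hq1 Hq2]. apply is_derive_unique.
apply (is_derive_ext (fun s => f (fst (g (plus q (scal s v))), snd (g (plus q (scal s v)))))).
{ intros s. now rewrite <- surjective_pairing. }
pose proof (chain2 E f (fun s => fst (g (plus q (scal s v)))) (fun s => snd (g (plus q (scal s
  v))))
  (ddp v (fun y => fst (g y)) q) (ddp v (fun y => snd (g y)) q) HE Hf) as C.
cbv beta in C. rewrite (line_0 (U := VR2)) in C. rewrite <- surjective_pairing in C.
apply C; [easy| |]; apply (ddp_is_derive 0 D); try easy; apply H.
Qed.

Lemma jeq_plus (k : nat) (p : pt) (f f' h h' : pt -> R) :
  smooth_at p f -> smooth_at p f' -> smooth_at p h -> smooth_at p h' ->
  jeq k p f f' -> jeq k p h h' -> jeq k p (fun x => f x + h x) (fun x => f' x + h' x).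
Proof.
revert f f' h h'; induction k; intros f f' h h' S1 S2 S3 S4 H1 H2.
- intros a b Hab. replace a with 0%nat by lia. replace b with 0%nat by lia.
  rewrite !partial00. f_equal; now apply (jeq_val 0).
- apply jeq_S; auto using smooth_at_plus.
  apply jeq_S in H1; auto. apply jeq_S in H2; auto.
  destruct H1 as [H1 [H1x H1y]]. destruct H2 as [H2 [H2x H2y]].
  repeat split; [now rewrite H1, H2| |].
  all: eapply jeq_near; [now apply near_Dplus|now apply near_Dplus|].
  all: apply IHk; auto using smooth_at_Dx, smooth_at_Dy.
Qed.

Lemma jeq_mult (k : nat) (p : pt) (f f' h h' : pt -> R) :
  smooth_at p f -> smooth_at p f' -> smooth_at p h -> smooth_at p h' ->
  jeq k p f f' -> jeq k p h h' -> jeq k p (fun x => f x * h x) (fun x => f' x * h' x).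
Proof.
revert f f' h h'; induction k; intros f f' h h' S1 S2 S3 S4 H1 H2.
- intros a b Hab. replace a with 0%nat by lia. replace b with 0%nat by lia.
  rewrite !partial00. f_equal; now apply (jeq_val 0).
- apply jeq_S; auto using smooth_at_mult.
  pose proof (jeq_le (S k) k _ _ _ ltac:(lia) H1) as L1.
  pose proof (jeq_le (S k) k _ _ _ ltac:(lia) H2) as L2.
  apply jeq_S in H1; auto. apply jeq_S in H2; auto.
  destruct H1 as [H1 [H1x H1y]]. destruct H2 as [H2 [H2x H2y]].
  repeat split; [now rewrite H1, H2| |].
  all: eapply jeq_near; [now apply near_Dmult|now apply near_Dmult|].
  all: apply jeq_plus; auto using smooth_at_Dx, smooth_at_Dy, smooth_at_mult.
Qed.

Lemma jeq_comp (k : nat) (p : pt) (f f' : pt -> R) (g : pt -> pt) :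
  smooth_at (g p) f -> smooth_at (g p) f' -> smooth_map_at p g ->
  jeq k (g p) f f' -> jeq k p (fun x => f (g x)) (fun x => f' (g x)).
Proof.
revert f f'; induction k; intros f f' S1 S2 Sg H.
- intros a b Hab. replace a with 0%nat by lia. replace b with 0%nat by lia.
  rewrite !partial00. now apply (jeq_val 0).
- apply jeq_S; auto using smooth_at_comp.
  apply jeq_S in H; auto. destruct H as [H [Hx Hy]].
  destruct Sg as [Sg1 Sg2].
  repeat split; [easy| |].
  all: eapply jeq_near; [apply near_Dcomp; try easy; now split|apply near_Dcomp; try easy;
    now split|].
  all: apply jeq_plus; try apply jeq_mult; try apply jeq_refl; try apply IHk;
    repeat apply smooth_at_mult; auto using smooth_at_Dx, smooth_at_Dy; try (now split).
  all: apply smooth_at_comp; auto using smooth_at_Dx, smooth_at_Dy; now split.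
Qed.

(** * Taylor polynomials as representatives of jets *)

Lemma coef_ix {k} (c : mindex k -> R) (s : mindex k) : coef c (ix s) (iy s) = c s.
Proof.
destruct s as [[a b] H]. unfold coef, ix, iy; simpl.
destruct le_dec as [h|h]; [|now destruct h].
f_equal. f_equal. apply proof_irrelevance.
Qed.

Lemma mindex_eq {k} (c d : mindex k -> R) :
  (forall a b, (a + b <= k)%nat -> coef c a b = coef d a b) -> c = d.
Proof.
intros H. apply functional_extensionality; intros s.
rewrite <- (coef_ix c), <- (coef_ix d). apply H. exact (proj2_sig s).
Qed.

Lemma coef_fjet (k : nat) (f : pt -> R) (p : pt) (a b : nat) :
  (a + b <= k)%nat -> coef (fjet k f p) a b = partial a b f p.
Proof. intros H. unfold coef. now destruct le_dec. Qed.

Lemma fjet_eq (k : nat) (f h : pt -> R) (p : pt) :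
  fjet k f p = fjet k h p <-> jeq k p f h.
Proof.
split.
- intros H a b Hab. rewrite <- !(coef_fjet k) by easy. now rewrite H.
- intros H. apply mindex_eq. intros a b Hab. rewrite !coef_fjet by easy. auto.
Qed.

Lemma partial_plus (p : pt) (a b : nat) (f h : pt -> R) :
  smooth_at p f -> smooth_at p h ->
  partial a b (fun x => f x + h x) p = partial a b f p + partial a b h p.
Proof.
intros [D [HD [Dp Hf]]] [E [HE [Ep Hh]]].
assert (HDE : open (fun q : pt => D q /\ E q)) by now apply open_and.
apply (smooth_subset (U := VR2) _ (fun q => D q /\ E q)) in Hf; [|tauto].
apply (smooth_subset (U := VR2) _ (fun q => D q /\ E q)) in Hh; [|tauto].
assert (Hp : D p /\ E p) by easy. clear Dp Ep. revert p Hp.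
induction a as [|a IH]; [induction b as [|b IH]|]; intros p Hp.
- now rewrite !partial00.
- rewrite !partial0S, (ddp_ext_open _ _ _ _ _ HDE Hp IH).
  apply (ddp_plus (fun q => D q /\ E q)); try easy; now apply smooth_partial.
- rewrite !partial_Sl, (ddp_ext_open _ _ _ _ _ HDE Hp IH).
  apply (ddp_plus (fun q => D q /\ E q)); try easy; now apply smooth_partial.
Qed.

Lemma partial_scal (p : pt) (a b : nat) (r : R) (f : pt -> R) :
  partial a b (fun x => r * f x) p = r * partial a b f p.
Proof.
unfold partial, partial_derive. rewrite <- Derive_n_scal_l.
apply Derive_n_ext. intros t. apply Derive_n_scal_l.
Qed.

Lemma smooth_at_sum (p : pt) (n : nat) (F : nat -> pt -> R) :
  (forall m, smooth_at p (F m)) -> smooth_at p (fun q => sum_f_R0 (fun m => F m q) n).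
Proof. intros H. induction n; simpl; [auto|now apply smooth_at_plus]. Qed.

Lemma partial_sum (p : pt) (a b n : nat) (F : nat -> pt -> R) :
  (forall m, smooth_at p (F m)) ->
  partial a b (fun q => sum_f_R0 (fun m => F m q) n) p
  = sum_f_R0 (fun m => partial a b (F m) p) n.
Proof.
intros H. induction n; simpl; [easy|].
rewrite partial_plus; [now rewrite IHn| |easy]. now apply smooth_at_sum.
Qed.

Lemma sum_single (F : nat -> R) (n a : nat) :
  (a <= n)%nat -> (forall m, m <> a -> F m = 0) -> sum_f_R0 F n = F a.
Proof.
intros Ha H. induction n; simpl; [now replace a with 0%nat by lia|].
destruct (Nat.eq_dec a (S n)) as [->|E].
- replace (sum_f_R0 F n) with 0; [ring|].
  symmetry. clear IHn Ha. assert (Hn : forall m, (m <= n)%nat -> F m = 0) by (intros; apply H;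
    lia).
  clear H. induction n; simpl; [apply Hn; lia|].
  rewrite IHn by (intros; apply Hn; lia). rewrite Hn by lia. ring.
- rewrite IHn by lia. rewrite (H (S n)) by auto. ring.
Qed.

Lemma Derive_n_pow_at (a m : nat) (x : R) :
  Derive_n (fun t => (t - x) ^ m) a x = if Nat.eq_dec a m then INR (fact m) else 0.
Proof.
transitivity (Derive_n (fun t => (t + - x) ^ m) a x); [reflexivity|].
rewrite (Derive_n_comp_trans (fun t => t ^ m) a x (- x)).
rewrite Derive_n_pow. replace (x + - x) with 0 by ring.
destruct (Nat.eq_dec a m) as [->|E]; destruct le_dec as [L|L]; try lia; try easy.
- rewrite Nat.sub_diag. simpl. field.
- rewrite pow_i by lia. ring.
Qed.

Lemma smooth_fst (D : pt -> Prop) : smooth (U := VR2) D (fun q => fst q).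
Proof.
apply smooth_linear; [intros x; apply continuous_fstU|]. reflexivity.
Qed.

Lemma smooth_snd (D : pt -> Prop) : smooth (U := VR2) D (fun q => snd q).
Proof.
apply smooth_linear; [intros x; apply continuous_sndU|]. reflexivity.
Qed.

Lemma smooth_sum {U : NormedModule R_AbsRing} (D : U -> Prop) (n : nat) (F : nat -> U -> R) :
  open D -> (forall m, smooth D (F m)) -> smooth D (fun q => sum_f_R0 (fun m => F m q) n).
Proof. intros HD H. induction n; simpl; [auto|now apply smooth_plus]. Qed.

Lemma smooth_monomial (D : pt -> Prop) (p : pt) (C : R) (m n : nat) :
  open D -> smooth (U := VR2) D (fun q => C * (fst q - fst p) ^ m * (snd q - snd p) ^ n).
Proof.
intros HD.
apply (smooth_mult (U := VR2)); [easy|apply (smooth_mult (U := VR2)); [easy| |]|].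
- apply smooth_const.
- apply (smooth_pow (U := VR2)); [easy|]. apply (smooth_minus (U := VR2));
  [easy|apply smooth_fst|apply smooth_const].
- apply (smooth_pow (U := VR2)); [easy|]. apply (smooth_minus (U := VR2));
  [easy|apply smooth_snd|apply smooth_const].
Qed.

Lemma smooth_taylor {k} (D : pt -> Prop) (p : pt) (c : mindex k -> R) :
  open D -> smooth (U := VR2) D (taylor p c).
Proof.
intros HD. apply (smooth_sum (U := VR2)); [easy|]. intros a.
apply (smooth_sum (U := VR2)); [easy|]. intros b. now apply smooth_monomial.
Qed.

Lemma smooth_at_taylor {k} (p q : pt) (c : mindex k -> R) : smooth_at q (taylor p c).
Proof.
exists (fun _ => True). repeat split; [apply open_true|]. apply smooth_taylor, open_true.
Qed.

(** At [p] a centred monomial has a nonzero derivative of order (a, b) only if its exponents are (a,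
    b), and the factorials then cancel. *)
Lemma partial_taylor {k} (p : pt) (c : mindex k -> R) (a b : nat) :
  (a + b <= k)%nat -> partial a b (taylor p c) p = coef c a b.
Proof.
intros Hab.
assert (Hm : forall C m n, smooth_at p (fun q => C * (fst q - fst p) ^ m * (snd q - snd p) ^ n)).
{ intros. exists (fun _ => True). repeat split; [apply open_true|].
  apply smooth_monomial, open_true. }
assert (Hd : forall C m n, partial a b (fun q => C * (fst q - fst p) ^ m * (snd q - snd p) ^ n) p
  = C * (if Nat.eq_dec a m then INR (fact m) else 0) * (if Nat.eq_dec b n then INR (fact n) else
    0)).
{ intros C m n. unfold partial, partial_derive. simpl.
  rewrite <- (Derive_n_pow_at a m (fst p)), <- (Derive_n_pow_at b n (snd p)).
  rewrite (Derive_n_ext _ (fun t => (C * Derive_n (fun z => (z - snd p) ^ n) b (snd p))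
    * (t - fst p) ^ m)).
  - rewrite Derive_n_scal_l. ring.
  - intros t. rewrite Derive_n_scal_l. ring. }
unfold taylor.
rewrite (partial_sum p a b k (fun m q => sum_f_R0 (fun n => coef c m n / (INR (fact m) * INR
  (fact n))
      * (fst q - fst p) ^ m * (snd q - snd p) ^ n) k)).
2: { intros m. apply smooth_at_sum. intros n. apply Hm. }
rewrite (sum_single _ k a).
- rewrite partial_sum by (intros; apply Hm).
  rewrite (sum_single _ k b).
  + rewrite Hd. destruct Nat.eq_dec; [|easy]. destruct Nat.eq_dec; [|easy].
    field. split; apply INR_fact_neq_0.
  + lia.
  + intros m Hm'. rewrite Hd. destruct (Nat.eq_dec b m); [lia|]. ring.
- lia.
- intros m Hm'. rewrite partial_sum by (intros; apply Hm).
  rewrite (sum_eq _ (fun _ => 0)); [|intros; rewrite Hd; destruct (Nat.eq_dec a m); [lia|]; ring].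
  rewrite sum_cte. ring.
Qed.

Lemma fjet_taylor {k} (p : pt) (c : mindex k -> R) : fjet k (taylor p c) p = c.
Proof.
apply mindex_eq. intros a b Hab. rewrite coef_fjet by easy. now apply partial_taylor.
Qed.

Lemma jet_jet_repr {k} (theta : J k) : jet k (jet_repr theta) (fst theta) = theta.
Proof.
destruct theta as [p c]. unfold jet, jet_repr; simpl. f_equal.
apply functional_extensionality; intros i. apply fjet_taylor.
Qed.

Lemma taylor_fjet (k : nat) (f : pt -> R) (p : pt) : jeq k p (taylor p (fjet k f p)) f.
Proof. apply fjet_eq. apply fjet_taylor. Qed.

(** * The action of point transformations on jets *)

Lemma DDcomp (v : pt) (q : pt) (f : pt -> R) (g : pt -> pt) :
  smooth_at (g q) f -> smooth_map_at q g ->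
  ddp v (fun x => f (g x)) q =
    ddp v (fun y => fst (g y)) q * ddx f (g q)
  + ddp v (fun y => snd (g y)) q * ddy f (g q).
Proof.
intros H1 H2. destruct (near_Dcomp q f g v H1 H2) as [D [_ [Dq H]]]. now apply H.
Qed.

Lemma near_eq_D (q v : pt) (f h : pt -> R) :
  near_eq q f h -> ddp v f q = ddp v h q.
Proof. intros [D [H1 [H2 H3]]]. now apply (ddp_ext_open D). Qed.

Lemma D_plus (v p : pt) (f h : pt -> R) : smooth_at p f -> smooth_at p h ->
  ddp v (fun x => f x + h x) p = ddp v f p + ddp v h p.
Proof. intros H1 H2. destruct (near_Dplus p f h v H1 H2) as [D [_ [Dq H]]]. now apply H. Qed.

Lemma D_mult (v p : pt) (f h : pt -> R) : smooth_at p f -> smooth_at p h ->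
  ddp v (fun x => f x * h x) p =
  ddp v f p * h p + f p * ddp v h p.
Proof. intros H1 H2. destruct (near_Dmult p f h v H1 H2) as [D [_ [Dq H]]]. now apply H. Qed.

Lemma DD_comp (v w : pt) (q : pt) (f : pt -> R) (g : pt -> pt) :
  smooth_at (g q) f -> smooth_map_at q g ->
  let D u h := ddp u h in
  let g1 := fun y => fst (g y) in let g2 := fun y => snd (g y) in
  D w (D v (fun x => f (g x))) q =
    D w (D v g1) q * ddx f (g q) + D w (D v g2) q * ddy f (g q)
  + D v g1 q * (D w g1 q * ddx (ddx f) (g q) + D w g2 q * ddy (ddx f) (g q))
  + D v g2 q * (D w g1 q * ddx (ddy f) (g q) + D w g2 q * ddy (ddy f) (g q)).
Proof.
intros H1 [H2 H3]. cbv beta zeta.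
pose proof (smooth_at_ddp q v _ H2) as S2. pose proof (smooth_at_ddp q v _ H3) as S3.
rewrite (near_eq_D q w _ _ (near_Dcomp q f g v H1 (conj H2 H3))).
assert (Sx : smooth_at q (fun x => ddx f (g x))) by (apply smooth_at_comp;
  [now apply smooth_at_Dx|now split]).
assert (Sy : smooth_at q (fun x => ddy f (g x))) by (apply smooth_at_comp;
  [now apply smooth_at_Dy|now split]).
rewrite D_plus by (apply smooth_at_mult; auto).
rewrite !D_mult by auto.
rewrite (DDcomp w q (ddx f) g), (DDcomp w q (ddy f) g) by (auto using smooth_at_Dx, smooth_at_Dy;
  now split).
ring.
Qed.

Lemma partial20 (f : pt -> R) : partial 2 0 f = ddx (ddx f).
Proof. now rewrite partial_Sl, partial10. Qed.
Lemma partial11 (f : pt -> R) : partial 1 1 f = ddx (ddy f).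
Proof. now rewrite partial_Sl, partial01. Qed.
Lemma partial02 (f : pt -> R) : partial 0 2 f = ddy (ddy f).
Proof. now rewrite partial0S, partial01. Qed.

Lemma DyDx (f : pt -> R) (q : pt) : smooth_at q f -> ddy (ddx f) q = ddx (ddy f) q.
Proof. intros [D [HD [Dp Df]]]. now apply (ddp_comm D). Qed.

(** * Functoriality of the lift to the fibres *)

Lemma lift_fib_near (g g' : pt -> pt) (q : pt) (u : fib -> R) (j : fib) :
  near_eq q (fun z => fst (g z)) (fun z => fst (g' z)) ->
  near_eq q (fun z => snd (g z)) (fun z => snd (g' z)) ->
  lift_fib g q u j = lift_fib g' q u j.
Proof.
intros H1 H2. unfold lift_fib, lift_J.
now rewrite !(near_eq_partial q _ _ _ _ H1), !(near_eq_partial q _ _ _ _ H2).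
Qed.

Lemma Dx_fst (q : pt) : ddx (fun z => fst z) q = 1.
Proof. rewrite DxE. simpl. apply Derive_id. Qed.
Lemma Dy_fst (q : pt) : ddy (fun z => fst z) q = 0.
Proof. rewrite DyE. simpl. apply Derive_const. Qed.
Lemma Dx_snd (q : pt) : ddx (fun z => snd z) q = 0.
Proof. rewrite DxE. simpl. apply Derive_const. Qed.
Lemma Dy_snd (q : pt) : ddy (fun z => snd z) q = 1.
Proof. rewrite DyE. simpl. apply Derive_id. Qed.

Lemma D_fun_const (v : pt) (c : R) (f : pt -> R) (q : pt) :
  (forall z, f z = c) -> ddp v f q = 0.
Proof.
intros H. replace f with (fun _ : pt => c).
- unfold ddp, ddir. apply Derive_const.
- now apply functional_extensionality.
Qed.

Lemma lift_fib_id (q : pt) (u : fib -> R) (j : fib) : lift_fib (fun z => z) q u j = u j.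
Proof.
unfold lift_fib, lift_J.
rewrite !partial20, !partial11, !partial02, !partial10, !partial01.
rewrite !(D_fun_const (1, 0) 1 (ddx (fun z => fst z)) q Dx_fst),
  !(D_fun_const (1, 0) 0 (ddy (fun z => fst z)) q Dy_fst),
  !(D_fun_const (0, 1) 0 (ddy (fun z => fst z)) q Dy_fst),
  !(D_fun_const (1, 0) 0 (ddx (fun z => snd z)) q Dx_snd),
  !(D_fun_const (1, 0) 1 (ddy (fun z => snd z)) q Dy_snd),
  !(D_fun_const (0, 1) 1 (ddy (fun z => snd z)) q Dy_snd).
rewrite !Dx_fst, !Dy_fst, !Dx_snd, !Dy_snd.
destruct j; field.
Qed.

(** [lift_fib g] pulls the coefficients of an ODE back along [g], hence it is contravariant. The
    second order chain rule turns this into an identity of rational functions in the twenty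
    derivatives of [g] and [h] of orders 1 and 2. *)
Lemma lift_fib_comp (g h : pt -> pt) (q : pt) (u : fib -> R) (j : fib) :
  smooth_map_at (g q) h -> smooth_map_at q g ->
  lift_J g q <> 0 -> lift_J h (g q) <> 0 ->
  lift_fib (fun z => h (g z)) q u j = lift_fib g q (lift_fib h (g q) u) j.
Proof.
intros [H1 H2] Hg. unfold lift_fib, lift_J.
rewrite !partial20, !partial11, !partial02, !partial10, !partial01.
pose proof (fun v w => DD_comp v w q _ g H1 Hg) as E1.
pose proof (fun v w => DD_comp v w q _ g H2 Hg) as E2. cbv beta zeta in E1, E2.
rewrite !E1, !E2.
pose proof (fun v => DDcomp v q _ g H1 Hg) as F1.
pose proof (fun v => DDcomp v q _ g H2 Hg) as F2.
cbv beta in F1, F2.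
rewrite !F1, !F2. clear E1 E2 F1 F2.
rewrite (DyDx _ (g q) H1), (DyDx _ (g q) H2).
generalize (ddx (ddx (fun z => fst (h z))) (g q)) (ddx (ddy (fun z => fst (h z))) (g q))
  (ddy (ddy (fun z => fst (h z))) (g q)) (ddx (fun z => fst (h z)) (g q)) (ddy (fun z => fst (h
    z)) (g q))
  (ddx (ddx (fun z => snd (h z))) (g q)) (ddx (ddy (fun z => snd (h z))) (g q))
  (ddy (ddy (fun z => snd (h z))) (g q)) (ddx (fun z => snd (h z)) (g q)) (ddy (fun z => snd (h
    z)) (g q))
  (ddx (ddx (fun z => fst (g z))) q) (ddx (ddy (fun z => fst (g z))) q)
  (ddy (ddy (fun z => fst (g z))) q) (ddx (fun z => fst (g z)) q) (ddy (fun z => fst (g z)) q)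
  (ddx (ddx (fun z => snd (g z))) q) (ddx (ddy (fun z => snd (g z))) q)
  (ddy (ddy (fun z => snd (g z))) q) (ddx (fun z => snd (g z)) q) (ddy (fun z => snd (g z)) q).
clear. intros h1xx h1xy h1yy h1x h1y h2xx h2xy h2yy h2x h2y g1xx g1xy g1yy g1x g1y
  g2xx g2xy g2yy g2x g2y J1 J2.
(* The Jacobian of the composite, nonzero by multiplicativity of determinants; it is the denominator
   on the left-hand side. *)
assert (J3 : (g1x * h1x + g2x * h1y) * (g1y * h2x + g2y * h2y)
  - (g1y * h1x + g2y * h1y) * (g1x * h2x + g2x * h2y) <> 0).
{ replace (_ - _) with ((g1x * g2y - g1y * g2x) * (h1x * h2y - h1y * h2x)) by ring.
  now apply Rmult_integral_contrapositive. }
destruct j; field; auto.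
Qed.

(** Differentiating f o g = id shows that the Jacobian matrices are inverse to each other. This is
    why no denominator vanishes in the lift of a point transformation. *)
Lemma lift_J_inv (g f : pt -> pt) (q : pt) :
  smooth_map_at q g -> smooth_map_at (g q) f ->
  near_eq q (fun z => fst (f (g z))) (fun z => fst z) ->
  near_eq q (fun z => snd (f (g z))) (fun z => snd z) ->
  lift_J g q * lift_J f (g q) = 1.
Proof.
intros Hg [H1 H2] E1 E2. unfold lift_J. rewrite !partial10, !partial01.
pose proof (near_eq_D q (1, 0) _ _ E1) as K1. pose proof (near_eq_D q (0, 1) _ _ E1) as K2.
pose proof (near_eq_D q (1, 0) _ _ E2) as K3. pose proof (near_eq_D q (0, 1) _ _ E2) as K4.
rewrite (DDcomp _ q _ g H1 Hg) in K1. rewrite (DDcomp _ q _ g H1 Hg) in K2.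
rewrite (DDcomp _ q _ g H2 Hg) in K3. rewrite (DDcomp _ q _ g H2 Hg) in K4.
rewrite Dx_fst in K1. rewrite Dy_fst in K2. rewrite Dx_snd in K3. rewrite Dy_snd in K4.
revert K1 K2 K3 K4.
generalize (ddx (fun z => fst (f z)) (g q)) (ddy (fun z => fst (f z)) (g q))
 (ddx (fun z => snd (f z)) (g q)) (ddy (fun z => snd (f z)) (g q))
 (ddx (fun z => fst (g z)) q) (ddy (fun z => fst (g z)) q)
 (ddx (fun z => snd (g z)) q) (ddy (fun z => snd (g z)) q).
intros a b c d e f' g' h K1 K2 K3 K4.
transitivity ((e * a + g' * b) * (f' * c + h * d) - (f' * a + h * b) * (e * c + g' * d)); [ring|].
rewrite K1, K2, K3, K4. ring.
Qed.

Lemma smooth_map_at_dom (f : point_transformation) (p : pt) :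
  pt_dom f p -> smooth_map_at p f.
Proof.
intros Hp. split; exists (pt_dom f); repeat split; auto using pt_dom_open;
  apply (pt_fun_smooth f).
Qed.

Lemma smooth_map_at_cod (f : point_transformation) (q : pt) :
  pt_cod f q -> smooth_map_at q (pt_inv f).
Proof.
intros Hp. split; exists (pt_cod f); repeat split; auto using pt_cod_open;
  apply (pt_inv_smooth f).
Qed.

Lemma lift_J_inv_neq0 (f : point_transformation) (q : pt) :
  pt_cod f q -> lift_J (pt_inv f) q <> 0.
Proof.
intros Hq H0.
pose proof (lift_J_inv (pt_inv f) f q) as H. rewrite H0 in H.
assert (0 = 1); [|lra].
rewrite <- H; [ring|now apply smooth_map_at_cod|apply smooth_map_at_dom, pt_inv_dom, Hq| |];
 exists (pt_cod f); repeat split; auto using pt_cod_open; intros z Hz; now rewrite pt_invK.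
Qed.

Lemma lift_J_fun_neq0 (f : point_transformation) (p : pt) :
  pt_dom f p -> lift_J f p <> 0.
Proof.
intros Hq H0.
pose proof (lift_J_inv f (pt_inv f) p) as H. rewrite H0 in H.
assert (0 = 1); [|lra].
rewrite <- H; [ring|now apply smooth_map_at_dom|apply smooth_map_at_cod, pt_fun_cod, Hq| |];
 exists (pt_dom f); repeat split; auto using pt_dom_open; intros z Hz; now rewrite pt_funK.
Qed.

(** * Smoothness of the lift and its action on jets *)

(** The lift as a function of ten independent numbers: the first derivatives a, b, c, d, and the
    second derivatives r, s, t of the first and r', s', t' of the second component. The same formula
    can then be differentiated in the base point or in the time of a flow. *)
Definition lift_alg (a b c d r s t r' s' t' : R) (u : fib -> R) (j : fib) : R :=
  match j with
  | U1 => u U1 * a ^ 3 + u U2 * (a ^ 2 * c) + u U3 * (a * c ^ 2) + u U4 * c ^ 3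
          - a * r' + c * r
  | U2 => u U1 * (3 * a ^ 2 * b) + u U2 * (a ^ 2 * d + 2 * a * b * c)
          + u U3 * (2 * a * c * d + b * c ^ 2) + u U4 * (3 * c ^ 2 * d)
          - (2 * a * s' + b * r') + (2 * c * s + d * r)
  | U3 => u U1 * (3 * a * b ^ 2) + u U2 * (2 * a * b * d + b ^ 2 * c)
          + u U3 * (a * d ^ 2 + 2 * b * c * d) + u U4 * (3 * c * d ^ 2)
          - (a * t' + 2 * b * s') + (c * t + 2 * d * s)
  | U4 => u U1 * b ^ 3 + u U2 * (b ^ 2 * d) + u U3 * (b * d ^ 2) + u U4 * d ^ 3
          - b * t' + d * t
  end / (a * d - b * c).

Lemma lift_fib_alg (g : pt -> pt) (q : pt) (u : fib -> R) (j : fib) :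
  lift_fib g q u j =
  lift_alg (partial 1 0 (fun z => fst (g z)) q) (partial 0 1 (fun z => fst (g z)) q)
    (partial 1 0 (fun z => snd (g z)) q) (partial 0 1 (fun z => snd (g z)) q)
    (partial 2 0 (fun z => fst (g z)) q) (partial 1 1 (fun z => fst (g z)) q)
    (partial 0 2 (fun z => fst (g z)) q)
    (partial 2 0 (fun z => snd (g z)) q) (partial 1 1 (fun z => snd (g z)) q)
    (partial 0 2 (fun z => snd (g z)) q) u j.
Proof. reflexivity. Qed.

Lemma smooth_lift_alg {U : NormedModule R_AbsRing} (D : U -> Prop)
  (a b c d r s t r' s' t' : U -> R) (u : fib -> U -> R) (j : fib) :
  open D -> (forall x, D x -> a x * d x - b x * c x <> 0) ->
  smooth D a -> smooth D b -> smooth D c -> smooth D d ->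
  smooth D r -> smooth D s -> smooth D t -> smooth D r' -> smooth D s' -> smooth D t' ->
  (forall i, smooth D (u i)) ->
  smooth D (fun x => lift_alg (a x) (b x) (c x) (d x) (r x) (s x) (t x) (r' x) (s' x) (t' x)
    (fun i => u i x) j).
Proof.
intros HD HJ. intros. unfold lift_alg.
destruct j; apply (smooth_div (U := U)); auto;
repeat first [assumption | apply (smooth_const (U := U)) | apply (smooth_plus (U := U)) |
  apply (smooth_opp (U := U)) | apply (smooth_mult (U := U)) | apply (smooth_pow (U := U)) |
    auto].
Qed.

Definition fib_delta (i j : fib) : R :=
  match i, j with U1, U1 | U2, U2 | U3, U3 | U4, U4 => 1 | _, _ => 0 end.

(** The lift is affine in the fibre coordinates, with this translation part and the matrix
    [lift_lin]. A transformed section thus becomes a sum of products of functions determined by [f]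
    with the components of the section composed with f^-1, and jets only require the rules for sums,
    products and composites. *)
Definition lift_shift (g : pt -> pt) (j : fib) (q : pt) : R := lift_fib g q (fun _ => 0) j.
Definition lift_lin (g : pt -> pt) (j i : fib) (q : pt) : R :=
  lift_fib g q (fib_delta i) j - lift_shift g j q.

Lemma lift_fib_affine (g : pt -> pt) (q : pt) (u : fib -> R) (j : fib) :
  lift_fib g q u j = lift_shift g j q + (lift_lin g j U1 q * u U1 + (lift_lin g j U2 q * u U2
    + (lift_lin g j U3 q * u U3 + lift_lin g j U4 q * u U4))).
Proof.
unfold lift_lin, lift_shift, lift_fib, Rdiv. destruct j; unfold fib_delta; ring.
Qed.

Lemma smooth_lift_fib (D : pt -> Prop) (g : pt -> pt) (u : fib -> pt -> R) (j : fib) :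
  open D -> smooth_map (U := VR2) D g -> (forall q, D q -> lift_J g q <> 0) ->
  (forall i, smooth (U := VR2) D (u i)) ->
  smooth (U := VR2) D (fun q => lift_fib g q (fun i => u i q) j).
Proof.
intros HD [H1 H2] HJ Hu.
apply (smooth_lift_alg (U := VR2) D); auto; now apply smooth_partial.
Qed.

Lemma smooth_at_lift_shift (f : point_transformation) (j : fib) (q : pt) :
  pt_cod f q -> smooth_at q (lift_shift (pt_inv f) j).
Proof.
intros Hq. exists (pt_cod f). repeat split; auto using pt_cod_open.
apply (smooth_lift_fib (pt_cod f) (pt_inv f) (fun _ _ => 0));
  auto using pt_cod_open, lift_J_inv_neq0.
- apply pt_inv_smooth.
- intros i. apply (smooth_const (U := VR2)).
Qed.

Lemma smooth_at_lift_lin (f : point_transformation) (j i : fib) (q : pt) :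
  pt_cod f q -> smooth_at q (lift_lin (pt_inv f) j i).
Proof.
intros Hq. apply smooth_at_minus; [|now apply smooth_at_lift_shift].
exists (pt_cod f). repeat split; auto using pt_cod_open.
apply (smooth_lift_fib (pt_cod f) (pt_inv f) (fun i' _ => fib_delta i i'));
  auto using pt_cod_open, lift_J_inv_neq0.
- apply pt_inv_smooth.
- intros i'. apply (smooth_const (U := VR2)).
Qed.

Lemma transform_affine (f : point_transformation) (S : section) (j : fib) :
  transform f S j = (fun q => lift_shift (pt_inv f) j q
   + (lift_lin (pt_inv f) j U1 q * S U1 (pt_inv f q) + (lift_lin (pt_inv f) j U2 q * S U2 (pt_inv
     f q)
    + (lift_lin (pt_inv f) j U3 q * S U3 (pt_inv f q) + lift_lin (pt_inv f) j U4 q * S U4 (pt_inv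
      f q))))).
Proof. apply functional_extensionality; intros q. apply lift_fib_affine. Qed.

Lemma smooth_at_transform (f : point_transformation) (S : section) (p : pt) (j : fib) :
  pt_dom f p -> (forall i, smooth_at p (S i)) -> smooth_at (f p) (transform f S j).
Proof.
intros Hp HS. rewrite transform_affine.
assert (Hq : pt_cod f (f p)) by now apply pt_fun_cod.
assert (HC : forall i, smooth_at (f p) (fun q => S i (pt_inv f q))).
{ intros i. apply smooth_at_comp; [rewrite pt_funK; auto|now apply smooth_map_at_cod]. }
assert (HM : forall i, smooth_at (f p) (fun q => lift_lin (pt_inv f) j i q * S i (pt_inv f q))).
{ intros i. apply smooth_at_mult; auto using smooth_at_lift_lin. }
do 4 (apply smooth_at_plus; [apply HM || now apply smooth_at_lift_shift|]). apply HM.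
Qed.

(** This makes f^(k) well defined on jets: [prolong] transforms a Taylor polynomial, and any other
    section with the same k-jet would do. *)
Lemma jeq_transform (k : nat) (f : point_transformation) (S T : section) (p : pt) (j : fib) :
  pt_dom f p -> (forall i, smooth_at p (S i)) -> (forall i, smooth_at p (T i)) ->
  (forall i, jeq k p (S i) (T i)) -> jeq k (f p) (transform f S j) (transform f T j).
Proof.
intros Hp HS HT H. rewrite !transform_affine.
assert (Hq : pt_cod f (f p)) by now apply pt_fun_cod.
assert (HC : forall S : section, (forall i, smooth_at p (S i)) ->
  forall i, smooth_at (f p) (fun q => S i (pt_inv f q))).
{ intros S' HS' i. apply smooth_at_comp; [rewrite pt_funK; auto|now apply smooth_map_at_cod]. }
assert (HJ : forall i, jeq k (f p) (fun q => S i (pt_inv f q)) (fun q => T i (pt_inv f q))).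
{ intros i. apply jeq_comp; try rewrite pt_funK; auto. now apply smooth_map_at_cod. }
assert (HL := smooth_at_lift_shift f j (f p) Hq).
assert (HM : forall S : section, (forall i, smooth_at p (S i)) -> forall i,
  smooth_at (f p) (fun q => lift_lin (pt_inv f) j i q * S i (pt_inv f q))).
{ intros S' HS' i. apply smooth_at_mult; auto using smooth_at_lift_lin. }
assert (HJM : forall i, jeq k (f p) (fun q => lift_lin (pt_inv f) j i q * S i (pt_inv f q))
  (fun q => lift_lin (pt_inv f) j i q * T i (pt_inv f q))).
{ intros i. apply jeq_mult; auto using smooth_at_lift_lin, jeq_refl. }
assert (HM1 := HM S HS). assert (HM2 := HM T HT).
do 4 (apply jeq_plus; [apply HM1 || apply HL|apply HM2 || apply HL| | |apply HJM || apply
  jeq_refl|];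
 [repeat (apply smooth_at_plus; [apply HM1|]); apply HM1|
  repeat (apply smooth_at_plus; [apply HM2|]); apply HM2|]).
apply HJM.
Qed.

Lemma jet_eq (k : nat) (S T : section) (p : pt) :
  (forall i, jeq k p (S i) (T i)) -> jet k S p = jet k T p.
Proof.
intros H. unfold jet. f_equal. apply functional_extensionality; intros i. now apply fjet_eq.
Qed.

Lemma jet_repr_jet (k : nat) (S : section) (p : pt) (i : fib) :
  jeq k p (jet_repr (jet k S p) i) (S i).
Proof. apply taylor_fjet. Qed.

Lemma smooth_at_jet_repr {k} (theta : J k) (q : pt) (i : fib) : smooth_at q (jet_repr theta i).
Proof. apply smooth_at_taylor. Qed.

Lemma prolong_jet (k : nat) (f : point_transformation) (S : section) (p : pt) :
  pt_dom f p -> (forall i, smooth_at p (S i)) ->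
  prolong k f (jet k S p) = jet k (transform f S) (f p).
Proof.
intros Hp HS. unfold prolong. simpl. apply jet_eq. intros i.
apply jeq_transform; auto.
- intros j. apply smooth_at_jet_repr.
- intros j. apply jet_repr_jet.
Qed.

Lemma jet_proj_prolong (k : nat) (f : point_transformation) (theta : J (S k)) :
  pt_dom f (fst theta) ->
  jet_proj (prolong (S k) f theta) = prolong k f (jet_proj theta).
Proof.
intros Hp. unfold jet_proj at 2. rewrite prolong_jet; auto using smooth_at_jet_repr.
unfold jet_proj, prolong. simpl. apply jet_eq. intros i.
apply (jeq_le (S k)); [lia|]. apply jet_repr_jet.
Qed.

(** * Inverses and composites of point transformations *)

Definition pt_sym (f : point_transformation) : point_transformation :=
  PointTransformation (pt_cod f) (pt_dom f) (pt_inv f) f (pt_cod_open f) (pt_dom_open f)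
    (pt_inv_dom f) (pt_fun_cod f) (pt_invK f) (pt_funK f) (pt_inv_smooth f) (pt_fun_smooth f).

(** Contravariance of the lift, applied to f^-1 o f. That composite is the identity only on
    [pt_dom f], which suffices since lifts depend on germs. *)
Lemma prolong_sym (k : nat) (f : point_transformation) (theta : J k) :
  pt_dom f (fst theta) -> prolong k (pt_sym f) (prolong k f theta) = theta.
Proof.
intros Hp. set (p := fst theta) in *. unfold prolong at 2.
rewrite prolong_jet; [|now apply pt_fun_cod|].
2: { intros i. apply smooth_at_transform; auto using smooth_at_jet_repr. }
simpl. rewrite pt_funK by easy. transitivity (jet k (jet_repr theta) p); [|apply jet_jet_repr].
apply jet_eq.
intros j. apply near_jeq. exists (pt_dom f). repeat split; auto using pt_dom_open.
intros q Hq. unfold transform, pt_sym; simpl.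
rewrite <- (lift_fib_comp f (pt_inv f)); auto using smooth_map_at_dom, smooth_map_at_cod,
  pt_fun_cod,
  lift_J_fun_neq0, lift_J_inv_neq0.
rewrite (lift_fib_near _ (fun z => z)).
- rewrite lift_fib_id. now rewrite pt_funK.
- exists (pt_dom f). repeat split; auto using pt_dom_open. intros z Hz. now rewrite pt_funK.
- exists (pt_dom f). repeat split; auto using pt_dom_open. intros z Hz. now rewrite pt_funK.
Qed.

Lemma open_preimage_smooth (D E : pt -> Prop) (g : pt -> pt) :
  open D -> open E -> smooth_map (U := VR2) D g -> open (fun x => D x /\ E (g x)).
Proof.
intros HD HE Hg. apply open_preimage; auto. intros x Hx.
now apply (smooth_map_continuous (U := VR2) D).
Qed.

Lemma smooth_map_comp {U : NormedModule R_AbsRing} (D : U -> Prop) (E : pt -> Prop)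
  (f : pt -> pt) (g : U -> pt) :
  open D -> open E -> (forall x, D x -> E (g x)) ->
  smooth_map (U := VR2) E f -> smooth_map D g -> smooth_map D (fun x => f (g x)).
Proof.
intros HD HE HDE [H1 H2] Hg. split.
- now apply (smooth_comp D E (fun y => fst (f y))).
- now apply (smooth_comp D E (fun y => snd (f y))).
Qed.

Lemma smooth_map_subset {U : NormedModule R_AbsRing} (D E : U -> Prop) (f : U -> pt) :
  (forall x, E x -> D x) -> smooth_map D f -> smooth_map E f.
Proof. intros H [H1 H2]. split; now apply (smooth_subset D). Qed.

#[local] Obligation Tactic := idtac.

Program Definition pt_comp (f h : point_transformation) : point_transformation :=
  PointTransformation (fun p => pt_dom h p /\ pt_dom f (h p))
    (fun q => pt_cod f q /\ pt_cod h (pt_inv f q))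
    (fun p => f (h p)) (fun q => pt_inv h (pt_inv f q)) _ _ _ _ _ _ _ _.
Next Obligation.
intros f h. apply open_preimage_smooth; auto using pt_dom_open, pt_fun_smooth.
Qed.
Next Obligation.
intros f h. apply open_preimage_smooth; auto using pt_cod_open, pt_inv_smooth.
Qed.
Next Obligation.
intros f h p [H1 H2]. split; [now apply pt_fun_cod|]. rewrite pt_funK by easy.
now apply pt_fun_cod.
Qed.
Next Obligation.
intros f h p [H1 H2]. split; [now apply pt_inv_dom|]. rewrite pt_invK by easy.
now apply pt_inv_dom.
Qed.
Next Obligation. intros f h p [H1 H2]. now rewrite !pt_funK. Qed.
Next Obligation. intros f h p [H1 H2]. now rewrite !pt_invK. Qed.
Next Obligation.
intros f h. apply (smooth_map_comp (U := VR2) _ (pt_dom f)).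
- apply open_preimage_smooth; auto using pt_dom_open, pt_fun_smooth.
- apply pt_dom_open.
- tauto.
- apply pt_fun_smooth.
- apply (smooth_map_subset (U := VR2) (pt_dom h)); [tauto|apply pt_fun_smooth].
Qed.
Next Obligation.
intros f h. apply (smooth_map_comp (U := VR2) _ (pt_cod h)).
- apply open_preimage_smooth; auto using pt_cod_open, pt_inv_smooth.
- apply pt_cod_open.
- tauto.
- apply pt_inv_smooth.
- apply (smooth_map_subset (U := VR2) (pt_cod f)); [tauto|apply pt_inv_smooth].
Qed.

Lemma prolong_comp (k : nat) (f h : point_transformation) (theta : J k) :
  pt_dom h (fst theta) -> pt_dom f (h (fst theta)) ->
  prolong k (pt_comp f h) theta = prolong k f (prolong k h theta).
Proof.
intros Hh Hf. unfold prolong at 3.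
rewrite prolong_jet; auto.
2: { intros i. apply smooth_at_transform; auto using smooth_at_jet_repr. }
unfold prolong. apply jet_eq. intros j. apply near_jeq.
exists (pt_cod (pt_comp f h)). repeat split; [apply pt_cod_open|now apply pt_fun_cod| |].
{ simpl. rewrite pt_funK by easy. now apply pt_fun_cod. }
intros q [Hq1 Hq2]. unfold transform; simpl.
apply (lift_fib_comp (pt_inv f) (pt_inv h)); auto using smooth_map_at_cod, lift_J_inv_neq0.
Qed.

(** * Push-forward of vector fields and flows *)

Lemma is_derive_fst (g : R -> pt) (t : R) (w : pt) :
  is_derive g t w -> is_derive (fun s => fst (g s)) t (fst w).
Proof.
intros H. unfold is_derive in *.
eapply filterdiff_ext_lin.
- apply (filterdiff_comp' g (fun z : VR2 => fst z) t _ (fun z : VR2 => fst z) H).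
  apply filterdiff_linear, is_linear_fst.
- reflexivity.
Qed.

Lemma is_derive_snd (g : R -> pt) (t : R) (w : pt) :
  is_derive g t w -> is_derive (fun s => snd (g s)) t (snd w).
Proof.
intros H. unfold is_derive in *.
eapply filterdiff_ext_lin.
- apply (filterdiff_comp' g (fun z : VR2 => snd z) t _ (fun z : VR2 => snd z) H).
  apply filterdiff_linear, is_linear_snd.
- reflexivity.
Qed.

Lemma is_derive_pair (g1 g2 : R -> R) (t : R) (l1 l2 : R) :
  is_derive g1 t l1 -> is_derive g2 t l2 ->
  is_derive (fun s => (g1 s, g2 s) : pt) t ((l1, l2) : pt).
Proof.
intros H1 H2. unfold is_derive in *.
apply (filterdiff_comp'_2 g1 g2 (fun a b => (a, b) : VR2) t _ _ (fun a b => (a, b) : VR2) H1 H2).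
apply (filterdiff_ext_lin _ (fun z : VR2 => z)).
- apply (filterdiff_ext (fun z : VR2 => z)); [now intros []|]. apply filterdiff_id.
- now intros [].
Qed.

Lemma is_derive_shift (g : R -> R) (t l : R) :
  is_derive (fun s => g (t + s)) 0 l -> is_derive g t l.
Proof.
intros H. apply (is_derive_ext (fun s => g (t + (s - t)))); [intros; f_equal; simpl; ring|].
evar_last.
- apply (is_derive_comp (fun r => g (t + r)) (fun s => s - t)).
  + replace (t - t) with 0 by ring. exact H.
  + auto_derive; [easy|reflexivity].
- unfold scal; simpl; unfold mult; simpl. ring.
Qed.

Lemma is_derive_shift_inv (g : R -> R) (t l : R) :
  is_derive g t l -> is_derive (fun s => g (t + s)) 0 l.
Proof.
intros H. evar_last.
- apply (is_derive_comp g (fun s => t + s)).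
  + rewrite Rplus_0_r. exact H.
  + auto_derive; [easy|reflexivity].
- unfold scal; simpl; unfold mult; simpl. ring.
Qed.

Lemma chain_curve (f : pt -> R) (g : R -> pt) (t : R) (w : pt) :
  smooth_at (g t) f -> is_derive g t w ->
  is_derive (fun s => f (g s)) t (fst w * ddx f (g t) + snd w * ddy f (g t)).
Proof.
intros [D [HD [Dp Hf]]] Hg. apply is_derive_shift.
apply (is_derive_ext (fun s => f (fst (g (t + s)), snd (g (t + s))))).
{ intros s. now rewrite <- surjective_pairing. }
pose proof (chain2 D f (fun s => fst (g (t + s))) (fun s => snd (g (t + s))) (fst w) (snd w) HD
  Hf) as C.
cbv beta in C. rewrite Rplus_0_r, <- surjective_pairing in C.
apply C; [easy| |].
- apply (is_derive_shift_inv (fun s => fst (g s))). now apply is_derive_fst.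
- apply (is_derive_shift_inv (fun s => snd (g s))). now apply is_derive_snd.
Qed.

(** The direct image of a vector field: its value at f(z) is the image of X(z) under the
    differential of f at z. *)
Definition push (f : point_transformation) (X : pt -> pt) : pt -> pt :=
  fun q => differential f (pt_inv f q) (X (pt_inv f q)).

Lemma smooth_at_push (f : point_transformation) (X : pt -> pt) (p : pt) :
  pt_dom f p -> smooth_map_at p X -> smooth_map_at (f p) (push f X).
Proof.
intros Hp [H1 H2].
assert (Hg : smooth_map_at (f p) (pt_inv f)) by now apply smooth_map_at_cod, pt_fun_cod.
assert (HC : forall h, smooth_at p h -> smooth_at (f p) (fun q => h (pt_inv f q))).
{ intros h Hh. apply smooth_at_comp; [now rewrite pt_funK|easy]. }
destruct (smooth_map_at_dom f p Hp) as [F1 F2].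
split; unfold push, differential; cbn [fst snd]; apply smooth_at_plus; apply smooth_at_mult.
all: first [apply (HC (partial _ _ _)); now apply smooth_at_partial
 | exact (HC (fun z => fst (X z)) H1) | exact (HC (fun z => snd (X z)) H2)].
Qed.

Lemma smooth_map_push (f : point_transformation) (X : pt -> pt) (D : pt -> Prop) :
  open D -> smooth_map (U := VR2) D X ->
  smooth_map (U := VR2) (fun q => pt_cod f q /\ D (pt_inv f q)) (push f X).
Proof.
intros HD HX.
assert (HO : open (fun q => pt_cod f q /\ D (pt_inv f q)))
  by (apply open_preimage_smooth; auto using pt_cod_open, pt_inv_smooth).
assert (Hg : smooth_map (U := VR2) (fun q => pt_cod f q /\ D (pt_inv f q)) (pt_inv f)).
{ apply (smooth_map_subset (U := VR2) (pt_cod f)); [tauto|apply pt_inv_smooth]. }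
assert (HF : forall h, smooth (U := VR2) (pt_dom f) h ->
  smooth (U := VR2) (fun q => pt_cod f q /\ D (pt_inv f q)) (fun q => h (pt_inv f q))).
{ intros h Hh. apply (smooth_comp (U := VR2) _ (pt_dom f)); auto using pt_dom_open.
  intros x [Hx _]. now apply pt_inv_dom. }
assert (HY : forall h, smooth (U := VR2) D h ->
  smooth (U := VR2) (fun q => pt_cod f q /\ D (pt_inv f q)) (fun q => h (pt_inv f q))).
{ intros h Hh. apply (smooth_comp (U := VR2) _ D); auto. now intros x [_ Hx]. }
destruct (pt_fun_smooth f) as [F1 F2]. destruct HX as [X1 X2].
split; unfold push, differential; cbn [fst snd]; apply (smooth_plus (U := VR2)); auto;
 apply (smooth_mult (U := VR2)); auto.
all: first [apply (HF (partial _ _ _)); now apply smooth_partial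
 | exact (HY (fun z => fst (X z)) X1) | exact (HY (fun z => snd (X z)) X2)].
Qed.

Lemma open_slab (eps : R) (U : pt -> Prop) :
  open U -> open (fun tq : VR3 => Rabs (fst tq) < eps /\ U (snd tq)).
Proof.
intros HU [x1 x2] [H1 H2]. apply filter_and.
- simpl in H1. assert (Hd : 0 < eps - Rabs x1) by lra.
  exists (mkposreal _ Hd). intros [y1 y2] [Hy _].
  apply (proj1 (ball_RE x1 (eps - Rabs x1) y1)) in Hy. simpl.
  replace y1 with ((y1 - x1) + x1) by ring.
  eapply Rle_lt_trans; [apply Rabs_triang|]. lra.
- destruct (HU _ H2) as [d Hd]. exists d. intros y [_ Hy]. now apply Hd.
Qed.

Definition conj_flow (f : point_transformation) (phi : R -> point_transformation)
  : R -> point_transformation := fun t => pt_comp f (pt_comp (phi t) (pt_sym f)).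

(** The conjugate f o phi_t o f^-1 has velocity field [push f X] by the chain rule. Times and points
    must be restricted so that phi_t does not leave the domain of [f]. *)
Lemma local_flow_push (f : point_transformation) (X : pt -> pt) (p : pt)
  (phi : R -> point_transformation) :
  pt_dom f p -> local_flow X p phi -> local_flow (push f X) (f p) (conj_flow f phi).
Proof.
intros Hp [eps [U [D [Heps [HU [Up [HD [HX [Hdom [Hsm [H0 Hder]]]]]]]]]]].
set (Phi := fun tq : VR3 => pt_fun (phi (fst tq)) (snd tq)) in *.
assert (HW := open_slab eps U HU).
assert (Hc : continuous Phi ((0, p) : VR3)).
{ apply (smooth_map_continuous (U := VR3) _ _ _ Hsm). simpl. rewrite Rabs_R0. now split. }
assert (HL : locally ((0, p) : VR3) (fun tq => pt_dom f (Phi tq))).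
{ apply Hc. unfold Phi; simpl. rewrite H0 by easy. now apply pt_dom_open. }
destruct HL as [d Hd].
(* The points all of whose neighbours stay in the domain of [f] for |t| < d. Using [locally] makes
   this set open, and continuity of the flow at (0, p) puts [p] in it. *)
set (U0 := fun q : pt => locally q (fun z => forall t, Rabs t < d -> pt_dom f (phi t z))).
assert (HU0 : open U0) by (intros q Hq; now apply locally_locally).
assert (U0p : U0 p).
{ exists d. intros z Hz t Ht. apply (Hd (t, z)). split; [|exact Hz].
  apply (proj2 (ball_RE _ _ _)). simpl. now rewrite Rminus_0_r. }
assert (U0f : forall q t, U0 q -> Rabs t < d -> pt_dom f (phi t q)).
{ intros q t Hq. exact (locally_singleton _ _ Hq t). }
assert (Hq : pt_cod f (f p)) by now apply pt_fun_cod.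
exists (Rmin eps d), (fun q => pt_cod f q /\ (U (pt_inv f q) /\ U0 (pt_inv f q))),
  (fun q => pt_cod f q /\ D (pt_inv f q)).
assert (HU' : open (fun q => pt_cod f q /\ (U (pt_inv f q) /\ U0 (pt_inv f q)))).
{ apply (open_preimage_smooth (pt_cod f) (fun z => U z /\ U0 z));
  auto using pt_cod_open, pt_inv_smooth. now apply open_and. }
split; [apply Rmin_pos; [easy|apply d]|].
split; [exact HU'|].
split; [rewrite pt_funK; auto|].
split; [apply open_preimage_smooth; auto using pt_cod_open, pt_inv_smooth|].
split; [now apply smooth_map_push|].
split; [|split; [|split]].
- intros t q Ht [Q1 [Q2 Q3]].
  assert (Ht1 : Rabs t < eps) by (eapply Rlt_le_trans; [exact Ht|apply Rmin_l]).
  assert (Ht2 : Rabs t < d) by (eapply Rlt_le_trans; [exact Ht|apply Rmin_r]).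
  destruct (Hdom t (pt_inv f q) Ht1 Q2) as [K1 K2].
  assert (K3 : pt_dom f (phi t (pt_inv f q))) by auto.
  simpl. repeat split; auto.
  + now apply pt_fun_cod.
  + now rewrite pt_funK.
- set (W := fun tq : VR3 => Rabs (fst tq) < Rmin eps d /\
    (pt_cod f (snd tq) /\ (U (pt_inv f (snd tq)) /\ U0 (pt_inv f (snd tq))))).
  assert (HWo : open W) by apply (open_slab _ _ HU').
  assert (Hs : forall h : VR2 -> R, smooth (pt_cod f) h -> smooth W (fun tq => h (snd tq))).
  { intros h Hh. apply (smooth_subset (U := VR3) (fun y => pt_cod f (snd y)));
    [now intros x [_ [Hx _]]|].
    intros n. now apply Ck_snd. }
  destruct (pt_inv_smooth f) as [G1 G2].
  assert (Ht : smooth (U := VR3) W (fun tq => fst tq)).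
  { apply (smooth_linear (U := VR3)); [intros; apply continuous_fstU|reflexivity]. }
  assert (Hin : forall tq, W tq -> Rabs (fst tq) < eps /\ U (fst (pt_inv f (snd tq)),
    snd (pt_inv f (snd tq)))).
  { intros tq [T1 [_ [T2 _]]]. rewrite <- surjective_pairing. split; [|easy].
    eapply Rlt_le_trans; [exact T1|apply Rmin_l]. }
  apply (smooth_map_comp (U := VR3) W (pt_dom f) f (fun tq => Phi (fst tq, pt_inv f (snd tq))));
   auto using pt_dom_open, pt_fun_smooth.
  + intros tq [T1 [_ [_ T2]]]. unfold Phi; simpl. apply U0f; [easy|].
    eapply Rlt_le_trans; [exact T1|apply Rmin_r].
  + destruct Hsm as [S1 S2]. split.
    * apply (smooth_ext (U := VR3) W (fun tq => fst (Phi (fst tq, (fst (pt_inv f (snd tq)),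
      snd (pt_inv f (snd tq))))))); [easy|intros; now rewrite <- surjective_pairing|].
      apply (smooth_comp3 (U := VR3) W _ (fun y => fst (Phi y)) (fun tq => fst tq)
       (fun tq => fst (pt_inv f (snd tq))) (fun tq => snd (pt_inv f (snd tq))) HWo HW Hin S1 Ht).
      -- exact (Hs _ G1).
      -- exact (Hs _ G2).
    * apply (smooth_ext (U := VR3) W (fun tq => snd (Phi (fst tq, (fst (pt_inv f (snd tq)),
      snd (pt_inv f (snd tq))))))); [easy|intros; now rewrite <- surjective_pairing|].
      apply (smooth_comp3 (U := VR3) W _ (fun y => snd (Phi y)) (fun tq => fst tq)
       (fun tq => fst (pt_inv f (snd tq))) (fun tq => snd (pt_inv f (snd tq))) HWo HW Hin S2 Ht).
      -- exact (Hs _ G1).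
      -- exact (Hs _ G2).
- intros q [Q1 [Q2 Q3]]. simpl. rewrite H0 by easy. now apply pt_invK.
- intros t q Ht [Q1 [Q2 Q3]].
  assert (Ht1 : Rabs t < eps) by (eapply Rlt_le_trans; [exact Ht|apply Rmin_l]).
  assert (Ht2 : Rabs t < d) by (eapply Rlt_le_trans; [exact Ht|apply Rmin_r]).
  assert (K3 : pt_dom f (phi t (pt_inv f q))) by auto.
  pose proof (Hder t (pt_inv f q) Ht1 Q2) as Hd'.
  destruct (smooth_map_at_dom f _ K3) as [F1 F2].
  unfold push; simpl. rewrite pt_funK by easy. unfold differential.
  rewrite !partial10, !partial01.
  apply (is_derive_ext (fun s => (fst (f (phi s (pt_inv f q))),
    snd (f (phi s (pt_inv f q)))) : pt)).
  { intros s. now rewrite <- surjective_pairing. }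
  apply is_derive_pair.
  + evar_last; [apply (chain_curve (fun z => fst (f z)) (fun s => phi s (pt_inv f q)) t _ F1
    Hd')|].
    simpl. ring.
  + evar_last; [apply (chain_curve (fun z => snd (f z)) (fun s => phi s (pt_inv f q)) t _ F2
    Hd')|].
    simpl. ring.
Qed.

(** * Tangent maps of prolongations *)

(** Differentiability along curves, with one derivative common to all curves through [theta] of
    velocity [v]. It replaces a differentiable structure on the space of jets. *)
Definition dirdiff {k} (theta v : J k) (F : J k -> R) : Prop :=
  exists l, forall gamma : R -> J k, gamma 0 = theta -> velocity gamma v ->
    is_derive (fun t => F (gamma t)) 0 l.

Lemma dirdiff_plus {k} (theta v : J k) (F G : J k -> R) :
  dirdiff theta v F -> dirdiff theta v G -> dirdiff theta v (fun x => F x + G x).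
Proof.
intros [l Hl] [m Hm]. exists (l + m). intros g H0 Hg.
apply (is_derive_plus (V := R_NormedModule)); auto.
Qed.

Lemma dirdiff_mult {k} (theta v : J k) (F G : J k -> R) :
  dirdiff theta v F -> dirdiff theta v G -> dirdiff theta v (fun x => F x * G x).
Proof.
intros [l Hl] [m Hm]. exists (l * G theta + F theta * m). intros g H0 Hg.
pose proof (is_derive_mult (fun t => F (g t)) (fun t => G (g t)) 0 l m (Hl g H0 Hg) (Hm g H0 Hg)
  Rmult_comm) as H.
cbv beta in H. rewrite H0 in H. exact H.
Qed.

Lemma dirdiff_base {k} (theta v : J k) (A : pt -> R) :
  smooth_at (fst theta) A -> dirdiff theta v (fun x => A (fst x)).
Proof.
intros HA. eexists. intros g H0 [Hg _].
evar_last; [apply (chain_curve A (fun t => fst (g t)) 0 (fst v)); [now rewrite H0|exact Hg]|].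
rewrite H0. reflexivity.
Qed.

Lemma dirdiff_coef {k} (theta v : J k) (i : fib) (a b : nat) :
  dirdiff theta v (fun x => coef (snd x i) a b).
Proof.
exists (coef (snd v i) a b). intros g H0 [_ Hg]. unfold coef.
destruct le_dec; [apply Hg|apply @is_derive_const].
Qed.

Lemma velocity_locally {k} (gamma : R -> J k) (v : J k) (D : pt -> Prop) :
  velocity gamma v -> open D -> D (fst (gamma 0)) -> locally (0 : R) (fun t => D (fst (gamma t))).
Proof.
intros [H _] HD H0.
assert (Hc : continuous (fun t => fst (gamma t) : pt) 0).
{ apply (@ex_derive_continuous R_AbsRing VR2). eexists; exact H. }
apply Hc. now apply HD.
Qed.

Lemma dirdiff_ext {k} (theta v : J k) (D : pt -> Prop) (F G : J k -> R) :
  open D -> D (fst theta) -> (forall x, D (fst x) -> F x = G x) ->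
  dirdiff theta v F -> dirdiff theta v G.
Proof.
intros HD H0 He [l Hl]. exists l. intros g Hg0 Hg.
apply (is_derive_ext_loc (fun t => F (g t))); [|auto].
assert (Hl' : locally (0 : R) (fun t => D (fst (g t)))) by (apply (velocity_locally g v); auto;
  now rewrite Hg0).
generalize Hl'. apply filter_imp. auto.
Qed.

Lemma dirdiff_sum4 {k} (theta v : J k) (s : J k -> R) (F : fib -> J k -> R) :
  dirdiff theta v s -> (forall i, dirdiff theta v (F i)) ->
  dirdiff theta v (fun x => s x + (F U1 x + (F U2 x + (F U3 x + F U4 x)))).
Proof.
intros Hs HF. apply dirdiff_plus; [exact Hs|].
apply dirdiff_plus; [apply HF|]. apply dirdiff_plus; [apply HF|]. apply dirdiff_plus; apply HF.
Qed.

Lemma D_transform (f : point_transformation) (S : section) (j : fib) (p w : pt) :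
  pt_dom f p -> (forall i, smooth_at p (S i)) ->
  let q := f p in
  let term i := ddp w (lift_lin (pt_inv f) j i) q * S i p
    + lift_lin (pt_inv f) j i q * (ddp w (fun z => fst (pt_inv f z)) q * ddx (S i) p
       + ddp w (fun z => snd (pt_inv f z)) q * ddy (S i) p) in
  ddp w (transform f S j) q = ddp w (lift_shift (pt_inv f) j) q
    + (term U1 + (term U2 + (term U3 + term U4))).
Proof.
intros Hp HS. cbv zeta. rewrite transform_affine.
assert (Hq : pt_cod f (f p)) by now apply pt_fun_cod.
assert (Hg := smooth_map_at_cod f (f p) Hq).
assert (HC : forall i, smooth_at (f p) (fun q => S i (pt_inv f q))).
{ intros i. apply smooth_at_comp; [rewrite (pt_funK f p Hp); apply HS|exact Hg]. }
assert (HL := fun i => smooth_at_lift_lin f j i (f p) Hq).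
assert (HM : forall i, smooth_at (f p) (fun q => lift_lin (pt_inv f) j i q * S i (pt_inv f q))).
{ intros i. apply smooth_at_mult; auto. }
assert (HT : forall i, ddp w (fun q => lift_lin (pt_inv f) j i q * S i (pt_inv f q)) (f p)
 = ddp w (lift_lin (pt_inv f) j i) (f p) * S i p
    + lift_lin (pt_inv f) j i (f p) * (ddp w (fun z => fst (pt_inv f z)) (f p) * ddx (S i) p
       + ddp w (fun z => snd (pt_inv f z)) (f p) * ddy (S i) p)).
{ intros i. rewrite D_mult by auto.
  assert (HS' : smooth_at (pt_inv f (f p)) (S i)) by (rewrite (pt_funK f p Hp); apply HS).
  rewrite (DDcomp w (f p) (S i) (pt_inv f) HS' Hg), (pt_funK f p Hp). reflexivity. }
rewrite D_plus; [|now apply smooth_at_lift_shift|do 3 (apply smooth_at_plus; [apply HM|]);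
  apply HM].
rewrite D_plus; [|apply HM|do 2 (apply smooth_at_plus; [apply HM|]); apply HM].
rewrite D_plus; [|apply HM|apply smooth_at_plus; apply HM].
rewrite D_plus; [|apply HM|apply HM].
now rewrite !HT.
Qed.

Lemma smooth_at_base (f : point_transformation) (A : pt -> R) (p : pt) :
  pt_dom f p -> smooth_at (f p) A -> smooth_at p (fun z => A (f z)).
Proof. intros Hp HA. apply smooth_at_comp; [easy|now apply smooth_map_at_dom]. Qed.

Lemma taylor_at {k} (p : pt) (c : mindex k -> R) : taylor p c p = coef c 0 0.
Proof. rewrite <- (partial_taylor p c 0 0) by lia. now rewrite partial00. Qed.

Lemma ddx_taylor {k} (p : pt) (c : mindex k -> R) :
  (1 <= k)%nat -> ddx (taylor p c) p = coef c 1 0.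
Proof. intros H. rewrite <- (partial_taylor p c 1 0) by lia. now rewrite partial10. Qed.

Lemma ddy_taylor {k} (p : pt) (c : mindex k -> R) :
  (1 <= k)%nat -> ddy (taylor p c) p = coef c 0 1.
Proof. intros H. rewrite <- (partial_taylor p c 0 1) by lia. now rewrite partial01. Qed.

(** On J^1 the components of f^(1) are affine in the fibre coordinates, with coefficients smooth in
    the base point: [transform_affine] shows it at order 0 and [D_transform] at order 1. *)
Lemma dirdiff_prolong (f : point_transformation) (theta v : J 1) (j : fib) (s : mindex 1) :
  pt_dom f (fst theta) -> dirdiff theta v (fun x => snd (prolong 1 f x) j s).
Proof.
intros Hp.
assert (Hq : pt_cod f (f (fst theta))) by now apply pt_fun_cod.
assert (HB : forall A, smooth_at (f (fst theta)) A -> dirdiff theta v (fun x => A (f (fst x)))).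
{ intros A HA. apply (dirdiff_base theta v (fun z => A (f z))). now apply smooth_at_base. }
assert (HL := fun i => smooth_at_lift_lin f j i _ Hq).
assert (HS := smooth_at_lift_shift f j _ Hq).
destruct (smooth_map_at_cod f _ Hq) as [G1 G2].
assert (HP := fun A w => smooth_at_ddp (f (fst theta)) w A).
assert (HD : forall w, dirdiff theta v (fun x => ddp w (transform f (jet_repr x) j) (f (fst x)))).
{ intros w.
  set (F := fun i (x : J 1) => ddp w (lift_lin (pt_inv f) j i) (f (fst x)) * coef (snd x i) 0 0
    + lift_lin (pt_inv f) j i (f (fst x)) *
      (ddp w (fun z => fst (pt_inv f z)) (f (fst x)) * coef (snd x i) 1 0
       + ddp w (fun z => snd (pt_inv f z)) (f (fst x)) * coef (snd x i) 0 1)).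
  apply (dirdiff_ext theta v (pt_dom f) (fun x => ddp w (lift_shift (pt_inv f) j) (f (fst x))
    + (F U1 x + (F U2 x + (F U3 x + F U4 x)))) _ (pt_dom_open f) Hp).
  - intros x Hx.
    pose proof (D_transform f (jet_repr x) j (fst x) w Hx (smooth_at_jet_repr x (fst x))) as E.
    cbv beta zeta in E. rewrite E. clear E.
    unfold jet_repr. rewrite !taylor_at, !ddx_taylor, !ddy_taylor by lia. reflexivity.
  - apply (dirdiff_sum4 theta v (fun x => ddp w (lift_shift (pt_inv f) j) (f (fst x))) F);
      [apply HB, HP, HS|].
    intros i. unfold F. apply dirdiff_plus; apply dirdiff_mult.
    + apply HB, HP, HL.
    + apply dirdiff_coef.
    + apply HB, HL.
    + apply dirdiff_plus; apply dirdiff_mult.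
      * apply HB, HP, G1.
      * apply dirdiff_coef.
      * apply HB, HP, G2.
      * apply dirdiff_coef. }
destruct s as [[a b] Hab]; simpl in Hab.
assert (Hc : (a = 0 /\ b = 0 \/ a = 1 /\ b = 0 \/ a = 0 /\ b = 1)%nat) by lia.
unfold prolong, jet, fjet, ix, iy; cbn [fst snd proj1_sig].
destruct Hc as [[-> ->]|[[-> ->]|[-> ->]]].
- set (F := fun i (x : J 1) => lift_lin (pt_inv f) j i (f (fst x)) * coef (snd x i) 0 0).
  apply (dirdiff_ext theta v (pt_dom f) (fun x => lift_shift (pt_inv f) j (f (fst x))
    + (F U1 x + (F U2 x + (F U3 x + F U4 x)))) _ (pt_dom_open f) Hp).
  + intros x Hx. rewrite partial00, transform_affine. cbv beta. rewrite pt_funK by easy.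
    unfold jet_repr. rewrite !taylor_at. reflexivity.
  + apply (dirdiff_sum4 theta v (fun x => lift_shift (pt_inv f) j (f (fst x))) F);
      [apply HB, HS|].
    intros i. unfold F. apply dirdiff_mult; [apply HB, HL|apply dirdiff_coef].
- destruct (HD (1, 0)) as [l Hl]. exists l. intros g H1 H2. specialize (Hl g H1 H2).
  apply (is_derive_ext (fun t => ddx (transform f (jet_repr (g t)) j) (f (fst (g t)))));
    [|exact Hl].
  intros t. now rewrite partial10.
- destruct (HD (0, 1)) as [l Hl]. exists l. intros g H1 H2. specialize (Hl g H1 H2).
  apply (is_derive_ext (fun t => ddy (transform f (jet_repr (g t)) j) (f (fst (g t)))));
    [|exact Hl].
  intros t. now rewrite partial01.
Qed.

(** The point is that [v'] is the same for all curves. A lifted field tangent to the graph of j_1 S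
    is the velocity of two curves, an orbit of the lifted flow and a curve in the graph, and their
    images under f^(1) must again share their velocity. *)
Lemma prolong_velocity (f : point_transformation) (theta v : J 1) :
  pt_dom f (fst theta) -> exists v' : J 1, forall gamma : R -> J 1,
    gamma 0 = theta -> velocity gamma v -> velocity (fun t => prolong 1 f (gamma t)) v'.
Proof.
intros Hp.
set (L := fun i s => proj1_sig (constructive_indefinite_description _ (dirdiff_prolong f theta v
  i s Hp))).
exists (differential f (fst theta) (fst v), L).
intros g H0 Hg. split.
- destruct (smooth_map_at_dom f _ Hp) as [F1 F2]. destruct Hg as [Hg _].
  unfold prolong, jet, differential; cbn [fst snd]. rewrite !partial10, !partial01.
  apply (is_derive_ext (fun s => (fst (f (fst (g s))), snd (f (fst (g s)))) : pt)).
  { intros s. now rewrite <- surjective_pairing. }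
  apply is_derive_pair.
  + evar_last; [apply (chain_curve (fun z => fst (f z)) (fun s => fst (g s)) 0 (fst v));
    [now rewrite H0|exact Hg]|].
    rewrite H0. simpl. ring.
  + evar_last; [apply (chain_curve (fun z => snd (f z)) (fun s => fst (g s)) 0 (fst v));
    [now rewrite H0|exact Hg]|].
    rewrite H0. simpl. ring.
- intros i s. cbn [snd].
  exact (proj2_sig (constructive_indefinite_description _ (dirdiff_prolong f theta v i s Hp)) g
    H0 Hg).
Qed.

(** Stated for a map which is the identity only near the base point, since that is all a local flow
    gives at time 0. *)
Lemma prolong_id {k} (f : point_transformation) (theta : J k) (U : pt -> Prop) :
  open U -> U (fst theta) -> (forall q, U q -> pt_dom f q) -> (forall q, U q -> f q = q) ->
  prolong k f theta = theta.
Proof.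
intros HU Hp Hd Hf. unfold prolong. rewrite Hf by easy.
transitivity (jet k (jet_repr theta) (fst theta)); [|apply jet_jet_repr].
apply jet_eq. intros j. apply near_jeq. exists U. repeat split; auto.
assert (HI : forall q, U q -> pt_inv f q = q).
{ intros q Hq. rewrite <- (Hf q Hq) at 1. apply pt_funK; auto. }
intros q Hq. unfold transform. rewrite (lift_fib_near _ (fun z => z)).
- now rewrite lift_fib_id, HI.
- exists U. repeat split; auto. intros z Hz. now rewrite HI.
- exists U. repeat split; auto. intros z Hz. now rewrite HI.
Qed.

Lemma ddy_partial (p : pt) (f : pt -> R) (a b : nat) :
  smooth_at p f -> ddy (partial a b f) p = partial a (S b) f p.
Proof.
intros [D [HD [Dp Hf]]]. revert p Dp. induction a as [|a IH]; intros p Dp.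
- now rewrite partial0S.
- rewrite !partial_Sl, (ddp_comm D) by (auto using smooth_partial).
  now apply (ddp_ext_open D).
Qed.

Lemma velocity_unique {k} (g : R -> J k) (v w : J k) : velocity g v -> velocity g w -> v = w.
Proof.
intros [H1 H2] [K1 K2]. destruct v as [[v1 v2] c], w as [[w1 w2] d]. cbn [fst snd] in *.
apply is_derive_fst in H1 as H3. apply is_derive_fst in K1 as K3.
apply is_derive_snd in H1. apply is_derive_snd in K1. cbn [fst snd] in *.
f_equal; [f_equal|].
- rewrite <- (is_derive_unique _ _ _ H3). now apply is_derive_unique.
- rewrite <- (is_derive_unique _ _ _ H1). now apply is_derive_unique.
- apply functional_extensionality; intros i. apply functional_extensionality; intros s.
  rewrite <- (is_derive_unique _ _ _ (H2 i s)). now apply is_derive_unique.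
Qed.

(** Besides the velocity of the base curve, only derivatives of the section of order at most k + 1
    enter. Hence tangency to the graph of j_k S is a condition on the (k+1)-jet of S. *)
Lemma velocity_jet (k : nat) (S : section) (c : R -> pt) (w : pt) :
  (forall i, smooth_at (c 0) (S i)) -> is_derive c 0 w ->
  velocity (fun t => jet k S (c t))
   (w, fun i s => fst w * partial (Datatypes.S (ix s)) (iy s) (S i) (c 0)
                + snd w * partial (ix s) (Datatypes.S (iy s)) (S i) (c 0)).
Proof.
intros HS Hc. split; [exact Hc|]. intros i s. unfold jet, fjet; cbn [snd].
evar_last; [apply (chain_curve (partial (ix s) (iy s) (S i)) c 0 w);
  [now apply smooth_at_partial|exact Hc]|].
now rewrite ddy_partial, partial_Sl.
Qed.

Lemma is_derive_linepath (p w : pt) : is_derive (fun s : R => plus p (scal s w) : pt) 0 w.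
Proof.
apply (is_derive_ext (fun s => (fst p + s * fst w, snd p + s * snd w) : pt)).
- intros s. reflexivity.
- destruct w as [w1 w2]. apply is_derive_pair; simpl; auto_derive; auto; ring.
Qed.

Lemma velocity_ext {k} (g h : R -> J k) (v : J k) :
  locally (0 : R) (fun t => g t = h t) -> velocity g v -> velocity h v.
Proof.
intros He [H1 H2]. split.
- apply (is_derive_ext_loc (V := VR2) (fun t => fst (g t))); [|exact H1].
  revert He. apply filter_imp. now intros t ->.
- intros i s. apply (is_derive_ext_loc (fun t => snd (g t) i s)); [|apply H2].
  revert He. apply filter_imp. now intros t ->.
Qed.

(** f^(1) sends the orbit of the lifted flow to the orbit of the conjugate flow, because
    prolongation respects composites, and the graph of j_1 S to that of the transformed section. By
    [prolong_velocity] both images have velocity [v']. *)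
Lemma lifted_vector_push (f : point_transformation) (X : pt -> pt) (theta : J 2) (v : J 1) :
  pt_dom f (fst theta) -> lifted_vector 1 X (jet_proj theta) v -> jet_tangent theta v ->
  exists v', lifted_vector 1 (push f X) (jet_proj (prolong 2 f theta)) v' /\
    jet_tangent (prolong 2 f theta) v'.
Proof.
intros Hp [phi [Hphi Hv]] [w Hw].
destruct (prolong_velocity f (jet_proj theta) v Hp) as [v' Hv'].
set (p := fst theta) in *.
exists v'. split.
- exists (conj_flow f phi). split; [now apply local_flow_push|].
  assert (H0 : prolong 1 (phi 0) (jet_proj theta) = jet_proj theta).
  { destruct Hphi as [eps [U [D [Heps [HU [Up [HD [HX [Hdom [Hsm [H0 Hder]]]]]]]]]]].
    apply (prolong_id _ _ U); auto. intros q Hq. apply (Hdom 0 q); auto. now rewrite Rabs_R0. }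
  pose proof (Hv' _ H0 Hv) as HV.
  assert (Hd : locally (0 : R) (fun t => pt_dom f (phi t p))).
  { apply (velocity_locally _ v (pt_dom f) Hv (pt_dom_open f)). rewrite H0. exact Hp. }
  destruct Hphi as [eps [U [D [Heps [HU [Up [HD [HX [Hdom [Hsm [_ Hder]]]]]]]]]]].
  assert (Hd2 : locally (0 : R) (fun t => pt_dom (phi t) p)).
  { exists (mkposreal _ Heps). intros t Ht. apply (proj1 (ball_RE _ _ _)) in Ht. simpl in Ht.
    rewrite Rminus_0_r in Ht.
    now apply (Hdom t p). }
  eapply velocity_ext; [|exact HV].
  generalize (filter_and _ _ Hd Hd2). apply filter_imp. intros t [K1 K2].
  rewrite (jet_proj_prolong 1) by easy. unfold conj_flow.
  set (th1 := jet_proj theta) in *.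
  assert (E : fst (prolong 1 f th1) = f p) by reflexivity.
  assert (C : pt_cod f (f p)) by now apply pt_fun_cod.
  rewrite prolong_comp.
  + rewrite prolong_comp.
    * now rewrite prolong_sym.
    * exact C.
    * rewrite E. simpl. now rewrite pt_funK.
  + rewrite E. simpl. split; [exact C|now rewrite pt_funK].
  + rewrite E. simpl. now rewrite pt_funK.
- set (sigma := fun s : R => jet 1 (jet_repr theta) (plus p (scal s w))) in *.
  assert (S0 : sigma 0 = jet_proj theta).
  { unfold sigma. now rewrite (line_0 (U := VR2)). }
  pose proof (Hv' sigma S0 Hw) as HV.
  exists (fst v').
  assert (HS : forall i, smooth_at (f p) (transform f (jet_repr theta) i)).
  { intros i. apply smooth_at_transform; auto. intros; apply smooth_at_jet_repr. }
  assert (HVf : is_derive (fun s : R => f (plus p (scal s w)) : pt) 0 (fst v')) by apply HV.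
  assert (E0 : plus p (scal 0 w) = p) by apply (line_0 (U := VR2)).
  (* The image of the straight line through [p] is a curve in the base; by [velocity_jet] it can be
     exchanged for the straight line with the same velocity. *)
  assert (K1 : velocity (fun s : R => prolong 1 f (sigma s))
   (fst v', fun i s => fst (fst v') * partial (S (ix s)) (iy s) (transform f (jet_repr theta) i)
     (f p)
      + snd (fst v') * partial (ix s) (S (iy s)) (transform f (jet_repr theta) i) (f p))).
  { eapply velocity_ext.
    2: { pose proof (velocity_jet 1 (transform f (jet_repr theta)) (fun s : R => f (plus p (scal
      s w))) (fst v')) as Q.
      cbv beta in Q. rewrite E0 in Q. apply Q; [exact HS|exact HVf]. }
    assert (HL := locally_line (U := VR2) (pt_dom f) p w (pt_dom_open f) Hp).
    revert HL. apply filter_imp. intros s Hs. unfold sigma.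
    rewrite prolong_jet; auto using smooth_at_jet_repr. }
  rewrite (velocity_unique _ _ _ HV K1).
  set (w' := fst v'). change (fst (prolong 2 f theta)) with (f p). cbn [fst snd].
  pose proof (velocity_jet 1 (jet_repr (prolong 2 f theta)) (fun s : R => plus (f p) (scal s w'))
    w') as Q.
  cbv beta in Q.
  replace (plus (f p) (scal 0 w')) with (f p) in Q by (symmetry; apply (line_0 (U := VR2))).
  (* Only derivatives of order at most 2 occur in the velocity, so the transformed section may be
     replaced by the representative of its 2-jet. *)
  assert (HJ : forall i, jeq 2 (f p) (jet_repr (prolong 2 f theta) i) (transform f (jet_repr
    theta) i)).
  { intros i. apply jet_repr_jet. }
  match goal with |- velocity _ ?x => match type of Q with _ -> _ -> velocity _ ?y => replace x
    with y end end.
  + apply Q; [intros; apply smooth_at_jet_repr|apply is_derive_linepath].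
  + f_equal. apply functional_extensionality; intros i.
    apply functional_extensionality; intros [[a b] Hs].
    unfold ix, iy; simpl in *. now rewrite !(HJ i) by lia.
Qed.

(** * Push-forward of jets of vector fields *)

Definition vjeq (k : nat) (p : pt) (X Y : pt -> pt) : Prop :=
  jeq k p (fun q => fst (X q)) (fun q => fst (Y q)) /\
  jeq k p (fun q => snd (X q)) (fun q => snd (Y q)).

Lemma vjet_eq (k : nat) (p : pt) (X Y : pt -> pt) :
  vjeq k p X Y -> vjet k X p = vjet k Y p.
Proof.
intros [H1 H2]. unfold vjet. now rewrite (proj2 (fjet_eq _ _ _ _) H1),
  (proj2 (fjet_eq _ _ _ _) H2).
Qed.

Lemma vjet_vjet_repr {k} (p : pt) (c : vjets k) : vjet k (vjet_repr p c) p = c.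
Proof.
apply functional_extensionality; intros s. unfold vjet, vjet_repr. cbn [fst snd].
change (fun q : pt => taylor p (fun s => fst (c s)) q) with (taylor p (fun s => fst (c s))).
change (fun q : pt => taylor p (fun s => snd (c s)) q) with (taylor p (fun s => snd (c s))).
rewrite !fjet_taylor. now rewrite <- surjective_pairing.
Qed.

Lemma vjet_repr_vjet (k : nat) (p : pt) (X : pt -> pt) : vjeq k p (vjet_repr p (vjet k X p)) X.
Proof. split; apply taylor_fjet. Qed.

Lemma smooth_map_at_vjet_repr {k} (p q : pt) (c : vjets k) : smooth_map_at q (vjet_repr p c).
Proof. split; apply smooth_at_taylor. Qed.

Lemma vcoef_vjet (k : nat) (X : pt -> pt) (p : pt) (a b : nat) : (a + b <= k)%nat ->
  vcoef (vjet k X p) a b =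
  (partial a b (fun q => fst (X q)) p, partial a b (fun q => snd (X q)) p).
Proof.
intros H. unfold vcoef, vjet. cbn [fst snd].
f_equal; exact (coef_fjet k _ p a b H).
Qed.

Lemma vcoef_add {k} (c d : vjets k) (a b : nat) :
  vcoef (vjet_add c d) a b = plus (vcoef c a b) (vcoef d a b).
Proof.
unfold vcoef, vjet_add, coef. destruct le_dec; [reflexivity|].
unfold plus; simpl; unfold prod_plus; simpl. unfold plus; simpl. f_equal; ring.
Qed.

Lemma vcoef_scal {k} (r : R) (c : vjets k) (a b : nat) :
  vcoef (vjet_scal r c) a b = scal r (vcoef c a b).
Proof.
unfold vcoef, vjet_scal, coef. destruct le_dec; [reflexivity|].
unfold scal; simpl; unfold prod_scal; simpl. unfold scal; simpl; unfold mult; simpl.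
f_equal; ring.
Qed.

Lemma vcoef_zero {k} (a b : nat) : vcoef (@vjet_zero k) a b = (0, 0).
Proof. unfold vcoef, vjet_zero, coef. now destruct le_dec. Qed.

Lemma vjets_eq {k} (c d : vjets k) :
  (forall a b, (a + b <= k)%nat -> vcoef c a b = vcoef d a b) -> c = d.
Proof.
intros H. apply functional_extensionality; intros s.
rewrite (surjective_pairing (c s)), (surjective_pairing (d s)).
rewrite <- (coef_ix (fun s => fst (c s)) s), <- (coef_ix (fun s => snd (c s)) s),
 <- (coef_ix (fun s => fst (d s)) s), <- (coef_ix (fun s => snd (d s)) s).
exact (H (ix s) (iy s) (proj2_sig s)).
Qed.

Lemma rho_vjet (k j : nat) (X : pt -> pt) (p : pt) : (j <= k)%nat ->
  rho j (vjet k X p) = vjet j X p.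
Proof.
intros H. apply functional_extensionality; intros [[a b] Hab]. simpl in Hab.
unfold rho. rewrite vcoef_vjet by (unfold ix, iy; simpl; lia). reflexivity.
Qed.

Lemma vcoef_rho {k} (j : nat) (c : vjets k) (a b : nat) : (a + b <= j)%nat ->
  vcoef (rho j c) a b = vcoef c a b.
Proof.
intros H. unfold vcoef at 1, coef. destruct le_dec; [|easy].
unfold rho, ix, iy. simpl. reflexivity.
Qed.

(** [push] multiplies the components of the field by functions determined by [f] and composes with
    f^-1. No derivative of the field is taken, so the order k is preserved. *)
Lemma push_vjeq (k : nat) (f : point_transformation) (X Y : pt -> pt) (p : pt) :
  pt_dom f p -> smooth_map_at p X -> smooth_map_at p Y -> vjeq k p X Y ->
  vjeq k (f p) (push f X) (push f Y).
Proof.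
intros Hp [X1 X2] [Y1 Y2] [H1 H2].
assert (Hg : smooth_map_at (f p) (pt_inv f)) by now apply smooth_map_at_cod, pt_fun_cod.
assert (HC : forall h, smooth_at p h -> smooth_at (f p) (fun q => h (pt_inv f q))).
{ intros h Hh. apply smooth_at_comp; [now rewrite (pt_funK f p Hp)|easy]. }
assert (HJ : forall h h', smooth_at p h -> smooth_at p h' -> jeq k p h h' ->
  jeq k (f p) (fun q => h (pt_inv f q)) (fun q => h' (pt_inv f q))).
{ intros h h' Hh Hh' H. apply jeq_comp; rewrite ?(pt_funK f p Hp); easy. }
destruct (smooth_map_at_dom f p Hp) as [F1 F2].
assert (K : forall F, smooth_at p F -> jeq k (f p)
  (fun q => partial 1 0 F (pt_inv f q) * fst (X (pt_inv f q)) + partial 0 1 F (pt_inv f q) * snd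
    (X (pt_inv f q)))
  (fun q => partial 1 0 F (pt_inv f q) * fst (Y (pt_inv f q)) + partial 0 1 F (pt_inv f q) * snd
    (Y (pt_inv f q)))).
{ intros F HF.
  pose proof (HC _ (smooth_at_partial p 1 0 F HF)) as A1.
  pose proof (HC _ (smooth_at_partial p 0 1 F HF)) as A2.
  pose proof (HC _ X1) as B1. pose proof (HC _ X2) as B2.
  pose proof (HC _ Y1) as C1. pose proof (HC _ Y2) as C2.
  cbv beta in *.
  apply jeq_plus; try (apply smooth_at_mult; assumption).
  - apply jeq_mult; try assumption; [apply jeq_refl|]. exact (HJ _ _ X1 Y1 H1).
  - apply jeq_mult; try assumption; [apply jeq_refl|]. exact (HJ _ _ X2 Y2 H2). }
split; apply K; assumption.
Qed.

Definition vpush {k} (f : point_transformation) (p : pt) (c : vjets k) : vjets k :=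
  vjet k (push f (vjet_repr p c)) (f p).

Lemma vpush_vjet (k : nat) (f : point_transformation) (p : pt) (X : pt -> pt) :
  pt_dom f p -> smooth_map_at p X ->
  vpush f p (vjet k X p) = vjet k (push f X) (f p).
Proof.
intros Hp HX. apply vjet_eq. apply push_vjeq; auto using smooth_map_at_vjet_repr, vjet_repr_vjet.
Qed.

Lemma taylor_add {k} (p : pt) (c d : mindex k -> R) (q : pt) :
  taylor p (fun s => c s + d s) q = taylor p c q + taylor p d q.
Proof.
unfold taylor. rewrite <- plus_sum. apply sum_eq; intros a _.
rewrite <- plus_sum. apply sum_eq; intros b _.
replace (coef (fun s => c s + d s) a b) with (coef c a b + coef d a b); [unfold Rdiv; ring|].
unfold coef. destruct le_dec; ring.
Qed.

Lemma taylor_scal {k} (p : pt) (r : R) (c : mindex k -> R) (q : pt) :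
  taylor p (fun s => r * c s) q = r * taylor p c q.
Proof.
unfold taylor. rewrite scal_sum. apply sum_eq; intros a _.
rewrite (Rmult_comm _ r), scal_sum. apply sum_eq; intros b _.
replace (coef (fun s => r * c s) a b) with (r * coef c a b); [unfold Rdiv; ring|].
unfold coef. destruct le_dec; ring.
Qed.

Lemma vjet_push_plus (k : nat) (f : point_transformation) (p : pt) (X Y Z : pt -> pt) :
  pt_dom f p -> smooth_map_at p X -> smooth_map_at p Y ->
  (forall q, Z q = plus (X q) (Y q)) ->
  vjet k (push f Z) (f p) = vjet_add (vjet k (push f X) (f p)) (vjet k (push f Y) (f p)).
Proof.
intros Hp HX HY HZ. destruct (smooth_at_push f X p Hp HX) as [X1 X2].
destruct (smooth_at_push f Y p Hp HY) as [Y1 Y2].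
apply vjets_eq. intros a b Hab. rewrite vcoef_add, !vcoef_vjet by easy.
unfold plus; simpl; unfold prod_plus; simpl. unfold plus; simpl.
rewrite <- !partial_plus by assumption.
f_equal; apply near_eq_partial, near_eq_ext; intros q; unfold push, differential; cbn [fst snd];
rewrite HZ; unfold plus; simpl; unfold plus; simpl; ring.
Qed.

Lemma vjet_push_scal (k : nat) (f : point_transformation) (p : pt) (r : R) (X Z : pt -> pt) :
  pt_dom f p -> smooth_map_at p X ->
  (forall q, Z q = scal r (X q)) ->
  vjet k (push f Z) (f p) = vjet_scal r (vjet k (push f X) (f p)).
Proof.
intros Hp HX HZ.
apply vjets_eq. intros a b Hab. rewrite vcoef_scal, !vcoef_vjet by easy.
unfold scal; simpl; unfold prod_scal; simpl. unfold scal; simpl; unfold mult; simpl.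
rewrite <- !partial_scal.
f_equal; apply near_eq_partial, near_eq_ext; intros q; unfold push, differential; cbn [fst snd];
rewrite HZ; unfold scal; simpl; unfold scal; simpl; unfold mult; simpl; ring.
Qed.

Lemma vpush_add {k} (f : point_transformation) (p : pt) (c d : vjets k) :
  pt_dom f p -> vpush f p (vjet_add c d) = vjet_add (vpush f p c) (vpush f p d).
Proof.
intros Hp. apply vjet_push_plus; auto using smooth_map_at_vjet_repr.
intros q. unfold vjet_repr, plus; simpl. unfold prod_plus; simpl. unfold plus; simpl.
now rewrite <- !taylor_add.
Qed.

Lemma vpush_scal {k} (f : point_transformation) (p : pt) (r : R) (c : vjets k) :
  pt_dom f p -> vpush f p (vjet_scal r c) = vjet_scal r (vpush f p c).
Proof.
intros Hp. apply vjet_push_scal; auto using smooth_map_at_vjet_repr.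
intros q. unfold vjet_repr, scal; simpl. unfold prod_scal; simpl.
unfold scal; simpl; unfold mult; simpl.
now rewrite <- !taylor_scal.
Qed.

Lemma vjet_zero_scal {k} (c : vjets k) : @vjet_zero k = vjet_scal 0 c.
Proof.
apply functional_extensionality; intros s. unfold vjet_zero, vjet_scal.
symmetry. apply (scal_zero_l (K := R_AbsRing) (V := VR2)).
Qed.

Lemma vpush_zero {k} (f : point_transformation) (p : pt) :
  pt_dom f p -> vpush f p (@vjet_zero k) = vjet_zero.
Proof.
intros Hp. rewrite (vjet_zero_scal vjet_zero) at 1. rewrite vpush_scal by easy.
symmetry. apply vjet_zero_scal.
Qed.

Lemma rho0_vpush {k} (f : point_transformation) (p : pt) (c : vjets k) :
  pt_dom f p -> rho0 (vpush f p c) = differential f p (rho0 c).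
Proof.
intros Hp. unfold rho0, vpush. rewrite vcoef_vjet by lia. rewrite !partial00. unfold push.
rewrite (pt_funK f p Hp), <- surjective_pairing. f_equal.
unfold vjet_repr. rewrite !taylor_at. reflexivity.
Qed.

Lemma differential_inv_r (f : point_transformation) (p v : pt) :
  pt_dom f p -> differential f p (differential (pt_inv f) (f p) v) = v.
Proof.
intros Hp. assert (Hq : pt_cod f (f p)) by now apply pt_fun_cod.
pose proof (smooth_map_at_cod f _ Hq) as Hg.
assert (HF : smooth_map_at (pt_inv f (f p)) f) by (rewrite pt_funK by easy;
  now apply smooth_map_at_dom).
destruct HF as [F1 F2].
assert (E1 : near_eq (f p) (fun z => fst (f (pt_inv f z))) (fun z => fst z)).
{ exists (pt_cod f). repeat split; auto using pt_cod_open. intros z Hz; now rewrite pt_invK. }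
assert (E2 : near_eq (f p) (fun z => snd (f (pt_inv f z))) (fun z => snd z)).
{ exists (pt_cod f). repeat split; auto using pt_cod_open. intros z Hz; now rewrite pt_invK. }
pose proof (near_eq_D (f p) (1, 0) _ _ E1) as K1. pose proof (near_eq_D (f p) (0,
  1) _ _ E1) as K2.
pose proof (near_eq_D (f p) (1, 0) _ _ E2) as K3. pose proof (near_eq_D (f p) (0,
  1) _ _ E2) as K4.
rewrite (DDcomp _ (f p) _ _ F1 Hg) in K1. rewrite (DDcomp _ (f p) _ _ F1 Hg) in K2.
rewrite (DDcomp _ (f p) _ _ F2 Hg) in K3. rewrite (DDcomp _ (f p) _ _ F2 Hg) in K4.
rewrite Dx_fst in K1. rewrite Dy_fst in K2. rewrite Dx_snd in K3. rewrite Dy_snd in K4.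
rewrite (pt_funK f p Hp) in K1, K2, K3, K4.
unfold differential. cbn [fst snd]. rewrite !partial10, !partial01.
destruct v as [v1 v2]. cbn [fst snd]. f_equal.
- transitivity (v1 * (ddx (fun z => fst (pt_inv f z)) (f p) * ddx (fun z => fst (f z)) p
    + ddx (fun z => snd (pt_inv f z)) (f p) * ddy (fun z => fst (f z)) p)
   + v2 * (ddy (fun z => fst (pt_inv f z)) (f p) * ddx (fun z => fst (f z)) p
    + ddy (fun z => snd (pt_inv f z)) (f p) * ddy (fun z => fst (f z)) p)); [ring|].
  rewrite K1, K2. ring.
- transitivity (v1 * (ddx (fun z => fst (pt_inv f z)) (f p) * ddx (fun z => snd (f z)) p
    + ddx (fun z => snd (pt_inv f z)) (f p) * ddy (fun z => snd (f z)) p)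
   + v2 * (ddy (fun z => fst (pt_inv f z)) (f p) * ddx (fun z => snd (f z)) p
    + ddy (fun z => snd (pt_inv f z)) (f p) * ddy (fun z => snd (f z)) p)); [ring|].
  rewrite K3, K4. ring.
Qed.

Lemma differential_inv_l (f : point_transformation) (p v : pt) :
  pt_dom f p -> differential (pt_inv f) (f p) (differential f p v) = v.
Proof.
intros Hp. pose proof (differential_inv_r (pt_sym f) (f p) v (pt_fun_cod f p Hp)) as H.
simpl in H. now rewrite (pt_funK f p Hp) in H.
Qed.

(** The bracket involves one differentiation, which costs one order of the jet. *)
Lemma lie_vjeq (k : nat) (p : pt) (X X' Y Y' : pt -> pt) :
  smooth_map_at p X -> smooth_map_at p X' -> smooth_map_at p Y -> smooth_map_at p Y' ->
  vjeq (S k) p X X' -> vjeq (S k) p Y Y' -> vjeq k p (lie X Y) (lie X' Y').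
Proof.
intros [X1 X2] [X1' X2'] [Y1 Y2] [Y1' Y2'] [H1 H2] [K1 K2].
assert (A : forall (F F' : pt -> pt) h h', smooth_map_at p F -> smooth_map_at p F' ->
  vjeq k p F F' -> smooth_at p h -> smooth_at p h' -> jeq (S k) p h h' ->
  jeq k p (fun q => partial 1 0 h q * fst (F q) + partial 0 1 h q * snd (F q))
          (fun q => partial 1 0 h' q * fst (F' q) + partial 0 1 h' q * snd (F' q))
  /\ smooth_at p (fun q => partial 1 0 h q * fst (F q) + partial 0 1 h q * snd (F q))
  /\ smooth_at p (fun q => partial 1 0 h' q * fst (F' q) + partial 0 1 h' q * snd (F' q))).
{ intros F F' h h' [F1 F2] [F1' F2'] [L1 L2] Hh Hh' L.
  apply jeq_S in L; auto. destruct L as [_ [Lx Ly]].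
  rewrite !partial10, !partial01.
  pose proof (smooth_at_Dx _ _ Hh). pose proof (smooth_at_Dx _ _ Hh').
  pose proof (smooth_at_Dy _ _ Hh). pose proof (smooth_at_Dy _ _ Hh').
  repeat split.
  - apply jeq_plus; try (apply smooth_at_mult; assumption); apply jeq_mult; assumption.
  - apply smooth_at_plus; apply smooth_at_mult; assumption.
  - apply smooth_at_plus; apply smooth_at_mult; assumption. }
assert (HX : vjeq k p X X') by (split; apply (jeq_le (S k)); auto).
assert (HY : vjeq k p Y Y') by (split; apply (jeq_le (S k)); auto).
assert (B : forall f f' h h', smooth_at p f -> smooth_at p f' -> smooth_at p h -> smooth_at p h'
  ->
  jeq k p f f' -> jeq k p h h' -> jeq k p (fun q => f q - h q) (fun q => f' q - h' q)).
{ intros f f' h h' S1 S2 S3 S4 Q1 Q2.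
  apply (jeq_near k p _ (fun q => f q + -1 * h q) _ (fun q => f' q + -1 * h' q));
  [apply near_eq_ext; intros; ring|apply near_eq_ext; intros; ring|].
  apply jeq_plus; try assumption; try (apply smooth_at_mult; [apply smooth_at_const|assumption]).
  apply jeq_mult; try assumption; try apply smooth_at_const. apply jeq_refl. }
split.
- destruct (A X X' (fun q => fst (Y q)) (fun q => fst (Y' q))) as [Q1 [Q2 Q3]]; try assumption;
  try (now split).
  destruct (A Y Y' (fun q => fst (X q)) (fun q => fst (X' q))) as [Q4 [Q5 Q6]]; try assumption;
    try (now split).
  exact (B _ _ _ _ Q2 Q3 Q5 Q6 Q1 Q4).
- destruct (A X X' (fun q => snd (Y q)) (fun q => snd (Y' q))) as [Q1 [Q2 Q3]]; try assumption;
  try (now split).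
  destruct (A Y Y' (fun q => snd (X q)) (fun q => snd (X' q))) as [Q4 [Q5 Q6]]; try assumption;
    try (now split).
  exact (B _ _ _ _ Q2 Q3 Q5 Q6 Q1 Q4).
Qed.

(** The hypothesis says that Y' o f is the derivative of F along Y, which is how a component of the
    direct image is characterized. Differentiating this relation, instead of the formula for [push],
    keeps the derivatives of f^-1 out of the computation. *)
Lemma D_push_fun (f : point_transformation) (Y : pt -> pt) (z v : pt) (F Y' : pt -> R) :
  pt_dom f z -> smooth_map_at z Y -> smooth_at z F -> smooth_at (f z) Y' ->
  (forall q, pt_dom f q -> Y' (f q) = partial 1 0 F q * fst (Y q) + partial 0 1 F q * snd (Y q))
    ->
  ddp v (fun y => fst (f y)) z * ddx Y' (f z) + ddp v (fun y => snd (f y)) z * ddy Y' (f z)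
  = ddp v (ddx F) z * fst (Y z) + ddx F z * ddp v (fun q => fst (Y q)) z
  + (ddp v (ddy F) z * snd (Y z) + ddy F z * ddp v (fun q => snd (Y q)) z).
Proof.
intros Hz [Y1 Y2] HF HY' He.
rewrite <- (DDcomp v z Y' f HY' (smooth_map_at_dom f z Hz)).
rewrite (near_eq_D z v _ (fun q => ddx F q * fst (Y q) + ddy F q * snd (Y q))).
- pose proof (smooth_at_Dx _ _ HF). pose proof (smooth_at_Dy _ _ HF).
  rewrite D_plus by (apply smooth_at_mult; assumption).
  rewrite !D_mult by assumption. reflexivity.
- exists (pt_dom f). repeat split; auto using pt_dom_open. intros q Hq.
  now rewrite He, partial10, partial01.
Qed.

Lemma lie_fst (X Y : pt -> pt) (q : pt) :
  fst (lie X Y q) =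
  partial 1 0 (fun z => fst (Y z)) q * fst (X q) + partial 0 1 (fun z => fst (Y z)) q * snd (X q)
  - (partial 1 0 (fun z => fst (X z)) q * fst (Y q) + partial 0 1 (fun z => fst (X z)) q * snd (Y
    q)).
Proof. reflexivity. Qed.

Lemma lie_snd (X Y : pt -> pt) (q : pt) :
  snd (lie X Y q) =
  partial 1 0 (fun z => snd (Y z)) q * fst (X q) + partial 0 1 (fun z => snd (Y z)) q * snd (X q)
  - (partial 1 0 (fun z => snd (X z)) q * fst (Y q) + partial 0 1 (fun z => snd (X z)) q * snd (Y
    q)).
Proof. reflexivity. Qed.

(** Differentiating the relations [R1] and [R2] expresses the derivatives of the direct images
    through those of the fields and the second derivatives of [f]. In the bracket the latter enter
    antisymmetrized, hence cancel. *)
Lemma lie_push (f : point_transformation) (X Y : pt -> pt) (z : pt) :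
  pt_dom f z -> smooth_map_at z X -> smooth_map_at z Y ->
  lie (push f X) (push f Y) (f z) = push f (lie X Y) (f z).
Proof.
intros Hz HX HY.
destruct (smooth_at_push f X z Hz HX) as [PX1 PX2].
destruct (smooth_at_push f Y z Hz HY) as [PY1 PY2].
destruct (smooth_map_at_dom f z Hz) as [F1 F2].
assert (R1 : forall Z q, pt_dom f q -> fst (push f Z (f q)) =
  partial 1 0 (fun y => fst (f y)) q * fst (Z q) + partial 0 1 (fun y => fst (f y)) q * snd (Z
    q)).
{ intros Z q Hq. unfold push. now rewrite (pt_funK f q Hq). }
assert (R2 : forall Z q, pt_dom f q -> snd (push f Z (f q)) =
  partial 1 0 (fun y => snd (f y)) q * fst (Z q) + partial 0 1 (fun y => snd (f y)) q * snd (Z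
    q)).
{ intros Z q Hq. unfold push. now rewrite (pt_funK f q Hq). }
pose proof (fun v => D_push_fun f X z v _ _ Hz HX F1 PX1 (R1 X)) as EX1.
pose proof (fun v => D_push_fun f X z v _ _ Hz HX F2 PX2 (R2 X)) as EX2.
pose proof (fun v => D_push_fun f Y z v _ _ Hz HY F1 PY1 (R1 Y)) as EY1.
pose proof (fun v => D_push_fun f Y z v _ _ Hz HY F2 PY2 (R2 Y)) as EY2.
rewrite (surjective_pairing (push f (lie X Y) (f z))), R1, R2 by easy.
rewrite (surjective_pairing (lie (push f X) (push f Y) (f z))).
rewrite !lie_fst, !lie_snd, !R1, !R2 by easy.
rewrite !partial10, !partial01.
pose proof (EX1 (1, 0)) as A1. pose proof (EX1 (0, 1)) as A2.
pose proof (EX2 (1, 0)) as A3. pose proof (EX2 (0, 1)) as A4.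
pose proof (EY1 (1, 0)) as B1. pose proof (EY1 (0, 1)) as B2.
pose proof (EY2 (1, 0)) as B3. pose proof (EY2 (0, 1)) as B4.
clear EX1 EX2 EY1 EY2 R1 R2.
(* Mixed derivatives of [f] are put in one order, so that [ring] sees the cancellation. *)
rewrite (DyDx _ z F1) in A2, B2. rewrite (DyDx _ z F2) in A4, B4.
set (x1 := fst (X z)) in *. set (x2 := snd (X z)) in *.
set (y1 := fst (Y z)) in *. set (y2 := snd (Y z)) in *.
match type of A1 with _ = ?e => set (a1 := e) in * end.
match type of A2 with _ = ?e => set (a2 := e) in * end.
match type of A3 with _ = ?e => set (a3 := e) in * end.
match type of A4 with _ = ?e => set (a4 := e) in * end.
match type of B1 with _ = ?e => set (b1 := e) in * end.
match type of B2 with _ = ?e => set (b2 := e) in * end.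
match type of B3 with _ = ?e => set (b3 := e) in * end.
match type of B4 with _ = ?e => set (b4 := e) in * end.
f_equal.
- transitivity (x1 * b1 + x2 * b2 - (y1 * a1 + y2 * a2)).
  + rewrite <- A1, <- A2, <- B1, <- B2. ring.
  + unfold a1, a2, b1, b2. ring.
- transitivity (x1 * b3 + x2 * b4 - (y1 * a3 + y2 * a4)).
  + rewrite <- A3, <- A4, <- B3, <- B4. ring.
  + unfold a3, a4, b3, b4. ring.
Qed.

Lemma smooth_map_at_lie (p : pt) (X Y : pt -> pt) :
  smooth_map_at p X -> smooth_map_at p Y -> smooth_map_at p (lie X Y).
Proof.
intros [X1 X2] [Y1 Y2].
assert (A : forall (F : pt -> pt) h, smooth_map_at p F -> smooth_at p h ->
  smooth_at p (fun q => partial 1 0 h q * fst (F q) + partial 0 1 h q * snd (F q))).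
{ intros F h [F1 F2] Hh. apply smooth_at_plus; apply smooth_at_mult;
  auto using smooth_at_partial. }
split.
- exact (smooth_at_minus p _ _ (A X _ (conj X1 X2) Y1) (A Y _ (conj Y1 Y2) X1)).
- exact (smooth_at_minus p _ _ (A X _ (conj X1 X2) Y2) (A Y _ (conj Y1 Y2) X2)).
Qed.

(** Naturality of the bracket of fields, carried over to jets. The Taylor representative of a pushed
    jet agrees with the pushed representative only to order k + 1, which [lie_vjeq] shows to be
    enough. *)
Lemma jet_bracket_vpush {k} (f : point_transformation) (p : pt) (c d : vjets (S k)) :
  pt_dom f p ->
  jet_bracket (f p) (vpush f p c) (vpush f p d) = vpush f p (jet_bracket p c d).
Proof.
intros Hp. unfold jet_bracket.
rewrite vpush_vjet; [|easy|apply smooth_map_at_lie; apply smooth_map_at_vjet_repr].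
transitivity (vjet k (lie (push f (vjet_repr p c)) (push f (vjet_repr p d))) (f p)).
- apply vjet_eq, lie_vjeq; try apply smooth_map_at_vjet_repr; try apply vjet_repr_vjet;
  apply smooth_at_push; auto using smooth_map_at_vjet_repr.
- apply vjet_eq. assert (H : forall q, pt_cod f q -> lie (push f (vjet_repr p c)) (push f
  (vjet_repr p d)) q =
    push f (lie (vjet_repr p c) (vjet_repr p d)) q).
  { intros q Hq. rewrite <- (pt_invK f q Hq).
    apply lie_push; [now apply pt_inv_dom|apply smooth_map_at_vjet_repr|apply
      smooth_map_at_vjet_repr]. }
  split; apply near_jeq; exists (pt_cod f); repeat split; auto using pt_cod_open, pt_fun_cod;
  intros q Hq; now rewrite H.
Qed.

Lemma push_zero (f : point_transformation) (q : pt) : push f (fun _ => (0, 0)) q = (0, 0).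
Proof. unfold push, differential; simpl. f_equal; ring. Qed.

Lemma vjet_const0 (k : nat) (X : pt -> pt) (p : pt) :
  (forall q, X q = (0, 0)) -> vjet k X p = vjet_zero.
Proof.
intros H. apply vjets_eq. intros a b Hab. rewrite vcoef_vjet, vcoef_zero by easy.
assert (E : partial a b (fun _ => 0) p = 0).
{ transitivity (partial a b (fun _ : pt => 0 * 1) p).
  - apply near_eq_partial, near_eq_ext. intros; ring.
  - rewrite (partial_scal p a b 0 (fun _ => 1)). ring. }
rewrite <- E. f_equal; apply near_eq_partial, near_eq_ext; intros q; now rewrite H.
Qed.

Lemma rho1_vpush_zero (f : point_transformation) (p : pt) (z : vjets 2) :
  pt_dom f p -> rho 1 z = vjet_zero -> rho 1 (vpush f p z) = vjet_zero.
Proof.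
intros Hp Hz. unfold vpush. rewrite rho_vjet by lia.
rewrite (vjet_eq 1 (f p) _ (push f (fun _ => (0, 0)))).
- apply vjet_const0. apply push_zero.
- apply push_vjeq; [easy|apply smooth_map_at_vjet_repr|split; apply smooth_at_const|].
  assert (E : vjet 1 (vjet_repr p z) p = vjet 1 (fun _ => (0, 0)) p).
  { rewrite <- (rho_vjet 2) by lia. rewrite vjet_vjet_repr, Hz. symmetry. now apply vjet_const0. }
  split; intros a b Hab; pose proof (f_equal (fun x => vcoef x a b) E) as Q; cbv beta in Q;
  rewrite !vcoef_vjet in Q by easy; injection Q; intros; assumption.
Qed.

(** * Tensoriality of the second order part of a flat 1-jet *)

Lemma D2_plus (p v w : pt) (f h : pt -> R) : smooth_at p f -> smooth_at p h ->
  ddp w (ddp v (fun x => f x + h x)) p = ddp w (ddp v f) p + ddp w (ddp v h) p.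
Proof.
intros Hf Hh. rewrite (near_eq_D p w _ _ (near_Dplus p f h v Hf Hh)).
apply D_plus; now apply smooth_at_ddp.
Qed.

Lemma D2_mult_flat (p v w : pt) (a h : pt -> R) : smooth_at p a -> smooth_at p h ->
  h p = 0 -> ddp v h p = 0 -> ddp w h p = 0 ->
  ddp w (ddp v (fun x => a x * h x)) p = a p * ddp w (ddp v h) p.
Proof.
intros Ha Hh H0 Hv Hw. rewrite (near_eq_D p w _ _ (near_Dmult p a h v Ha Hh)).
pose proof (smooth_at_ddp p v _ Ha). pose proof (smooth_at_ddp p v _ Hh).
rewrite D_plus by (apply smooth_at_mult; assumption).
rewrite !D_mult by assumption. rewrite H0, Hv, Hw. ring.
Qed.

(** Two derivatives of Y o f = F_x Z^1 + F_y Z^2. On the left, second derivatives of [f] are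
    multiplied by first derivatives of Y; on the right, higher derivatives of F are multiplied by
    the value or first derivatives of Z. All these vanish, and a tensorial rule is left. *)
Lemma D2_push_flat (f : point_transformation) (Z : pt -> pt) (p : pt) (F Y : pt -> R) (v w : pt) :
  pt_dom f p -> smooth_map_at p Z -> smooth_at p F -> smooth_at (f p) Y ->
  (forall q, pt_dom f q -> Y (f q) = partial 1 0 F q * fst (Z q) + partial 0 1 F q * snd (Z q)) ->
  Z p = (0, 0) ->
  (forall u, ddp u (fun q => fst (Z q)) p = 0) -> (forall u, ddp u (fun q => snd (Z q)) p = 0) ->
  ddx Y (f p) = 0 -> ddy Y (f p) = 0 ->
  ddp v (fun q => fst (f q)) p * (ddp w (fun q => fst (f q)) p * ddx (ddx Y) (f p)
     + ddp w (fun q => snd (f q)) p * ddx (ddy Y) (f p))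
  + ddp v (fun q => snd (f q)) p * (ddp w (fun q => fst (f q)) p * ddx (ddy Y) (f p)
     + ddp w (fun q => snd (f q)) p * ddy (ddy Y) (f p))
  = ddx F p * ddp w (ddp v (fun q => fst (Z q))) p + ddy F p * ddp w (ddp v (fun q => snd (Z q)))
    p.
Proof.
intros Hp [Z1 Z2] HF HY He H0 D1 D2 Yx Yy.
pose proof (DD_comp v w p Y f HY (smooth_map_at_dom f p Hp)) as E. cbv beta zeta in E.
rewrite Yx, Yy, (DyDx _ _ HY) in E.
assert (E0 : near_eq p (fun x => Y (f x)) (fun q => ddx F q * fst (Z q) + ddy F q * snd (Z q))).
{ exists (pt_dom f). repeat split; auto using pt_dom_open. intros q Hq.
  now rewrite He, partial10, partial01. }
pose proof (smooth_at_Dx _ _ HF) as Fx. pose proof (smooth_at_Dy _ _ HF) as Fy.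
assert (E1 : near_eq p (ddp v (fun x => Y (f x))) (ddp v (fun q => ddx F q * fst (Z q) + ddy F q
  * snd (Z q)))).
{ destruct E0 as [D [HD [Dp HE]]]. exists D. repeat split; auto. intros q Hq.
  now apply (ddp_ext_open D). }
rewrite (near_eq_D p w _ _ E1) in E.
rewrite D2_plus in E by (apply smooth_at_mult; assumption).
rewrite (D2_mult_flat p v w (ddx F) (fun q => fst (Z q)) Fx Z1) in E;
  [|now rewrite H0|apply D1|apply D1].
rewrite (D2_mult_flat p v w (ddy F) (fun q => snd (Z q)) Fy Z2) in E;
  [|now rewrite H0|apply D2|apply D2].
rewrite E. ring.
Qed.

Lemma ddp_lin (p v : pt) (f : pt -> R) : smooth_at p f ->
  ddp v f p = fst v * ddx f p + snd v * ddy f p.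
Proof.
intros Hf. apply is_derive_unique.
pose proof (chain_curve f (fun s : R => plus p (scal s v)) 0 v) as C.
cbv beta in C. replace (plus p (scal (0 : R) v)) with p in C by (symmetry;
  apply (line_0 (U := VR2))).
apply C; [easy|apply is_derive_linepath].
Qed.

Lemma rho1_zero_vcoef {k} (z : vjets k) (a b : nat) :
  rho 1 z = vjet_zero -> (a + b <= 1)%nat -> vcoef z a b = (0, 0).
Proof. intros H Hab. rewrite <- (vcoef_rho 1) by easy. now rewrite H, vcoef_zero. Qed.

Lemma vcoef_eq_partial {k} (p : pt) (z : vjets k) (a b : nat) : (a + b <= k)%nat ->
  vcoef z a b = (partial a b (fun q => fst (vjet_repr p z q)) p,
                 partial a b (fun q => snd (vjet_repr p z q)) p).
Proof. intros H. rewrite <- vcoef_vjet with (k := k) by easy. now rewrite vjet_vjet_repr. Qed.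

(** [D2_push_flat] on pairs of basis vectors, for both components of [f], extended by bilinearity.
    The vanishing 1-jet is what makes the second derivatives a tensor. *)
Lemma quad_part_vpush (f : point_transformation) (p : pt) (z : vjets 2) (v w : pt) :
  pt_dom f p -> rho 1 z = vjet_zero ->
  quad_part (vpush f p z) (differential f p v) (differential f p w)
  = differential f p (quad_part z v w).
Proof.
intros Hp Hz. pose proof (rho1_vpush_zero f p z Hp Hz) as Hz'.
set (Z := vjet_repr p z).
assert (HZ : smooth_map_at p Z) by apply smooth_map_at_vjet_repr.
assert (Hq := pt_fun_cod f p Hp).
destruct (smooth_at_push f Z p Hp HZ) as [W1 W2].
destruct (smooth_map_at_dom f p Hp) as [F1 F2].
assert (V : forall a b, (a + b <= 2)%nat -> vcoef (vpush f p z) a b =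
  (partial a b (fun q => fst (push f Z q)) (f p), partial a b (fun q => snd (push f Z q)) (f p))).
{ intros a b Hab. unfold vpush. now rewrite vcoef_vjet. }
assert (L : forall a b, (a + b <= 1)%nat -> partial a b (fun q => fst (push f Z q)) (f p) = 0 /\
  partial a b (fun q => snd (push f Z q)) (f p) = 0).
{ intros a b Hab. pose proof (rho1_zero_vcoef _ a b Hz' Hab) as Q. rewrite V in Q by lia.
  now injection Q. }
assert (M : forall a b, (a + b <= 1)%nat -> partial a b (fun q => fst (Z q)) p = 0 /\
  partial a b (fun q => snd (Z q)) p = 0).
{ intros a b Hab. pose proof (rho1_zero_vcoef _ a b Hz Hab) as Q.
  rewrite (vcoef_eq_partial p) in Q by lia. now injection Q. }
destruct HZ as [Z1 Z2].
assert (M1 : forall u, ddp u (fun q => fst (Z q)) p = 0).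
{ intros u. rewrite ddp_lin by easy. rewrite <- partial10, <- partial01.
  rewrite (proj1 (M 1%nat 0%nat ltac:(lia))), (proj1 (M 0%nat 1%nat ltac:(lia))). ring. }
assert (M2 : forall u, ddp u (fun q => snd (Z q)) p = 0).
{ intros u. rewrite ddp_lin by easy. rewrite <- partial10, <- partial01.
  rewrite (proj2 (M 1%nat 0%nat ltac:(lia))), (proj2 (M 0%nat 1%nat ltac:(lia))). ring. }
assert (M0 : Z p = (0, 0)).
{ destruct (M 0%nat 0%nat ltac:(lia)) as [A B]. rewrite partial00 in A, B.
  rewrite (surjective_pairing (Z p)). now f_equal. }
assert (L1x := proj1 (L 1%nat 0%nat ltac:(lia))). assert (L1y := proj1 (L 0%nat 1%nat
  ltac:(lia))).
assert (L2x := proj2 (L 1%nat 0%nat ltac:(lia))). assert (L2y := proj2 (L 0%nat 1%nat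
  ltac:(lia))).
rewrite partial10 in L1x, L2x. rewrite partial01 in L1y, L2y.
assert (R1 : forall q, pt_dom f q -> fst (push f Z (f q)) =
  partial 1 0 (fun y => fst (f y)) q * fst (Z q) + partial 0 1 (fun y => fst (f y)) q * snd (Z
    q)).
{ intros q Hq'. unfold push. now rewrite (pt_funK f q Hq'). }
assert (R2 : forall q, pt_dom f q -> snd (push f Z (f q)) =
  partial 1 0 (fun y => snd (f y)) q * fst (Z q) + partial 0 1 (fun y => snd (f y)) q * snd (Z
    q)).
{ intros q Hq'. unfold push. now rewrite (pt_funK f q Hq'). }
pose proof (fun v w => D2_push_flat f Z p _ _ v w Hp (conj Z1 Z2) F1 W1 R1 M0 M1 M2 L1x L1y) as
  E1.
pose proof (fun v w => D2_push_flat f Z p _ _ v w Hp (conj Z1 Z2) F2 W2 R2 M0 M1 M2 L2x L2y) as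
  E2.
unfold quad_part. rewrite !V by lia. rewrite !(vcoef_eq_partial p z) by lia. fold Z.
cbn [fst snd]. unfold differential. cbn [fst snd].
rewrite !partial20, !partial11, !partial02, !partial10, !partial01.
pose proof (E1 (1, 0) (1, 0)) as A1. pose proof (E1 (0, 1) (1, 0)) as A2.
pose proof (E1 (0, 1) (0, 1)) as A3.
pose proof (E2 (1, 0) (1, 0)) as B1. pose proof (E2 (0, 1) (1, 0)) as B2.
pose proof (E2 (0, 1) (0, 1)) as B3.
clear E1 E2.
match type of A1 with _ = ?e => set (a1 := e) in A1 end.
match type of A2 with _ = ?e => set (a2 := e) in A2 end.
match type of A3 with _ = ?e => set (a3 := e) in A3 end.
match type of B1 with _ = ?e => set (b1 := e) in B1 end.
match type of B2 with _ = ?e => set (b2 := e) in B2 end.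
match type of B3 with _ = ?e => set (b3 := e) in B3 end.
destruct v as [v1 v2], w as [w1 w2]. cbn [fst snd].
f_equal.
- transitivity (v1 * w1 * a1 + (v1 * w2 + v2 * w1) * a2 + v2 * w2 * a3).
  + rewrite <- A1, <- A2, <- A3. ring.
  + unfold a1, a2, a3. ring.
- transitivity (v1 * w1 * b1 + (v1 * w2 + v2 * w1) * b2 + v2 * w2 * b3).
  + rewrite <- B1, <- B2, <- B3. ring.
  + unfold b1, b2, b3. ring.
Qed.

Lemma jet_symmetries_vpush (f : point_transformation) (theta : J 2) (c : vjets 3) :
  pt_dom f (fst theta) -> jet_symmetries theta c ->
  jet_symmetries (prolong 2 f theta) (vpush f (fst theta) c).
Proof.
intros Hp [X [v [[D [HD [Dp HX]]] [-> [Hl Ht]]]]].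
destruct (lifted_vector_push f X theta v Hp Hl Ht) as [v' [Hl' Ht']].
exists (push f X), v'. split; [|split; [|split]]; auto.
- exists (fun q => pt_cod f q /\ D (pt_inv f q)).
  split; [apply open_preimage_smooth; auto using pt_cod_open, pt_inv_smooth|].
  split; [|now apply smooth_map_push].
  change (fst (prolong 2 f theta)) with (f (fst theta)).
  rewrite (pt_funK f _ Hp). split; [now apply pt_fun_cod|easy].
- apply vpush_vjet; [easy|]. destruct HX. split; exists D; auto.
Qed.

Lemma horizontal_vpush (f : point_transformation) (theta : J 2) (H : vjets 3 -> Prop) :
  pt_dom f (fst theta) -> horizontal theta H ->
  horizontal (prolong 2 f theta) (fun c' => exists c, H c /\ c' = vpush f (fst theta) c).
Proof.
intros Hp [H0 [Hadd [Hscal [Hsym Hbij]]]].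
split; [|split; [|split; [|split]]].
- exists vjet_zero. split; [easy|]. now rewrite vpush_zero.
- intros c' d' [c [Hc ->]] [d [Hd ->]]. exists (vjet_add c d).
  split; [auto|]. now rewrite vpush_add.
- intros r c' [c [Hc ->]]. exists (vjet_scal r c). split; [auto|]. now rewrite vpush_scal.
- intros c' [c [Hc ->]]. apply jet_symmetries_vpush; auto.
(* The lift of [v] at the image point is the direct image of the lift of the vector that the
   differential of f^-1 assigns to [v]. *)
- intros v. destruct (Hbij (differential (pt_inv f) (f (fst theta)) v)) as [c [[Hc Hv] Hu]].
  exists (vpush f (fst theta) c). split; [split; [eauto|]|].
  + now rewrite rho0_vpush, Hv, differential_inv_r.
  + intros c' [[d [Hd ->]] Hv']. f_equal. apply Hu. split; [easy|].
    rewrite rho0_vpush in Hv' by easy. now rewrite <- Hv', differential_inv_l.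
Qed.

Lemma is_omega2_push (f : point_transformation) (theta : J 2) (tau : tensor) :
  pt_dom f (fst theta) -> is_omega2 theta tau ->
  is_omega2 (prolong 2 f theta) (push_tensor f (fst theta) tau).
Proof.
intros Hp [H [Hh [Hb Ht]]].
exists (fun c' => exists c, H c /\ c' = vpush f (fst theta) c).
split; [now apply horizontal_vpush|].
change (fst (prolong 2 f theta)) with (f (fst theta)).
split.
- intros c' d' [c [Hc ->]] [d [Hd ->]]. rewrite jet_bracket_vpush by easy.
  apply rho1_vpush_zero; auto.
- intros c' d' [c [Hc ->]] [d [Hd ->]]. rewrite jet_bracket_vpush by easy.
  apply functional_extensionality; intros xi. apply functional_extensionality; intros eta.
  unfold push_tensor. rewrite !rho0_vpush, !differential_inv_l by easy.
  rewrite Ht by easy. rewrite <- quad_part_vpush by auto.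
  now rewrite !differential_inv_r.
Qed.

(** * The equations of symmetry jets *)

(* The derivative at [t = 0] of [lift_fib (phi t)], where [phi] is the flow of a
   vector field whose derivative of order [(a, b)] is [d a b]. *)
Definition lie_alg (d : nat -> nat -> pt) (u : fib -> R) (j : fib) : R :=
  match j with
  | U1 => u U1 * (2 * fst (d 1 0)%nat - snd (d 0 1)%nat) + u U2 * snd (d 1 0)%nat
          - snd (d 2 0)%nat
  | U2 => 3 * u U1 * fst (d 0 1)%nat + u U2 * fst (d 1 0)%nat + 2 * u U3 * snd (d 1 0)%nat
          - 2 * snd (d 1 1)%nat + fst (d 2 0)%nat
  | U3 => 2 * u U2 * fst (d 0 1)%nat + u U3 * snd (d 0 1)%nat + 3 * u U4 * snd (d 1 0)%nat
          - snd (d 0 2)%nat + 2 * fst (d 1 1)%nat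
  | U4 => u U3 * fst (d 0 1)%nat + u U4 * (2 * snd (d 0 1)%nat - fst (d 1 0)%nat)
          + fst (d 0 2)%nat
  end.

Definition vpartial (X : pt -> pt) (q : pt) (a b : nat) : pt :=
  (partial a b (fun z => fst (X z)) q, partial a b (fun z => snd (X z)) q).

(** Linearization of the lift at the 2-jet of the identity, where a = d = 1 and all other entries
    vanish; in particular the denominator is 1 there. *)
Lemma lift_alg_derive (a b c d r s t r' s' t' : R -> R) (D : nat -> nat -> pt)
  (u : fib -> R) (j : fib) :
  a 0 = 1 -> b 0 = 0 -> c 0 = 0 -> d 0 = 1 ->
  r 0 = 0 -> s 0 = 0 -> t 0 = 0 -> r' 0 = 0 -> s' 0 = 0 -> t' 0 = 0 ->
  is_derive a 0 (fst (D 1 0)%nat) -> is_derive b 0 (fst (D 0 1)%nat) ->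
  is_derive c 0 (snd (D 1 0)%nat) -> is_derive d 0 (snd (D 0 1)%nat) ->
  is_derive r 0 (fst (D 2 0)%nat) -> is_derive s 0 (fst (D 1 1)%nat) ->
  is_derive t 0 (fst (D 0 2)%nat) ->
  is_derive r' 0 (snd (D 2 0)%nat) -> is_derive s' 0 (snd (D 1 1)%nat) ->
  is_derive t' 0 (snd (D 0 2)%nat) ->
  is_derive (fun x => lift_alg (a x) (b x) (c x) (d x) (r x) (s x) (t x) (r' x) (s' x) (t' x) u
    j) 0
    (lie_alg D u j).
Proof.
intros Ea Eb Ec Ed Er Es Et Er' Es' Et' Ha Hb Hc Hd Hr Hs Ht Hr' Hs' Ht'.
assert (K : forall (h : R -> R) l, is_derive h 0 l -> Derive (fun x : R => h x) 0 = l)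
  by (intros h l H; now apply is_derive_unique).
apply K in Ha as Ka. apply K in Hb as Kb. apply K in Hc as Kc. apply K in Hd as Kd.
apply K in Hr as Kr. apply K in Hs as Ks. apply K in Ht as Kt. apply K in Hr' as Kr'.
apply K in Hs' as Ks'. apply K in Ht' as Kt'.
unfold lift_alg. destruct j; (auto_derive;
[repeat split; try (eexists; eassumption); rewrite Ea, Eb, Ec, Ed; lra|]);
rewrite ?Ka, ?Kb, ?Kc, ?Kd, ?Kr, ?Ks, ?Kt, ?Kr', ?Ks', ?Kt';
rewrite ?Ea, ?Eb, ?Ec, ?Ed, ?Er, ?Es, ?Et, ?Er', ?Es', ?Et';
replace (1 * 1 + - (0 * 0)) with 1 by ring; unfold lie_alg; field.
Qed.

Lemma slice_ddp (F : VR3 -> R) (v : pt) (t : R) (q : pt) :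
  ddp v (fun z => F (t, z)) q = ddir (U := VR3) (0, v) F (t, q).
Proof.
apply Derive_ext. intros s. f_equal.
unfold plus at 2; simpl. unfold prod_plus; simpl. f_equal.
unfold plus, scal; simpl. unfold mult; simpl. ring.
Qed.

Lemma time_derive (W : VR3 -> Prop) (F : VR3 -> R) (q : pt) :
  smooth W F -> W (0, q) ->
  is_derive (fun t => F (t, q)) 0 (ddir (U := VR3) (1, (0, 0)) F (0, q)).
Proof.
intros HF Hq. pose proof (ddir_is_derive (U := VR3) 0 W F (0, q) (1, (0, 0)) (HF 1%nat) Hq) as H.
eapply is_derive_ext; [|exact H].
assert (A : forall s q1 q2 : R, F (0 + s * 1, (q1 + s * 0, q2 + s * 0)) = F (s, (q1, q2))).
{ intros s q1 q2. do 2 f_equal; [|f_equal]; ring. }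
intros s. destruct q as [q1 q2]. exact (A s q1 q2).
Qed.

(** Symmetry of second derivatives on R x R^2. This is the use made of the joint smoothness required
    in [local_flow]. *)
Lemma time_space_derive (W : VR3 -> Prop) (F : VR3 -> R) (q v : pt) :
  open W -> smooth W F -> W (0, q) ->
  is_derive (fun t => ddp v (fun z => F (t, z)) q) 0
    (ddp v (fun z => ddir (U := VR3) (1, (0, 0)) F (0, z)) q).
Proof.
intros HW HF Hq.
rewrite (slice_ddp (ddir (U := VR3) (1, (0, 0)) F)).
rewrite (ddir_comm (U := VR3) W) by assumption.
apply (is_derive_ext (fun t => ddir (U := VR3) (0, v) F (t, q))); [intros; symmetry;
  apply slice_ddp|].
apply (time_derive W); [now apply smooth_ddir|easy].
Qed.

Lemma vpartial_E (X : pt -> pt) (q : pt) :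
  vpartial X q 1 0 = (ddx (fun z => fst (X z)) q, ddx (fun z => snd (X z)) q) /\
  vpartial X q 0 1 = (ddy (fun z => fst (X z)) q, ddy (fun z => snd (X z)) q) /\
  vpartial X q 2 0 = (ddx (ddx (fun z => fst (X z))) q, ddx (ddx (fun z => snd (X z))) q) /\
  vpartial X q 1 1 = (ddx (ddy (fun z => fst (X z))) q, ddx (ddy (fun z => snd (X z))) q) /\
  vpartial X q 0 2 = (ddy (ddy (fun z => fst (X z))) q, ddy (ddy (fun z => snd (X z))) q).
Proof.
unfold vpartial. now rewrite !partial20, !partial11, !partial02, !partial10, !partial01.
Qed.

(** At t = 0 the flow is the identity to all orders near [q], and the time derivative of a space
    derivative of phi_t is that space derivative of X. Inserted in the formula of the lift, this
    gives the first claim at every point of U, and its space derivative gives the second. *)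
Lemma flow_lift_time (X : pt -> pt) (phi : R -> point_transformation) (eps : R) (U : pt -> Prop)
  (q w : pt) (u : fib -> R) (j : fib) :
  0 < eps -> open U -> U q ->
  (forall t q, Rabs t < eps -> U q -> pt_dom (phi t) q) ->
  smooth_map (fun tq : R * pt => Rabs (fst tq) < eps /\ U (snd tq))
               (fun tq : R * pt => pt_fun (phi (fst tq)) (snd tq)) ->
  (forall q, U q -> phi 0 q = q) ->
  (forall t q, Rabs t < eps -> U q ->
       is_derive (fun s : R => phi s q : pt) t (X (phi t q))) ->
  is_derive (fun t => lift_fib (phi t) q u j) 0 (lie_alg (vpartial X q) u j) /\
  is_derive (fun t => ddp w (fun z => lift_fib (phi t) z u j) q) 0
    (ddp w (fun z => lie_alg (vpartial X z) u j) q) /\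
  is_derive (fun t => ddp w (fun z => fst (phi t z)) q) 0 (ddp w (fun z => fst (X z)) q) /\
  is_derive (fun t => ddp w (fun z => snd (phi t z)) q) 0 (ddp w (fun z => snd (X z)) q).
Proof.
intros Heps HU Uq Hdom Hsm H0 Hder.
set (W := fun tq : VR3 => Rabs (fst tq) < eps /\ U (snd tq)).
assert (HW : open W) by now apply open_slab.
assert (W0 : forall z, U z -> W (0, z)) by (intros z Hz; split; [simpl;
  now rewrite Rabs_R0|easy]).
destruct Hsm as [S1 S2].
set (P1 := fun tq : VR3 => fst (phi (fst tq) (snd tq))) in *.
set (P2 := fun tq : VR3 => snd (phi (fst tq) (snd tq))) in *.
change (smooth (U := VR3) W P1) in S1. change (smooth (U := VR3) W P2) in S2.
assert (T1 : forall z, U z -> ddir (U := VR3) (1, (0, 0)) P1 (0, z) = fst (X z)).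
{ intros z Hz. rewrite <- (is_derive_unique _ _ _ (time_derive W P1 z S1 (W0 z Hz))).
  apply is_derive_unique. apply (is_derive_fst (fun t => phi t z)).
  assert (E : Rabs 0 < eps) by now rewrite Rabs_R0.
  pose proof (Hder 0 z E Hz) as Hd. rewrite (H0 z Hz) in Hd. exact Hd. }
assert (T2 : forall z, U z -> ddir (U := VR3) (1, (0, 0)) P2 (0, z) = snd (X z)).
{ intros z Hz. rewrite <- (is_derive_unique _ _ _ (time_derive W P2 z S2 (W0 z Hz))).
  apply is_derive_unique. apply (is_derive_snd (fun t => phi t z)).
  assert (E : Rabs 0 < eps) by now rewrite Rabs_R0.
  pose proof (Hder 0 z E Hz) as Hd. rewrite (H0 z Hz) in Hd. exact Hd. }
assert (D1 : forall (P : VR3 -> R) (x : pt -> R), smooth (U := VR3) W P ->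
  (forall z, U z -> ddir (U := VR3) (1, (0, 0)) P (0, z) = x z) ->
  forall v z, U z -> is_derive (fun t => ddp v (fun y => P (t, y)) z) 0 (ddp v x z)).
{ intros P x HP Hx v z Hz.
  rewrite <- (ddp_ext_open U _ _ v z HU Hz Hx).
  now apply (time_space_derive W); auto. }
assert (D2 : forall (P : VR3 -> R) (x : pt -> R), smooth (U := VR3) W P ->
  (forall z, U z -> ddir (U := VR3) (1, (0, 0)) P (0, z) = x z) ->
  forall v1 v2 z, U z -> is_derive (fun t => ddp v2 (ddp v1 (fun y => P (t,
    y))) z) 0 (ddp v2 (ddp v1 x) z)).
{ intros P x HP Hx v1 v2 z Hz.
  apply (is_derive_ext (fun t => ddp v2 (fun y => ddir (U := VR3) (0, v1) P (t, y)) z)).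
  - intros t. f_equal. apply functional_extensionality; intros y. symmetry. apply slice_ddp.
  - apply D1; [now apply smooth_ddir| |easy].
    intros y Hy. rewrite (ddir_comm (U := VR3) W) by auto.
    rewrite <- slice_ddp. now apply (ddp_ext_open U). }
assert (I1 : forall v z, U z -> ddp v (fun y => fst (phi 0 y)) z = ddp v (fun y => fst y) z).
{ intros v z Hz. apply (ddp_ext_open U); auto. intros y Hy. now rewrite H0. }
assert (I2 : forall v z, U z -> ddp v (fun y => snd (phi 0 y)) z = ddp v (fun y => snd y) z).
{ intros v z Hz. apply (ddp_ext_open U); auto. intros y Hy. now rewrite H0. }
assert (I3 : forall v1 v2 z, U z -> ddp v2 (ddp v1 (fun y => fst (phi 0 y))) z = ddp v2 (ddp v1
  (fun y => fst y)) z).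
{ intros v1 v2 z Hz. apply (ddp_ext_open U); auto. }
assert (I4 : forall v1 v2 z, U z -> ddp v2 (ddp v1 (fun y => snd (phi 0 y))) z = ddp v2 (ddp v1
  (fun y => snd y)) z).
{ intros v1 v2 z Hz. apply (ddp_ext_open U); auto. }
assert (N1 : forall z, U z -> is_derive (fun t => lift_fib (phi t) z u j) 0 (lie_alg (vpartial X
  z) u j)).
{ intros z Hz.
  apply (is_derive_ext (fun t => lift_alg (ddx (fun y => fst (phi t y)) z) (ddy (fun y => fst
    (phi t y)) z)
    (ddx (fun y => snd (phi t y)) z) (ddy (fun y => snd (phi t y)) z)
    (ddx (ddx (fun y => fst (phi t y))) z) (ddx (ddy (fun y => fst (phi t y))) z)
    (ddy (ddy (fun y => fst (phi t y))) z)
    (ddx (ddx (fun y => snd (phi t y))) z) (ddx (ddy (fun y => snd (phi t y))) z)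
    (ddy (ddy (fun y => snd (phi t y))) z) u j)).
  { intros t. rewrite lift_fib_alg.
    now rewrite !partial20, !partial11, !partial02, !partial10, !partial01. }
  destruct (vpartial_E X z) as [V1 [V2 [V3 [V4 V5]]]].
  apply lift_alg_derive; rewrite ?V1, ?V2, ?V3, ?V4, ?V5; cbn [fst snd].
  all: rewrite ?I3, ?I4, ?I1, ?I2 by assumption;
   rewrite ?(D_fun_const (1, 0) 1 (ddx (fun z => fst z)) _ Dx_fst),
  ?(D_fun_const (1, 0) 0 (ddy (fun z => fst z)) _ Dy_fst),
  ?(D_fun_const (0, 1) 0 (ddy (fun z => fst z)) _ Dy_fst),
  ?(D_fun_const (1, 0) 0 (ddx (fun z => snd z)) _ Dx_snd),
  ?(D_fun_const (1, 0) 1 (ddy (fun z => snd z)) _ Dy_snd),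
  ?(D_fun_const (0, 1) 1 (ddy (fun z => snd z)) _ Dy_snd), ?Dx_fst, ?Dy_fst, ?Dx_snd, ?Dy_snd;
  try reflexivity.
  exact (D1 P1 _ S1 T1 _ z Hz). exact (D1 P1 _ S1 T1 _ z Hz).
  exact (D1 P2 _ S2 T2 _ z Hz). exact (D1 P2 _ S2 T2 _ z Hz).
  exact (D2 P1 _ S1 T1 _ _ z Hz). exact (D2 P1 _ S1 T1 _ _ z Hz). exact (D2 P1 _ S1 T1 _ _ z Hz).
  exact (D2 P2 _ S2 T2 _ _ z Hz). exact (D2 P2 _ S2 T2 _ _ z Hz). exact (D2 P2 _ S2 T2 _ _ z Hz).
  }
split; [now apply N1|].
(* As a function of (t, q) the lift is smooth, its denominator being the Jacobian of phi_t. Its time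
   derivative at 0 is known on all of U by [N1], so time and space derivatives can be exchanged for
   it as for the flow. *)
set (N := fun tq : VR3 => lift_fib (phi (fst tq)) (snd tq) u j).
assert (SN : smooth (U := VR3) W N).
{ assert (HS : forall (P : VR3 -> R) v, smooth (U := VR3) W P ->
    smooth (U := VR3) W (fun tq => ddp v (fun y => P (fst tq, y)) (snd tq))).
  { intros P v HP. apply (smooth_ext (U := VR3) W (ddir (U := VR3) (0, v) P));
    [easy| |now apply smooth_ddir].
    intros [t z] _. symmetry. apply slice_ddp. }
  assert (HS2 : forall (P : VR3 -> R) v1 v2, smooth (U := VR3) W P ->
    smooth (U := VR3) W (fun tq => ddp v2 (ddp v1 (fun y => P (fst tq, y))) (snd tq))).
  { intros P v1 v2 HP.
    apply (smooth_ext (U := VR3) W (ddir (U := VR3) (0, v2) (ddir (U := VR3) (0, v1) P)));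
     [easy| |now do 2 apply smooth_ddir].
    intros [t z] _. rewrite <- slice_ddp. simpl. f_equal.
    apply functional_extensionality; intros y. symmetry. apply slice_ddp. }
  apply (smooth_ext (U := VR3) W (fun tq => lift_alg (ddx (fun y => P1 (fst tq,
    y)) (snd tq)) (ddy (fun y => P1 (fst tq, y)) (snd tq))
    (ddx (fun y => P2 (fst tq, y)) (snd tq)) (ddy (fun y => P2 (fst tq, y)) (snd tq))
    (ddx (ddx (fun y => P1 (fst tq, y))) (snd tq)) (ddx (ddy (fun y => P1 (fst tq, y))) (snd tq))
    (ddy (ddy (fun y => P1 (fst tq, y))) (snd tq))
    (ddx (ddx (fun y => P2 (fst tq, y))) (snd tq)) (ddx (ddy (fun y => P2 (fst tq, y))) (snd tq))
    (ddy (ddy (fun y => P2 (fst tq, y))) (snd tq)) (fun i => (fun i _ => u i) i tq) j));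
      [easy| |].
  - intros tq _. unfold N. rewrite lift_fib_alg.
    now rewrite !partial20, !partial11, !partial02, !partial10, !partial01.
  - apply (smooth_lift_alg (U := VR3) W); auto.
    + intros tq [Ht Hz]. pose proof (lift_J_fun_neq0 (phi (fst tq)) (snd tq) (Hdom _ _ Ht Hz)) as
      J.
      unfold lift_J in J. rewrite !partial10, !partial01 in J. exact J.
    + intros i. apply (smooth_const (U := VR3)). }
split; [|split].
- apply (D1 N _ SN); auto. intros z Hz.
  rewrite <- (is_derive_unique _ _ _ (time_derive W N z SN (W0 z Hz))).
  apply is_derive_unique. exact (N1 z Hz).
- exact (D1 P1 _ S1 T1 _ q Uq).
- exact (D1 P2 _ S2 T2 _ q Uq).
Qed.

Lemma lie_alg_affine (d : nat -> nat -> pt) (u : fib -> R) (j : fib) :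
  let n := lie_alg d (fun _ => 0) j in let m i := lie_alg d (fib_delta i) j - n in
  lie_alg d u j = n + (m U1 * u U1 + (m U2 * u U2 + (m U3 * u U3 + m U4 * u U4))).
Proof. cbv zeta. unfold lie_alg. destruct j; unfold fib_delta; ring. Qed.

Lemma is_derive_prod (f g : R -> R) (t l m : R) :
  is_derive f t l -> is_derive g t m ->
  is_derive (fun s => f s * g s) t (l * g t + f t * m).
Proof. intros Hf Hg. exact (is_derive_mult f g t l m Hf Hg Rmult_comm). Qed.

Lemma is_derive_sum (f g : R -> R) (t l m : R) :
  is_derive f t l -> is_derive g t m ->
  is_derive (fun s => f s + g s) t (l + m).
Proof. intros Hf Hg. exact (is_derive_plus f g t l m Hf Hg). Qed.

Lemma is_derive_diff (f g : R -> R) (t l m : R) :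
  is_derive f t l -> is_derive g t m ->
  is_derive (fun s => f s - g s) t (l - m).
Proof. intros Hf Hg. exact (is_derive_minus f g t l m Hf Hg). Qed.

(** For fixed [u] the expression [lie_alg d u j] is linear in [d], so the derivative passes to the
    entries of [d]. *)
Lemma D_lie_alg (X : pt -> pt) (p w : pt) (u : fib -> R) (j : fib) :
  smooth_map_at p X ->
  ddp w (fun z => lie_alg (vpartial X z) u j) p =
  lie_alg (fun a b => (ddp w (partial a b (fun z => fst (X z))) p,
                       ddp w (partial a b (fun z => snd (X z))) p)) u j.
Proof.
intros [H1 H2].
assert (K1 : forall a b, is_derive (fun s : R => partial a b (fun z => fst (X z)) (plus p (scal s
  w))) 0
  (ddp w (partial a b (fun z => fst (X z))) p)).
{ intros a b. destruct H1 as [D [HD [Dp Df]]].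
  apply (ddp_is_derive 0 D); [now apply smooth_partial|easy]. }
assert (K2 : forall a b, is_derive (fun s : R => partial a b (fun z => snd (X z)) (plus p (scal s
  w))) 0
  (ddp w (partial a b (fun z => snd (X z))) p)).
{ intros a b. destruct H2 as [D [HD [Dp Df]]].
  apply (ddp_is_derive 0 D); [now apply smooth_partial|easy]. }
assert (Alg : forall (f g : nat -> nat -> R -> R) (f' g' : nat -> nat -> R),
  (forall a b, is_derive (f a b) 0 (f' a b)) -> (forall a b, is_derive (g a b) 0 (g' a b)) ->
  is_derive (fun s => lie_alg (fun a b => (f a b s, g a b s)) u j) 0
    (lie_alg (fun a b => (f' a b, g' a b)) u j)).
{ intros f g f' g' Hf Hg.
  unfold lie_alg; destruct j; cbn [fst snd]; (evar_last;
  [repeat match goal with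
   | |- is_derive (fun s => @?A s + @?B s) _ _ => refine (is_derive_sum A B _ _ _ _ _)
   | |- is_derive (fun s => @?A s - @?B s) _ _ => refine (is_derive_diff A B _ _ _ _ _)
   | |- is_derive (fun s => @?A s * @?B s) _ _ => refine (is_derive_prod A B _ _ _ _ _)
   | |- is_derive (fun s => f ?a ?b s) _ _ => exact (Hf a b)
   | |- is_derive (fun s => g ?a ?b s) _ _ => exact (Hg a b)
   | |- is_derive (fun _ => ?c) _ _ => exact (is_derive_const c 0)
   end | cbn; ring]). }
exact (is_derive_unique _ _ _ (Alg _ _ _ _ K1 K2)).
Qed.

Lemma D_minus (v p : pt) (f h : pt -> R) : smooth_at p f -> smooth_at p h ->
  ddp v (fun x => f x - h x) p = ddp v f p - ddp v h p.
Proof.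
intros Hf Hh.
assert (E : near_eq p (fun x => f x - h x) (fun x => f x + -1 * h x)) by (apply near_eq_ext;
  intros; ring).
rewrite (near_eq_D p v _ _ E).
rewrite D_plus, D_mult, (D_fun_const v (-1) (fun _ => -1)); auto using smooth_at_const; [ring|].
apply smooth_at_mult; auto using smooth_at_const.
Qed.

Lemma smooth_at_lift_fib_fun (f : point_transformation) (u : fib -> R) (j : fib) (p : pt) :
  pt_dom f p -> smooth_at p (fun z => lift_fib f z u j).
Proof.
intros Hp. exists (pt_dom f). repeat split; auto using pt_dom_open.
apply (smooth_lift_fib (pt_dom f) f (fun i _ => u i)); auto using pt_dom_open, lift_J_fun_neq0.
- apply pt_fun_smooth.
- intros i. apply (smooth_const (U := VR2)).
Qed.

Lemma is_derive_const_loc (g : R -> R) (l c : R) :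
  is_derive g 0 l -> locally (0 : R) (fun t => g t = c) -> l = 0.
Proof.
intros Hg Hc. rewrite <- (is_derive_unique _ _ _ Hg).
apply is_derive_unique. apply (is_derive_ext_loc (fun _ => c)).
- revert Hc. now apply filter_imp.
- apply @is_derive_const.
Qed.

(* Differentiating [(phi t)^-1 . (phi t . theta_1) = theta_1] at [t = 0] only
   involves the derivatives of [phi t], not those of its inverse. *)
Lemma flow_equations (X : pt -> pt) (theta : J 2) (v : J 1) (w : pt) (j : fib) :
  smooth_map_at (fst theta) X ->
  lifted_vector 1 X (jet_proj theta) v -> jet_tangent theta v ->
  let p := fst theta in
  let d := vpartial X p in
  let u a b i := coef (snd theta i) a b in
  let dt a b i := fst (X p) * u (S a) b i + snd (X p) * u a (S b) i in
  lie_alg d (u 0 0)%nat j + dt 0%nat 0%nat j = 0 /\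
  lie_alg (fun a b => (ddp w (partial a b (fun z => fst (X z))) p,
                       ddp w (partial a b (fun z => snd (X z))) p)) (u 0 0)%nat j
  + (lie_alg d (fun i => fst w * u 1%nat 0%nat i + snd w * u 0%nat 1%nat i) j
     - lie_alg d (fun _ => 0) j)
  + (ddp w (fun z => fst (X z)) p * (u 1 0 j)%nat + fst w * dt 1%nat 0%nat j
     + (ddp w (fun z => snd (X z)) p * (u 0 1 j)%nat + snd w * dt 0%nat 1%nat j)) = 0.
Proof.
intros HX [phi [Hphi Hv]] [x Hx]. cbv zeta.
change (fst (jet_proj theta)) with (fst theta) in Hphi.
set (p := fst theta) in *.
set (SS := jet_repr theta) in *.
assert (HS : forall i, smooth_at p (SS i)) by (intros; apply smooth_at_jet_repr).
assert (Hu : forall a b i, (a + b <= 2)%nat -> partial a b (SS i) p = coef (snd theta i) a b).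
{ intros a b i Hab. apply partial_taylor. exact Hab. }
destruct Hphi as [eps [U [D [Heps [HU [Up [HD [_ [Hdom' [Hsm [H0 Hder]]]]]]]]]]].
assert (Hdom : forall t q, Rabs t < eps -> U q -> pt_dom (phi t) q) by (intros t q Ht Hq;
  now apply Hdom').
assert (R0 : Rabs 0 < eps) by now rewrite Rabs_R0.
set (th1 := jet_proj theta) in *.
assert (G0 : prolong 1 (phi 0) th1 = th1) by (apply (prolong_id _ _ U); auto).
(* The vector [v] is read off twice: its base part from the flow, and its fibre part from the graph
   of the jet of the section, as the derivative along that same base part. *)
assert (Hw : fst v = X p).
{ destruct Hv as [Hv _]. pose proof (Hder 0 p R0 Up) as Hd. rewrite (H0 p Up) in Hd.
  assert (E : forall l l' : pt, is_derive (fun t => phi t p : pt) 0 l ->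
     is_derive (fun t => phi t p : pt) 0 l' -> l = l').
  { intros [l1 l2] [m1 m2] K1 K2.
    pose proof (is_derive_unique _ _ _ (is_derive_fst _ _ _ K1)) as Q1.
    pose proof (is_derive_unique _ _ _ (is_derive_fst _ _ _ K2)) as Q2.
    pose proof (is_derive_unique _ _ _ (is_derive_snd _ _ _ K1)) as Q3.
    pose proof (is_derive_unique _ _ _ (is_derive_snd _ _ _ K2)) as Q4.
    cbn [fst snd] in *. congruence. }
  exact (E _ _ Hv Hd). }
assert (HV : v = (x, fun i s => fst x * partial (S (ix s)) (iy s) (SS i) p
                + snd x * partial (ix s) (S (iy s)) (SS i) p)).
{ apply (velocity_unique _ _ _ Hx).
  pose proof (velocity_jet 1 SS (fun s : R => plus p (scal s x)) x) as Q. cbv beta in Q.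
  replace (plus p (scal 0 x)) with p in Q by (symmetry; apply (line_0 (U := VR2))).
  apply Q; [exact HS|apply is_derive_linepath]. }
assert (Hxw : x = X p) by (rewrite <- Hw, HV; reflexivity).
subst x.
assert (Hc : forall i a b, (a + b <= 1)%nat ->
  is_derive (fun t => coef (snd (prolong 1 (phi t) th1) i) a b) 0
   (fst (X p) * coef (snd theta i) (S a) b + snd (X p) * coef (snd theta i) a (S b))).
{ intros i a b Hab. rewrite <- !Hu by lia. destruct Hv as [_ Hv]. rewrite HV in Hv.
  specialize (Hv i (exist _ (a, b) Hab)). unfold ix, iy in Hv; cbn [fst snd proj1_sig] in Hv.
  unfold coef. destruct le_dec as [h|h]; [|easy].
  replace h with Hab by apply proof_irrelevance. exact Hv. }
assert (Hc0 : forall i a b, (a + b <= 1)%nat ->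
  coef (snd (prolong 1 (phi 0) th1) i) a b = coef (snd theta i) a b).
{ intros i a b Hab. rewrite G0. unfold th1, jet_proj. cbn [snd jet].
  unfold jet; cbn [snd]. rewrite coef_fjet by easy. apply Hu. lia. }
assert (FT := fun w u => flow_lift_time X phi eps U p w u j Heps HU Up Hdom Hsm H0 Hder).
assert (I0 : forall u, lift_fib (phi 0) p u j = u j).
{ intros u. rewrite (lift_fib_near _ (fun z => z)); [apply lift_fib_id| |];
  exists U; repeat split; auto; intros z Hz; now rewrite H0. }
assert (I0' : forall u, ddp w (fun z => lift_fib (phi 0) z u j) p = 0).
{ intros u. transitivity (ddp w (fun _ => u j) p); [|now apply (D_fun_const w (u j))].
  apply (ddp_ext_open U); auto. intros z Hz.
  rewrite (lift_fib_near _ (fun z => z)); [apply lift_fib_id| |];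
  exists U; repeat split; auto; intros y Hy; now rewrite H0. }
assert (I1 : ddp w (fun z => fst (phi 0 z)) p = fst w).
{ rewrite (ddp_ext_open U _ (fun z => fst z) w p HU Up) by (intros; now rewrite H0).
  rewrite ddp_lin, Dx_fst, Dy_fst; [ring|].
  exists (fun _ => True). repeat split; [apply open_true|apply smooth_fst]. }
assert (I2 : ddp w (fun z => snd (phi 0 z)) p = snd w).
{ rewrite (ddp_ext_open U _ (fun z => snd z) w p HU Up) by (intros; now rewrite H0).
  rewrite ddp_lin, Dx_snd, Dy_snd; [ring|].
  exists (fun _ => True). repeat split; [apply open_true|apply smooth_snd]. }
assert (Heps' : locally (0 : R) (fun t => Rabs t < eps)).
{ exists (mkposreal _ Heps). intros t Ht. apply (proj1 (ball_RE _ _ _)) in Ht.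
  simpl in Ht. now rewrite Rminus_0_r in Ht. }
(* The inverse of [pt_sym (phi t)] is [phi t] itself, so unfolding [transform] in this identity
   produces [lift_fib (phi t)]. *)
assert (Id : forall t a b, Rabs t < eps -> (a + b <= 1)%nat ->
  partial a b (transform (pt_sym (phi t)) (jet_repr (prolong 1 (phi t) th1)) j) p
  = coef (snd theta j) a b).
{ intros t a b Ht Hab.
  pose proof (prolong_sym 1 (phi t) th1 (Hdom t p Ht Up)) as E.
  apply (f_equal (fun z => coef (snd z j) a b)) in E.
  replace (coef (snd th1 j) a b) with (coef (snd theta j) a b) in E.
  2: { rewrite <- (Hc0 j a b Hab). now rewrite G0. }
  change (coef (fjet 1 (transform (pt_sym (phi t)) (jet_repr (prolong 1 (phi t) th1)) j)
    (pt_inv (phi t) (phi t p))) a b = coef (snd theta j) a b) in E.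
  rewrite coef_fjet, (pt_funK _ _ (Hdom t p Ht Up)) in E by easy. exact E. }
set (sh := fun t => lift_fib (phi t) p (fun _ => 0) j).
set (li := fun i t => lift_fib (phi t) p (fib_delta i) j - sh t).
assert (Dsh : is_derive sh 0 (lie_alg (vpartial X p) (fun _ => 0) j)) by exact (proj1 (FT w (fun
  _ => 0))).
assert (Dli : forall i, is_derive (li i) 0 (lie_alg (vpartial X p) (fib_delta i) j
   - lie_alg (vpartial X p) (fun _ => 0) j)).
{ intros i. apply is_derive_diff; [exact (proj1 (FT w (fib_delta i)))|exact Dsh]. }
assert (sh0 : sh 0 = 0) by apply I0.
assert (li0 : forall i, li i 0 = fib_delta i j) by (intros; unfold li; rewrite I0, sh0; ring).
split.
- set (F := fun i t => li i t * coef (snd (prolong 1 (phi t) th1) i) 0 0).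
  assert (DF : forall i, is_derive (F i) 0
    ((lie_alg (vpartial X p) (fib_delta i) j - lie_alg (vpartial X p) (fun _ => 0) j) * coef (snd
      theta i) 0 0
    + fib_delta i j * (fst (X p) * coef (snd theta i) 1 0 + snd (X p) * coef (snd theta i) 0 1))).
  { intros i. pose proof (is_derive_prod _ _ _ _ _ (Dli i) (Hc i 0%nat 0%nat ltac:(lia))) as Q.
    cbv beta in Q. rewrite li0, Hc0 in Q by lia. exact Q. }
  pose proof (is_derive_sum _ _ _ _ _ Dsh (is_derive_sum _ _ _ _ _ (DF U1)
    (is_derive_sum _ _ _ _ _ (DF U2) (is_derive_sum _ _ _ _ _ (DF U3) (DF U4))))) as DD.
  apply (is_derive_const_loc _ _ (coef (snd theta j) 0 0)) in DD.
  + rewrite (lie_alg_affine _ (fun i => coef (snd theta i) 0 0)). cbv zeta.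
    etransitivity; [|exact DD]. destruct j; unfold fib_delta; ring.
  + revert Heps'. apply filter_imp. intros t Ht. rewrite <- (Id t 0%nat 0%nat Ht ltac:(lia)).
    rewrite partial00. unfold transform. simpl. rewrite lift_fib_affine.
    unfold jet_repr. unfold F, li, sh, lift_lin, lift_shift.
    change (phi t p) with (fst (prolong 1 (phi t) th1)). rewrite !taylor_at. reflexivity.
- set (dsh := fun t => ddp w (fun z => lift_fib (phi t) z (fun _ => 0) j) p).
  set (dli := fun i t => ddp w (fun z => lift_fib (phi t) z (fib_delta i) j) p - dsh t).
  assert (Ddsh : is_derive dsh 0 (ddp w (fun z => lie_alg (vpartial X z) (fun _ => 0) j) p))
    by exact (proj1 (proj2 (FT w (fun _ => 0)))).
  assert (Ddli : forall i, is_derive (dli i) 0 (ddp w (fun z => lie_alg (vpartial X z) (fib_delta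
    i) j) p
     - ddp w (fun z => lie_alg (vpartial X z) (fun _ => 0) j) p)).
  { intros i. apply is_derive_diff; [exact (proj1 (proj2 (FT w (fib_delta i))))|exact Ddsh]. }
  rewrite !D_lie_alg in Ddsh by easy.
  assert (dli0 : forall i, dli i 0 = 0) by (intros; unfold dli, dsh; rewrite !I0'; ring).
  pose proof (proj1 (proj2 (proj2 (FT w (fun _ => 0))))) as DP1.
  pose proof (proj2 (proj2 (proj2 (FT w (fun _ => 0))))) as DP2.
  set (F := fun i t => dli i t * coef (snd (prolong 1 (phi t) th1) i) 0 0
    + li i t * (ddp w (fun z => fst (phi t z)) p * coef (snd (prolong 1 (phi t) th1) i) 1 0
              + ddp w (fun z => snd (phi t z)) p * coef (snd (prolong 1 (phi t) th1) i) 0 1)).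
  (* The rules of differentiation produce a value containing factors taken at t = 0; these are
     evaluated afterwards, the lift being the identity matrix with vanishing derivative there. *)
  assert (DF : forall i, exists l, is_derive (F i) 0 l /\ l =
    (ddp w (fun z => lie_alg (vpartial X z) (fib_delta i) j) p
     - ddp w (fun z => lie_alg (vpartial X z) (fun _ => 0) j) p) * coef (snd theta i) 0 0
    + (lie_alg (vpartial X p) (fib_delta i) j - lie_alg (vpartial X p) (fun _ => 0) j)
      * (fst w * coef (snd theta i) 1 0 + snd w * coef (snd theta i) 0 1)
    + fib_delta i j * (ddp w (fun z => fst (X z)) p * coef (snd theta i) 1 0
      + fst w * (fst (X p) * coef (snd theta i) 2 0 + snd (X p) * coef (snd theta i) 1 1)
      + (ddp w (fun z => snd (X z)) p * coef (snd theta i) 0 1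
      + snd w * (fst (X p) * coef (snd theta i) 1 1 + snd (X p) * coef (snd theta i) 0 2)))).
  { intros i. eexists. split.
    - apply is_derive_sum; [apply is_derive_prod; [apply Ddli|apply Hc; lia]|].
      apply is_derive_prod; [apply Dli|].
      apply is_derive_sum; apply is_derive_prod; try exact DP1; try exact DP2; apply Hc; lia.
    - cbv beta. rewrite dli0, li0, I1, I2, !Hc0 by lia.
      match goal with |- @eq _ ?a ?b => change (@eq R a b) end. ring. }
  destruct (DF U1) as [l1 [D1 E1]]. destruct (DF U2) as [l2 [D2 E2]].
  destruct (DF U3) as [l3 [D3 E3]]. destruct (DF U4) as [l4 [D4 E4]].
  pose proof (is_derive_sum _ _ _ _ _ Ddsh (is_derive_sum _ _ _ _ _ D1
    (is_derive_sum _ _ _ _ _ D2 (is_derive_sum _ _ _ _ _ D3 D4)))) as DD.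
  assert (Fin : forall c, locally (0 : R) (fun t => dsh t + (F U1 t + (F U2 t + (F U3 t + F U4
    t))) = c) ->
   lie_alg (fun a b => (ddp w (partial a b (fun z => fst (X z))) p,
                       ddp w (partial a b (fun z => snd (X z))) p)) (fun i => coef (snd theta i)
                      0 0) j
  + (lie_alg (vpartial X p) (fun i => fst w * coef (snd theta i) 1 0 + snd w * coef (snd theta i)
    0 1) j
     - lie_alg (vpartial X p) (fun _ => 0) j)
  + (ddp w (fun z => fst (X z)) p * coef (snd theta j) 1 0
     + fst w * (fst (X p) * coef (snd theta j) 2 0 + snd (X p) * coef (snd theta j) 1 1)
     + (ddp w (fun z => snd (X z)) p * coef (snd theta j) 0 1
     + snd w * (fst (X p) * coef (snd theta j) 1 1 + snd (X p) * coef (snd theta j) 0 2))) = 0).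
  { intros c Hcst. apply (is_derive_const_loc _ _ c) in DD; [|exact Hcst].
    rewrite E1, E2, E3, E4 in DD. rewrite !D_lie_alg in DD by easy.
    rewrite (lie_alg_affine _ (fun i => coef (snd theta i) 0 0)).
    rewrite (lie_alg_affine (vpartial X p) (fun i => fst w * coef (snd theta i) 1 0 + snd w *
      coef (snd theta i) 0 1)).
    cbv zeta.
    etransitivity; [|exact DD]. destruct j; unfold fib_delta; ring. }
  apply (Fin (fst w * coef (snd theta j) 1 0 + snd w * coef (snd theta j) 0 1)).
  revert Heps'. apply filter_imp. intros t Ht.
  rewrite <- (Id t 1%nat 0%nat Ht ltac:(lia)), <- (Id t 0%nat 1%nat Ht ltac:(lia)).
  rewrite partial10, partial01.
  assert (Ht' := Hdom t p Ht Up).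
  assert (Hcod := pt_fun_cod (phi t) p Ht').
  set (T := jet_repr (prolong 1 (phi t) th1)).
  assert (HT : forall i q, smooth_at q (T i)) by (intros; apply smooth_at_jet_repr).
  assert (ST : smooth_at p (transform (pt_sym (phi t)) T j)).
  { pose proof (smooth_at_transform (pt_sym (phi t)) T (phi t p) j Hcod (fun i => HT i _)) as Q.
    simpl in Q. now rewrite (pt_funK _ _ Ht') in Q. }
  rewrite <- (ddp_lin p w) by exact ST.
  pose proof (D_transform (pt_sym (phi t)) T j (phi t p) w Hcod (fun i => HT i _)) as E.
  cbv beta zeta in E. simpl pt_fun in E. simpl pt_inv in E. rewrite (pt_funK _ _ Ht') in E.
  rewrite E. unfold T, jet_repr.
  change (phi t p) with (fst (prolong 1 (phi t) th1)).
  rewrite !taylor_at, !ddx_taylor, !ddy_taylor by lia.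
  unfold F, li, sh, dli, dsh, lift_lin, lift_shift.
  rewrite !D_minus by (apply (smooth_at_lift_fib_fun (phi t)); exact Ht'). reflexivity.
Qed.

(** * Brackets of symmetry jets *)

(** The Leibniz rule on families of derivatives, up to order 2. The final case is a default outside
    that range. *)
Definition jet_mult (f h : nat -> nat -> R) (a b : nat) : R :=
  match a, b with
  | 0%nat, 0%nat => f 0%nat 0%nat * h 0%nat 0%nat
  | 1%nat, 0%nat => f 1%nat 0%nat * h 0%nat 0%nat + f 0%nat 0%nat * h 1%nat 0%nat
  | 0%nat, 1%nat => f 0%nat 1%nat * h 0%nat 0%nat + f 0%nat 0%nat * h 0%nat 1%nat
  | 2%nat, 0%nat => f 2%nat 0%nat * h 0%nat 0%nat + 2 * f 1%nat 0%nat * h 1%nat 0%nat + f 0%nat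
    0%nat * h 2%nat 0%nat
  | 1%nat, 1%nat => f 1%nat 1%nat * h 0%nat 0%nat + f 1%nat 0%nat * h 0%nat 1%nat + f 0%nat 1%nat
    * h 1%nat 0%nat + f 0%nat 0%nat * h 1%nat 1%nat
  | 0%nat, 2%nat => f 0%nat 2%nat * h 0%nat 0%nat + 2 * f 0%nat 1%nat * h 0%nat 1%nat + f 0%nat
    0%nat * h 0%nat 2%nat
  | _, _ => 0
  end.

Lemma le2_cases (a b : nat) : (a + b <= 2)%nat ->
  (a = 0 /\ b = 0 \/ a = 1 /\ b = 0 \/ a = 0 /\ b = 1 \/ a = 2 /\ b = 0 \/
   a = 1 /\ b = 1 \/ a = 0 /\ b = 2)%nat.
Proof. lia. Qed.

Lemma partial_mult (p : pt) (f h : pt -> R) (a b : nat) : (a + b <= 2)%nat ->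
  smooth_at p f -> smooth_at p h ->
  partial a b (fun q => f q * h q) p =
  jet_mult (fun a b => partial a b f p) (fun a b => partial a b h p) a b.
Proof.
intros Hab Hf Hh.
assert (D2 : forall v w, ddp w (ddp v (fun q => f q * h q)) p =
  ddp w (ddp v f) p * h p + ddp v f p * ddp w h p + (ddp w f p * ddp v h p + f p * ddp w (ddp v
    h) p)).
{ intros v w. rewrite (near_eq_D p w _ _ (near_Dmult p f h v Hf Hh)).
  pose proof (smooth_at_ddp p v f Hf). pose proof (smooth_at_ddp p v h Hh).
  rewrite D_plus by (apply smooth_at_mult; assumption). now rewrite !D_mult by assumption. }
destruct (le2_cases a b Hab) as [[-> ->]|[[-> ->]|[[-> ->]|[[-> ->]|[[-> ->]|[-> ->]]]]]];
 unfold jet_mult; rewrite ?partial20, ?partial11, ?partial02, ?partial10, ?partial01, ?partial00,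
  ?D2, ?D_mult by assumption; ring.
Qed.

Lemma partial_partial (p : pt) (f : pt -> R) (a b c e : nat) : smooth_at p f ->
  partial a b (partial c e f) p = partial (a + c) (b + e) f p.
Proof.
intros [D [HD [Dp Hf]]]. revert p Dp. induction a as [|a IH]; [induction b as [|b IH]|];
  intros p Dp.
- now rewrite partial00.
- rewrite partial0S, (ddp_ext_open D _ _ _ _ HD Dp IH). simpl.
  apply ddy_partial. exists D; auto.
- simpl. rewrite !partial_Sl. now apply (ddp_ext_open D).
Qed.

Definition bracket_alg (d e : nat -> nat -> pt) (a b : nat) : pt :=
  let comp (pr : pt -> R) :=
    jet_mult (fun a b => pr (e (S a) b)) (fun a b => fst (d a b)) a b
    + jet_mult (fun a b => pr (e a (S b))) (fun a b => snd (d a b)) a b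
    - (jet_mult (fun a b => pr (d (S a) b)) (fun a b => fst (e a b)) a b
    + jet_mult (fun a b => pr (d a (S b))) (fun a b => snd (e a b)) a b) in
  (comp fst, comp snd).

Lemma jet_mult_ext (f f' h h' : nat -> nat -> R) (a b : nat) : (a + b <= 2)%nat ->
  (forall a b, (a + b <= 2)%nat -> f a b = f' a b) -> (forall a b,
    (a + b <= 2)%nat -> h a b = h' a b) ->
  jet_mult f h a b = jet_mult f' h' a b.
Proof.
intros Hab Hf Hh.
destruct (le2_cases a b Hab) as [[-> ->]|[[-> ->]|[[-> ->]|[[-> ->]|[[-> ->]|[-> ->]]]]]];
 unfold jet_mult; rewrite !Hf, !Hh by lia; reflexivity.
Qed.

Lemma vcoef_bracket (p : pt) (c e : vjets 3) (a b : nat) : (a + b <= 2)%nat ->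
  vcoef (jet_bracket p c e) a b = bracket_alg (vcoef c) (vcoef e) a b.
Proof.
intros Hab. unfold jet_bracket. rewrite vcoef_vjet by easy.
set (X := vjet_repr p c). set (Y := vjet_repr p e).
destruct (smooth_map_at_vjet_repr p p c) as [X1 X2]. fold X in X1, X2.
destruct (smooth_map_at_vjet_repr p p e) as [Y1 Y2]. fold Y in Y1, Y2.
assert (EX : forall a b, (a + b <= 3)%nat -> vcoef c a b =
  (partial a b (fun q => fst (X q)) p, partial a b (fun q => snd (X q)) p)) by apply
    vcoef_eq_partial.
assert (EY : forall a b, (a + b <= 3)%nat -> vcoef e a b =
  (partial a b (fun q => fst (Y q)) p, partial a b (fun q => snd (Y q)) p)) by apply
    vcoef_eq_partial.
assert (M : forall (f h : pt -> R) i k, (i + k <= 1)%nat -> smooth_at p f -> smooth_at p h ->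
  partial a b (fun q => partial i k f q * h q) p =
  jet_mult (fun a b => partial (a + i) (b + k) f p) (fun a b => partial a b h p) a b).
{ intros f h i k Hik Hf Hh. rewrite partial_mult; auto using smooth_at_partial.
  apply jet_mult_ext; auto. intros a' b' _. now apply partial_partial. }
assert (G : forall x y : pt -> R, smooth_at p x -> smooth_at p y ->
  partial a b (fun q => partial 1 0 y q * fst (X q) + partial 0 1 y q * snd (X q)
     - (partial 1 0 x q * fst (Y q) + partial 0 1 x q * snd (Y q))) p
  = jet_mult (fun a b => partial (S a) b y p) (fun a b => partial a b (fun q => fst (X q)) p) a b
  + jet_mult (fun a b => partial a (S b) y p) (fun a b => partial a b (fun q => snd (X q)) p) a b
  - (jet_mult (fun a b => partial (S a) b x p) (fun a b => partial a b (fun q => fst (Y q)) p) a b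
  + jet_mult (fun a b => partial a (S b) x p) (fun a b => partial a b (fun q => snd (Y q)) p) a
    b)).
{ intros x y Hx Hy.
  assert (P : forall f h i k, smooth_at p f -> smooth_at p h -> smooth_at p (fun q => partial i k
    f q * h q))
    by (intros; apply smooth_at_mult; auto using smooth_at_partial).
  transitivity (partial a b (fun q => (partial 1 0 y q * fst (X q) + partial 0 1 y q * snd (X q))
     + -1 * (partial 1 0 x q * fst (Y q) + partial 0 1 x q * snd (Y q))) p).
  { apply near_eq_partial, near_eq_ext. intros; ring. }
  rewrite partial_plus, partial_scal, !partial_plus; try apply P; auto.
  2: { apply smooth_at_plus; now apply P. }
  2: { apply smooth_at_mult; [apply smooth_at_const|]. apply smooth_at_plus; now apply P. }
  rewrite !M by (auto; lia).
  match goal with |- ?A + ?B + -1 * (?C + ?D) = _ => transitivity (A + B - (C + D)); [ring|] end.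
  f_equal; f_equal; apply jet_mult_ext; auto; intros a' b' _; f_equal; lia. }
unfold bracket_alg. f_equal.
- etransitivity; [exact (G _ _ X1 Y1)|].
  f_equal; f_equal; apply jet_mult_ext; auto; intros a' b' H;
    ((rewrite EX by lia) || (rewrite EY by lia)); reflexivity.
- etransitivity; [exact (G _ _ X2 Y2)|].
  f_equal; f_equal; apply jet_mult_ext; auto; intros a' b' H;
    ((rewrite EX by lia) || (rewrite EY by lia)); reflexivity.
Qed.

(** The infinitesimal invariance of the section under the field, with its x- and y-derivatives at
    the point. Derivatives of the section transform by the linear part of the action only, hence the
    subtraction of [lie_alg d] at zero fibre coordinates. *)
Definition symmetry_equations (u : nat -> nat -> fib -> R) (d : nat -> nat -> pt) : Prop :=
  forall j,
  let along a b := fst (d 0 0)%nat * u (S a) b j + snd (d 0 0)%nat * u a (S b) j in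
  lie_alg d (u 0 0)%nat j + along 0%nat 0%nat = 0 /\
  lie_alg (fun a b => d (S a) b) (u 0 0)%nat j
  + (lie_alg d (u 1 0)%nat j - lie_alg d (fun _ => 0) j)
  + (fst (d 1 0)%nat * (u 1 0 j)%nat + snd (d 1 0)%nat * (u 0 1 j)%nat + along 1%nat 0%nat) = 0 /\
  lie_alg (fun a b => d a (S b)) (u 0 0)%nat j
  + (lie_alg d (u 0 1)%nat j - lie_alg d (fun _ => 0) j)
  + (fst (d 0 1)%nat * (u 1 0 j)%nat + snd (d 0 1)%nat * (u 0 1 j)%nat + along 0%nat 1%nat) = 0.

Lemma lie_alg_ext (d d' : nat -> nat -> pt) (u u' : fib -> R) (j : fib) :
  (forall a b, (a + b <= 2)%nat -> d a b = d' a b) -> (forall i, u i = u' i) ->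
  lie_alg d u j = lie_alg d' u' j.
Proof. intros Hd Hu. unfold lie_alg. rewrite !Hd, !Hu by lia. reflexivity. Qed.

Lemma jet_symmetries_equations (theta : J 2) (c : vjets 3) :
  jet_symmetries theta c ->
  symmetry_equations (fun a b i => coef (snd theta i) a b) (vcoef c).
Proof.
intros [X [v [[D [HD [Dp HX]]] [-> [Hl Ht]]]]] j. set (p := fst theta) in *.
assert (SX : smooth_map_at p X) by (destruct HX; split; exists D; auto).
assert (V : forall a b, (a + b <= 3)%nat -> vcoef (vjet 3 X p) a b = vpartial X p a b)
  by (intros; now apply vcoef_vjet).
destruct SX as [S1 S2].
assert (X0 : forall w, X p = w -> vpartial X p 0%nat 0%nat = w).
{ intros w <-. unfold vpartial. rewrite !partial00. now rewrite <- surjective_pairing. }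
specialize (X0 _ eq_refl).
destruct (flow_equations X theta v (1, 0) j (conj S1 S2) Hl Ht) as [E0 Ex].
destruct (flow_equations X theta v (0, 1) j (conj S1 S2) Hl Ht) as [_ Ey].
cbv zeta in *. fold p in E0, Ex, Ey. cbn [fst snd] in Ex, Ey.
rewrite !(V 0 0)%nat, X0, (V 1 0)%nat, (V 0 1)%nat by lia.
cbv zeta. split; [|split].
- etransitivity; [|exact E0]. apply f_equal2; [|reflexivity].
  apply lie_alg_ext; intros; [apply V; lia|reflexivity].
- etransitivity; [|exact Ex].
  assert (A1 : lie_alg (fun a b => vcoef (vjet 3 X p) (S a) b) (fun i => coef (snd theta i) 0 0)
    j =
    lie_alg (fun a b => (ddx (partial a b (fun z => fst (X z))) p,
      ddx (partial a b (fun z => snd (X z))) p)) (fun i => coef (snd theta i) 0 0) j).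
  { apply lie_alg_ext; [|reflexivity]. intros a b Hab. rewrite V by lia. unfold vpartial.
    now rewrite !partial_Sl. }
  assert (A2 : lie_alg (vcoef (vjet 3 X p)) (fun i => coef (snd theta i) 1 0) j =
    lie_alg (vpartial X p) (fun i => 1 * coef (snd theta i) 1 0 + 0 * coef (snd theta i) 0 1) j).
  { apply lie_alg_ext; [intros; apply V; lia|intros; ring]. }
  assert (A3 : lie_alg (vcoef (vjet 3 X p)) (fun _ => 0) j = lie_alg (vpartial X p) (fun _ => 0)
    j).
  { apply lie_alg_ext; intros; [apply V; lia|reflexivity]. }
  rewrite A1, A2, A3. unfold vpartial at 3 4; cbn [fst snd]. rewrite !partial10. ring.
- etransitivity; [|exact Ey].
  assert (A1 : lie_alg (fun a b => vcoef (vjet 3 X p) a (S b)) (fun i => coef (snd theta i) 0 0)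
    j =
    lie_alg (fun a b => (ddy (partial a b (fun z => fst (X z))) p,
      ddy (partial a b (fun z => snd (X z))) p)) (fun i => coef (snd theta i) 0 0) j).
  { apply lie_alg_ext; [|reflexivity]. intros a b Hab. rewrite V by lia. unfold vpartial.
    now rewrite !ddy_partial. }
  assert (A2 : lie_alg (vcoef (vjet 3 X p)) (fun i => coef (snd theta i) 0 1) j =
    lie_alg (vpartial X p) (fun i => 0 * coef (snd theta i) 1 0 + 1 * coef (snd theta i) 0 1) j).
  { apply lie_alg_ext; [intros; apply V; lia|intros; ring]. }
  assert (A3 : lie_alg (vcoef (vjet 3 X p)) (fun _ => 0) j = lie_alg (vpartial X p) (fun _ => 0)
    j).
  { apply lie_alg_ext; intros; [apply V; lia|reflexivity]. }
  rewrite A1, A2, A3. unfold vpartial at 3 4; cbn [fst snd]. rewrite !partial01. ring.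
Qed.

(* Liouville's relative invariants; [u a b i] is the derivative of order [(a, b)]
   of the fibre coordinate [i]. *)
Definition liouville1 (u : nat -> nat -> fib -> R) : R :=
  (u 0 2 U1)%nat - 2 / 3 * (u 1 1 U2)%nat + 1 / 3 * (u 2 0 U3)%nat
  + 2 * (u 0 0 U1)%nat * (u 1 0 U4)%nat + (u 1 0 U1)%nat * (u 0 0 U4)%nat
  - (u 0 0 U1)%nat * (u 0 1 U3)%nat - (u 0 1 U1)%nat * (u 0 0 U3)%nat
  + 2 / 3 * (u 0 0 U2)%nat * (u 0 1 U2)%nat - 1 / 3 * (u 0 0 U2)%nat * (u 1 0 U3)%nat.

Definition liouville2 (u : nat -> nat -> fib -> R) : R :=
  (u 2 0 U4)%nat - 2 / 3 * (u 1 1 U3)%nat + 1 / 3 * (u 0 2 U2)%nat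
  - 2 * (u 0 1 U1)%nat * (u 0 0 U4)%nat - (u 0 0 U1)%nat * (u 0 1 U4)%nat
  + (u 0 0 U2)%nat * (u 1 0 U4)%nat + (u 1 0 U2)%nat * (u 0 0 U4)%nat
  - 2 / 3 * (u 0 0 U3)%nat * (u 1 0 U3)%nat + 1 / 3 * (u 0 1 U2)%nat * (u 0 0 U3)%nat.

(* The 12 symmetry equations leave the first derivatives and [X^2_12], [X^1_12]
   of a symmetry free.  For the symmetries with values (1, 0) and (0, 1), the
   vanishing of the 1-jet of the bracket determines the latter from the former,
   and then the first derivatives cancel from its second order part. *)
Lemma bracket_liouville (u : nat -> nat -> fib -> R) (d e : nat -> nat -> pt) :
  symmetry_equations u d -> symmetry_equations u e ->
  (d 0 0)%nat = (1, 0) -> (e 0 0)%nat = (0, 1) ->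
  (forall a b, (a + b <= 1)%nat -> bracket_alg d e a b = (0, 0)) ->
  bracket_alg d e 2 0 = (2 * liouville1 u, 0) /\
  bracket_alg d e 1 1 = (liouville2 u, liouville1 u) /\
  bracket_alg d e 0 2 = (0, 2 * liouville2 u).
Proof.
intros Hd He Ed Ee HB.
pose proof (HB 0%nat 0%nat ltac:(lia)) as B0. pose proof (HB 1%nat 0%nat ltac:(lia)) as Bx.
pose proof (HB 0%nat 1%nat ltac:(lia)) as By. clear HB.
destruct (Hd U1) as [D1 [D1x D1y]]. destruct (Hd U2) as [D2 [D2x D2y]].
destruct (Hd U3) as [D3 [D3x D3y]]. destruct (Hd U4) as [D4 [D4x D4y]]. clear Hd.
destruct (He U1) as [E1 [E1x E1y]]. destruct (He U2) as [E2 [E2x E2y]].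
destruct (He U3) as [E3 [E3x E3y]]. destruct (He U4) as [E4 [E4x E4y]]. clear He.
cbv zeta in *. unfold bracket_alg, jet_mult, lie_alg, liouville1, liouville2 in *.
rewrite Ed in *. rewrite Ee in *. clear Ed Ee. cbn [fst snd] in *.
injection B0; clear B0; intros B02 B01.
injection Bx; clear Bx; intros Bx2 Bx1.
injection By; clear By; intros By2 By1.
destruct (d 1 0)%nat as [d1x d2x].
destruct (d 0 1)%nat as [d1y d2y].
destruct (d 2 0)%nat as [d1xx d2xx].
destruct (d 1 1)%nat as [d1xy d2xy].
destruct (d 0 2)%nat as [d1yy d2yy].
destruct (d 3 0)%nat as [d1xxx d2xxx].
destruct (d 2 1)%nat as [d1xxy d2xxy].
destruct (d 1 2)%nat as [d1xyy d2xyy].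
destruct (d 0 3)%nat as [d1yyy d2yyy].
destruct (e 1 0)%nat as [e1x e2x].
destruct (e 0 1)%nat as [e1y e2y].
destruct (e 2 0)%nat as [e1xx e2xx].
destruct (e 1 1)%nat as [e1xy e2xy].
destruct (e 0 2)%nat as [e1yy e2yy].
destruct (e 3 0)%nat as [e1xxx e2xxx].
destruct (e 2 1)%nat as [e1xxy e2xxy].
destruct (e 1 2)%nat as [e1xyy e2xyy].
destruct (e 0 3)%nat as [e1yyy e2yyy].
set (u1 := (u 0 0 U1)%nat) in *; clearbody u1.
set (u2 := (u 0 0 U2)%nat) in *; clearbody u2.
set (u3 := (u 0 0 U3)%nat) in *; clearbody u3.
set (u4 := (u 0 0 U4)%nat) in *; clearbody u4.
set (u1y := (u 0 1 U1)%nat) in *; clearbody u1y.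
set (u2y := (u 0 1 U2)%nat) in *; clearbody u2y.
set (u3y := (u 0 1 U3)%nat) in *; clearbody u3y.
set (u4y := (u 0 1 U4)%nat) in *; clearbody u4y.
set (u1x := (u 1 0 U1)%nat) in *; clearbody u1x.
set (u2x := (u 1 0 U2)%nat) in *; clearbody u2x.
set (u3x := (u 1 0 U3)%nat) in *; clearbody u3x.
set (u4x := (u 1 0 U4)%nat) in *; clearbody u4x.
cbn [fst snd] in *.
(* The undifferentiated equations are solved for the pure second derivatives; the mixed ones remain
   as parameters. *)
assert (E0 : d2xx = 2 * d1x * u1 + d2x * u2 - d2y * u1 + u1x) by (clear - D1; lra).
subst d2xx.
assert (E0 : d1xx = - d1x * u2 - 3 * d1y * u1 - 2 * d2x * u3 + 2 * d2xy - u2x) by (clear - D2;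
  lra).
subst d1xx.
assert (E0 : d2yy = 2 * d1xy + 2 * d1y * u2 + 3 * d2x * u4 + d2y * u3 + u3x) by (clear - D3; lra).
subst d2yy.
assert (E0 : d1yy = d1x * u4 - d1y * u3 - 2 * d2y * u4 - u4x) by (clear - D4; lra).
subst d1yy.
clear D1 D2 D3 D4.
assert (E0 : e2xx = 2 * e1x * u1 + e2x * u2 - e2y * u1 + u1y) by (clear - E1; lra).
subst e2xx.
assert (E0 : e1xx = - e1x * u2 - 3 * e1y * u1 - 2 * e2x * u3 + 2 * e2xy - u2y) by (clear - E2;
  lra).
subst e1xx.
assert (E0 : e2yy = 2 * e1xy + 2 * e1y * u2 + 3 * e2x * u4 + e2y * u3 + u3y) by (clear - E3; lra).
subst e2yy.
assert (E0 : e1yy = e1x * u4 - e1y * u3 - 2 * e2y * u4 - u4y) by (clear - E4; lra).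
subst e1yy.
clear E1 E2 E3 E4.
(* The value of the bracket of lifts of the coordinate vectors is the difference of these first
   derivatives. *)
assert (E0 : e1x = d1y) by (clear - B01; lra).
subst e1x.
assert (E0 : e2x = d2y) by (clear - B02; lra). subst e2x.
assert (Se1xy : e1xy = d1x * e1y + d1x * u4 + d1y * e2y - d1y * u3 - d1y ^ 2 - d2y * e1y - 2 *
  d2y * u4 - u4x) by (clear - By1; lra).
assert (Sd2xy : d2xy = d1x * d2y - d1y * d2x + 2 * d1y * u1 + d2x * e2y + d2y * u2 - d2y ^ 2 -
  e2y * u1 + u1y) by (clear - Bx2; lra).
(* The two remaining equations have leading parts 2 e2xy - d1xy and e2xy - 2 d1xy. The determinant
   of this system is -3, whence the thirds in Liouville's invariants. *)
assert (Se2xy : e2xy = d1y * d2y - d2x * e1y - d2x * u4 + d2y * u3 + 2 * e1y * u1 + 2 / 3 * u2y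
  - 1 / 3 * u3x) by (clear - Bx1 By2; lra).
assert (Sd1xy : d1xy = d1y * d2y - d1y * u2 - d2x * e1y - 2 * d2x * u4 + e1y * u1 + 1 / 3 * u2y
  - 2 / 3 * u3x) by (clear - Bx1 By2; lra).
subst e1xy d2xy e2xy d1xy. clear B01 B02 Bx1 Bx2 By1 By2.
(* What remains is linear in the third derivatives, which the differentiated symmetry equations
   eliminate; nonlinear monomials are atoms for [lra]. *)
repeat split; apply f_equal2; lra.
Qed.

(** * The tensor determined by Liouville's invariants *)

Definition lin_comb (r s : R) (d e : nat -> nat -> pt) (a b : nat) : pt :=
  (r * fst (d a b) + s * fst (e a b), r * snd (d a b) + s * snd (e a b)).

(** The bracket is bilinear and alternating, so on the span of two fields it is governed by the
    determinant of the coefficients. *)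
Lemma bracket_lin_comb (v w : pt) (d e : nat -> nat -> pt) (a b : nat) : (a + b <= 2)%nat ->
  let k := fst v * snd w - snd v * fst w in
  bracket_alg (lin_comb (fst v) (snd v) d e) (lin_comb (fst w) (snd w) d e) a b =
  (k * fst (bracket_alg d e a b), k * snd (bracket_alg d e a b)).
Proof.
intros Hab k. unfold k, bracket_alg, lin_comb.
destruct (le2_cases a b Hab) as [[-> ->]|[[-> ->]|[[-> ->]|[[-> ->]|[[-> ->]|[-> ->]]]]]];
 unfold jet_mult; cbn [fst snd]; f_equal; ring.
Qed.

(** This is (dx ^ dy)(v, w) times lambda(xi) eta + lambda(eta) xi, where lambda = L1 dx + L2 dy is
    the form with the Liouville invariants as components. *)
Definition liouville_tensor (u : nat -> nat -> fib -> R) : tensor := fun v w xi eta =>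
  let k := fst v * snd w - snd v * fst w in
  let mixed := fst xi * snd eta + snd xi * fst eta in
  (k * (2 * liouville1 u * (fst xi * fst eta) + liouville2 u * mixed),
   k * (liouville1 u * mixed + 2 * liouville2 u * (snd xi * snd eta))).

(** [H] is spanned by the lifts of (1, 0) and (0, 1), for which [bracket_liouville] computes the
    bracket. Every pair of tangent vectors is the projection of two combinations of these lifts, so
    [tau] has no freedom left. *)
Lemma is_omega2_liouville (theta : J 2) (tau : tensor) :
  is_omega2 theta tau -> tau = liouville_tensor (fun a b i => coef (snd theta i) a b).
Proof.
intros [H [[_ [Hadd [Hscal [Hsym Hbij]]]] [Hb Ht]]].
destruct (Hbij (1, 0)) as [c [[Hc Ec] _]]. destruct (Hbij (0, 1)) as [e [[He Ee] _]].
assert (B : forall a b, (a + b <= 1)%nat -> bracket_alg (vcoef c) (vcoef e) a b = (0, 0)).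
{ intros a b Hab. rewrite <- vcoef_bracket with (p := fst theta) by lia.
  apply rho1_zero_vcoef; [now apply Hb|easy]. }
destruct (bracket_liouville _ (vcoef c) (vcoef e) (jet_symmetries_equations theta c (Hsym c Hc))
  (jet_symmetries_equations theta e (Hsym e He)) Ec Ee B) as [L20 [L11 L02]].
set (comb := fun v : pt => vjet_add (vjet_scal (fst v) c) (vjet_scal (snd v) e)).
assert (HC : forall v, H (comb v)) by (intros; apply Hadd; apply Hscal; assumption).
assert (VC : forall v, vcoef (comb v) = lin_comb (fst v) (snd v) (vcoef c) (vcoef e)).
{ intros v. apply functional_extensionality; intros a. apply functional_extensionality; intros b.
  unfold comb. now rewrite vcoef_add, !vcoef_scal. }
assert (RC : forall v, rho0 (comb v) = v).
{ intros [v1 v2]. unfold rho0. rewrite VC. unfold lin_comb.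
  change (vcoef c 0 0) with (rho0 c). change (vcoef e 0 0) with (rho0 e).
  rewrite Ec, Ee. cbn [fst snd]. f_equal; ring. }
apply functional_extensionality; intros v. apply functional_extensionality; intros w.
rewrite <- (RC v) at 1. rewrite <- (RC w) at 1. rewrite Ht by auto.
apply functional_extensionality; intros xi. apply functional_extensionality; intros eta.
unfold quad_part, liouville_tensor. rewrite !vcoef_bracket, !VC, !bracket_lin_comb by lia.
rewrite L20, L11, L02. cbn [fst snd]. f_equal; ring.
Qed.

Lemma in_g2_wedge2_liouville (u : nat -> nat -> fib -> R) : in_g2_wedge2 (liouville_tensor u).
Proof.
split; [|repeat split].
- intros v w. set (k := fst v * snd w - snd v * fst w).
  (* The coefficients are those found in [bracket_liouville], multiplied by the area of (v, w). *)
  set (zf := fun a b : nat => match a, b with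
    | 2%nat, 0%nat => (k * (2 * liouville1 u), 0)
    | 1%nat, 1%nat => (k * liouville2 u, k * liouville1 u)
    | 0%nat, 2%nat => (0, k * (2 * liouville2 u))
    | _, _ => (0, 0)
    end).
  assert (E : forall a b, (a + b <= 2)%nat -> vcoef (fun s : mindex 2 => zf (ix s) (iy s)) a b =
    zf a b).
  { intros a b Hab. unfold vcoef, coef. destruct le_dec; [|easy].
    unfold ix, iy; cbn [fst snd proj1_sig].
    now rewrite <- surjective_pairing. }
  exists (fun s : mindex 2 => zf (ix s) (iy s)).
  split; [|split; [|split; [|split; [|split]]]].
  + apply vjets_eq. intros a b Hab. rewrite vcoef_rho, E, vcoef_zero by lia.
    destruct a as [|[|a]], b as [|[|b]]; try reflexivity; lia.
  + apply functional_extensionality; intros xi. apply functional_extensionality; intros eta.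
    unfold quad_part, liouville_tensor. rewrite !E by lia. unfold zf, k. cbn [fst snd].
    f_equal; ring.
  + rewrite E by lia. reflexivity.
  + rewrite !E by lia. unfold zf. cbn [fst snd]. ring.
  + rewrite !E by lia. unfold zf. cbn [fst snd]. ring.
  + rewrite E by lia. reflexivity.
- intros v xi eta. unfold liouville_tensor, zero; simpl. unfold prod_zero, zero; simpl.
  f_equal; ring.
- intros v v' w xi eta. unfold liouville_tensor, plus; simpl. unfold prod_plus, plus; simpl.
  f_equal; ring.
- intros r v w xi eta. unfold liouville_tensor, scal; simpl. unfold prod_scal, scal; simpl.
  unfold mult; simpl. f_equal; ring.
- intros v w w' xi eta. unfold liouville_tensor, plus; simpl. unfold prod_plus, plus; simpl.
  f_equal; ring.
- intros r v w xi eta. unfold liouville_tensor, scal; simpl. unfold prod_scal, scal; simpl.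
  unfold mult; simpl. f_equal; ring.
Qed.

(** * Values and invariance of the tensor field *)

(** Any two admissible tensors equal the same Liouville tensor, so the one picked by the choice
    operator is [tau]. *)
Lemma omega2_eq (theta : J 2) (tau : tensor) : is_omega2 theta tau -> omega2 theta = tau.
Proof.
intros H. unfold omega2. destruct excluded_middle_informative as [h|h]; [|now destruct h;
  exists tau].
rewrite (is_omega2_liouville theta tau H). apply is_omega2_liouville.
exact (proj2_sig (constructive_indefinite_description _ h)).
Qed.

Lemma omega2_none (theta : J 2) :
  ~ (exists tau, is_omega2 theta tau) -> omega2 theta = tensor_zero.
Proof. intros H. unfold omega2. now destruct excluded_middle_informative. Qed.

Lemma in_g2_wedge2_zero : in_g2_wedge2 tensor_zero.
Proof.
(* The zero tensor is the Liouville tensor of the equation y'' = 0, all of whose coefficients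
   vanish. *)
replace tensor_zero with (liouville_tensor (fun _ _ _ => 0)); [apply in_g2_wedge2_liouville|].
repeat (apply functional_extensionality; intro).
unfold liouville_tensor, liouville1, liouville2, tensor_zero, zero; simpl.
unfold prod_zero, zero; simpl. f_equal; field.
Qed.

Lemma push_tensor_zero (f : point_transformation) (p : pt) :
  push_tensor f p tensor_zero = tensor_zero.
Proof.
repeat (apply functional_extensionality; intro).
unfold push_tensor, tensor_zero, differential, zero; simpl. unfold prod_zero, zero; simpl.
f_equal; ring.
Qed.

Theorem theorem5p4 :
  (forall theta2 : J 2, in_g2_wedge2 (omega2 theta2)) /\
  (forall (f : point_transformation) (theta2 : J 2),
     pt_dom f (fst theta2) ->
     push_tensor f (fst theta2) (omega2 theta2) = omega2 (prolong 2 f theta2)).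
Proof.
split.
- intros theta. destruct (classic (exists tau, is_omega2 theta tau)) as [[tau H]|H].
  + rewrite (omega2_eq theta tau H), (is_omega2_liouville theta tau H).
    apply in_g2_wedge2_liouville.
  + rewrite omega2_none by easy. apply in_g2_wedge2_zero.
- intros f theta Hp. destruct (classic (exists tau, is_omega2 theta tau)) as [[tau H]|H].
  + rewrite (omega2_eq theta tau H). symmetry. apply omega2_eq. now apply is_omega2_push.
  (* When neither point carries an admissible subspace, both sides are the default tensor zero,
     which the direct image preserves. *)
  + rewrite !omega2_none; [apply push_tensor_zero| |easy].
    intros [tau Ht]. apply H.
    pose proof (is_omega2_push (pt_sym f) (prolong 2 f theta) tau (pt_fun_cod f _ Hp) Ht) as Q.
    rewrite prolong_sym in Q by easy. eexists; exact Q.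
Qed.
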